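(* Let $\psi$ be an admissible wavelet such that $\|\psi\|_{2,\mu_\alpha}^2\le c_\psi$. Then for every nonzero $f\in L^2_\alpha(\mathbb R_+)$, $$-\int_{\mathcal R}|W_\psi f(a,x)|^2\ln\big(|W_\psi f(a,x)|^2\big)\,d\nu_\alpha(a,x)\ \ge\ \|f\|_{2,\mu_\alpha}^2\,\ln\!\left(\frac{c_\psi}{\|\psi\|_{2,\mu_\alpha}^2\,\|f\|_{2,\mu_\alpha}^2}\right)$$ (the left-hand side is well defined in $(-\infty,+\infty]$, with the convention $0\ln0=0$).
   Context: Fix a real number $\alpha>-1/2$. Let $\mu_\alpha$ be the measure on $\mathbb{R}_+=[0,\infty)$ given by $d\mu_\alpha(x)=\frac{x^{2\alpha+1}}{2^\alpha\Gamma(\alpha+1)}\,dx$; for $1\le p<\infty$ let $L^p_\alpha(\mathbb R_+)=L^p(\mathbb R_+,\mu_\alpha)$ with norm $\|f\|_{p,\mu_\alpha}=\left(\int_0^\infty|f|^p\,d\mu_\alpha\right)^{1/p}$, and let $L^\infty_\alpha(\mathbb R_+)$ be the essentially bounded functions. Let $j_\alpha(z)=\Gamma(\alpha+1)\sum_{n\ge0}\frac{(-1)^n}{n!\,\Gamma(n+\alpha+1)}(z/2)^{2n}$. The Hankel transform is $\mathcal H_\alpha f(\xi)=\int_0^\infty f(x)\,j_\alpha(x\xi)\,d\mu_\alpha(x)$ for $f\in L^1_\alpha(\mathbb R_+)$, extended to a unitary operator on $L^2_\alpha(\mathbb R_+)$. For $x\ge0$ the Hankel translation is $\tau_x^\alpha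 f(y)=\frac{\Gamma(\alpha+1)}{\Gamma(1/2)\Gamma(\alpha+1/2)}\int_0^\pi f\big(\sqrt{x^2+y^2+2xy\cos\theta}\big)\sin^{2\alpha}\theta\,d\theta$, and for $a>0$ the dilation is $D_af(x)=a^{\alpha+1}f(ax)$. A nonzero $\psi\in L^1_\alpha(\mathbb R_+)\cap L^\infty_\alpha(\mathbb R_+)$ is an admissible wavelet if $0<c_\psi:=\int_0^\infty|\mathcal H_\alpha\psi(a)|^2\,\frac{da}{a}<\infty$. For such $\psi$ and $f\in L^2_\alpha(\mathbb R_+)$, the Hankel wavelet transform is $W_\psi f(a,x)=c_\psi^{-1/2}\int_0^\infty f(t)\,\overline{\tau_x^\alpha(D_a\psi)(t)}\,d\mu_\alpha(t)$ for $(a,x)\in\mathcal R:=(0,\infty)\times[0,\infty)$. On $\mathcal R$ let $d\nu_\alpha(a,x)=a^{2\alpha+1}\,da\,d\mu_\alpha(x)$, $L^p_\alpha(\mathcal R)=L^p(\mathcal R,\nu_\alpha)$, with norm $\|F\|_{p,\nu_\alpha}$ (and $\|F\|_\infty$ the essential supremum). *)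

(* Defs.v *)
(* mathcomp-analysis (Lebesgue integration on a realType R)
   together with mathcomp-real-closed complex numbers R[i]. *)
From mathcomp Require Import all_boot all_algebra.
From mathcomp Require Import all_classical all_reals all_analysis.
From mathcomp Require Import complex.

Set Implicit Arguments.
Unset Strict Implicit.
Unset Printing Implicit Defensive.

Import GRing.Theory Num.Theory numFieldNormedType.Exports.
Local Open Scope classical_set_scope.
Local Open Scope ring_scope.
Local Open Scope complex_scope.

Section HankelDefs.
Variable R : realType.
Implicit Types (alpha s x y a t xi : R) (f g psi : R -> R[i]).

(* Modulus of a complex number. *)
Definition cmod (z : R[i]) : R :=
  Num.sqrt (complex.Re z ^+ 2 + complex.Im z ^+ 2).

(* Euler's Gamma function  Gamma(s) = int_0^oo t^(s-1) e^(-t) dt  (s > 0). *)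
Definition Gamma s : R :=
  Rintegral lebesgue_measure `](0%R:R), +oo[ (fun t => powR t (s - 1) * expR (- t)).

(* Density of mu_alpha w.r.t. Lebesgue measure on [0,oo):
   x^(2 alpha + 1) / (2^alpha Gamma(alpha+1)). *)
Definition mu_dens alpha x : R :=
  powR x (2 * alpha + 1) / (powR 2 alpha * Gamma (alpha + 1)).

(* Real integral of a complex valued function over D w.r.t. Lebesgue measure,
   taken componentwise. *)
Definition cintegral (D : set R) g : R[i] :=
  (Rintegral lebesgue_measure D (fun x => complex.Re (g x)))
  +i* (Rintegral lebesgue_measure D (fun x => complex.Im (g x))).

(* int_0^oo g dmu_alpha *)
Definition mu_int alpha g : R[i] :=
  cintegral `[(0%R:R), +oo[ (fun x => g x * (mu_dens alpha x)%:C).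

(* int_0^oo |g|^p dmu_alpha  in \bar R *)
Definition Lp_int alpha (p : R) g : \bar R :=
  (\int[lebesgue_measure]_(x in `[(0%R:R), +oo[)
      (powR (cmod (g x)) p * mu_dens alpha x)%:E)%E.

(* ||g||_{2,mu_alpha}^2 *)
Definition L2norm2 alpha g : R := fine (Lp_int alpha 2 g).

(* Measurability of a complex valued function on [0,oo). *)
Definition cmeasurable g : Prop :=
  measurable_fun `[(0%R:R), +oo[ (fun x => complex.Re (g x)) /\
  measurable_fun `[(0%R:R), +oo[ (fun x => complex.Im (g x)).

(* g in L^p_alpha(R_+), 1 <= p < oo *)
Definition in_Lp alpha (p : R) g : Prop :=
  cmeasurable g /\ (Lp_int alpha p g < +oo)%E.

(* g in L^oo_alpha(R_+): mu_alpha-essentially bounded on [0,oo).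
   (mu_alpha and Lebesgue measure have the same null sets on [0,oo).) *)
Definition in_Linf g : Prop :=
  cmeasurable g /\
  exists M : R, {ae lebesgue_measure, forall x, 0 <= x -> cmod (g x) <= M}.

(* g is the zero element (mu_alpha-a.e. zero on [0,oo)). *)
Definition ae_zero g : Prop :=
  {ae lebesgue_measure, forall x, 0 <= x -> g x = 0}.

(* Normalized Bessel function
   j_alpha(z) = Gamma(alpha+1) sum_n (-1)^n/(n! Gamma(n+alpha+1)) (z/2)^(2n). *)
Definition j_bessel alpha (z : R) : R :=
  Gamma (alpha + 1) *
  limn (series (fun n : nat =>
     (-1) ^+ n / ((n`!)%:R * Gamma (n%:R + alpha + 1)) * (z / 2) ^+ (2 * n)) : nat -> R).

(* Hankel transform of g in L^1_alpha. *)
Definition hankel alpha g (xi : R) : R[i] :=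
  mu_int alpha (fun x => g x * (j_bessel alpha (x * xi))%:C).

(* c_psi = int_0^oo |H_alpha psi(a)|^2 da/a *)
Definition c_psi alpha psi : \bar R :=
  (\int[lebesgue_measure]_(a in `](0%R:R), +oo[)
      ((cmod (hankel alpha psi a)) ^+ 2 / a)%:E)%E.

(* Admissible wavelet: nonzero psi in L^1 cap L^oo with 0 < c_psi < oo. *)
Definition admissible alpha psi : Prop :=
  in_Lp alpha 1 psi /\ in_Linf psi /\ ~ ae_zero psi /\
  (0 < c_psi alpha psi)%E /\ (c_psi alpha psi < +oo)%E.

(* Hankel translation tau_x^alpha g (y). *)
Definition htrans alpha x g y : R[i] :=
  (Gamma (alpha + 1) / (Gamma (1 / 2) * Gamma (alpha + 1 / 2)))%:C *
  cintegral `[(0%R:R), pi]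
    (fun th => g (Num.sqrt (x ^+ 2 + y ^+ 2 + 2 * x * y * cos th))
               * (powR (sin th) (2 * alpha))%:C).

(* Dilation D_a g (x) = a^(alpha+1) g(a x). *)
Definition dil alpha a g x : R[i] := (powR a (alpha + 1))%:C * g (a * x).

(* Hankel wavelet transform W_psi f (a, x). *)
Definition hwt alpha psi f (p : R * R) : R[i] :=
  (powR (fine (c_psi alpha psi)) (- (1 / 2)))%:C *
  mu_int alpha (fun t => f t * (htrans alpha p.2 (dil alpha p.1 psi) t)^*).

(* The region (0,oo) x [0,oo) and the density of nu_alpha
   (d nu_alpha = a^(2 alpha+1) da dmu_alpha(x)) w.r.t. Lebesgue measure on R*R. *)
Definition regionR : set (R * R) := `](0%R:R), +oo[ `*` `[(0%R:R), +oo[.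
Definition nu_dens alpha (p : R * R) : R :=
  powR p.1 (2 * alpha + 1) * mu_dens alpha p.2.

(* Integrand of the entropy: -|W|^2 ln |W|^2 (ln 0 = 0 in mathcomp, so 0 ln 0 = 0). *)
Definition entropy_integrand alpha psi f (p : R * R) : R :=
  - ((cmod (hwt alpha psi f p)) ^+ 2 * ln ((cmod (hwt alpha psi f p)) ^+ 2)).

(* - int_R |W|^2 ln |W|^2 dnu_alpha  in \bar R *)
Definition wavelet_entropy alpha psi f : \bar R :=
  (\int[(lebesgue_measure \x lebesgue_measure)%E]_(p in regionR)
      (entropy_integrand alpha psi f p * nu_dens alpha p)%:E)%E.

(* Negative part of the entropy integral (finite <=> LHS well defined in (-oo,+oo]). *)
Definition wavelet_entropy_negpart alpha psi f : \bar R :=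
  (\int[(lebesgue_measure \x lebesgue_measure)%E]_(p in regionR)
      (Num.max (- (entropy_integrand alpha psi f p * nu_dens alpha p)) 0)%:E)%E.

End HankelDefs.

(* Main.v *)
From HB Require Import structures.
Require Import Defs.
From mathcomp Require Import all_boot all_order all_algebra.
From mathcomp Require Import all_classical all_reals all_analysis measurable_realfun.
From mathcomp Require Import complex zify ring lra.
Import Order.TTheory GRing.Theory Num.Theory numFieldNormedType.Exports.

(* Everything is derived from the wavelet Plancherel formula
   int |W f|^2 d nu = |f|^2 and from the pointwise bound |W f|^2 <= M with
   M = |f|^2 |psi|^2 / c_psi (AM-GM on the product of mu_alpha and of the angular
   measure): since - ln is nonincreasing, - |W f|^2 ln |W f|^2 >= - |W f|^2 ln M, which
   integrates to the claim.

   For the Plancherel formula put w(x,y,t) = sqrt(x^2 + y^2 + 2xy cos t), let P be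
   the probability proportional to sin^(2 alpha) t dt on [0, pi] and a = alpha + 1.  Two
   facts carry the harmonic analysis: int_P j(xi w) = j(x xi) j(y xi), proved on
   power series by a Vandermonde identity, and the exchange
   int int G(w(y,x,t), x) dP d mu = int int G(x, w(y,x,t)) dP d mu, which in the
   polar coordinates u = x cos t, v = x sin t is the reflection u -> - y - u.  The
   exchange turns generalized convolutions into products under the Hankel transform.
   Plancherel for bounded integrable h follows by Gaussian regularization:
   int h^2 - int (H h)^2 exp(- r^2 xi^2 / 2) is half a Dirichlet form of the
   heat kernel, which vanishes with r.  The isometry of W is then Plancherel in x
   followed by a scaling in the dilation parameter, first for truncated f, then in
   general by Fatou and a parallelogram inequality. *)

Set Implicit Arguments.
Unset Strict Implicit.
Unset Printing Implicit Defensive.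
Local Open Scope classical_set_scope.
Local Open Scope ring_scope.

(** * Densities and substitutions *)

(** Two normalizations cancel to give the isometry its constant one: on positive scales [nu_alpha]
    is [hK alpha] times the product of [mu_alpha] with itself, and [c_psi] is [hK alpha] times
    [wcst]. Complex functions enter only through their real and imaginary parts, extended evenly to
    the line, so that the modulus of a product becomes a polynomial identity in four reals. The
    harmonic analysis is carried out for abstract measures [m] and [P], known through cosine
    moments, the exchange, Gaussian moments and scaling. A Gaussian regularizes because its
    transform is again Gaussian, hence positive and of mass one; the exchange keeps its translates a
    symmetric Markov kernel, and the second moment [2 a r^2] alone makes the Dirichlet form of a
    uniformly continuous function of bounded support vanish. A recurrent obstacle is that
    [Rintegral] applies [fine]: an infinite inner integral silently becomes [0], so identities are
    proved in the extended reals where possible, and the others need integrability or an argument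
    almost everywhere. *)

Section DensityMeasure.
Local Open Scope ereal_scope.
Context d (T : measurableType d) (R : realType).
Variable m : {measure set T -> \bar R}.

(** The proofs [w0] and [mw] are carried by the term, so that instance inference recovers the
    measure structures declared below. *)
Definition density (w : T -> R) (w0 : forall x, (0 <= w x)%R)
  (mw : measurable_fun setT w) (A : set T) : \bar R :=
  \int[m]_(x in A) (w x)%:E.

Variables (w : T -> R) (w0 : forall x, (0 <= w x)%R) (mw : measurable_fun setT w).

Let mwE (A : set T) : measurable_fun A (EFin \o w).
Proof. by apply/measurable_EFinP; exact: measurable_funTS. Qed.

Let density0 : density w0 mw set0 = 0.
Proof. by rewrite /density integral_set0. Qed.

Let density_ge0 A : 0 <= density w0 mw A.
Proof. by apply: integral_ge0 => x _; rewrite lee_fin. Qed.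

Let density_sigma_additive : semi_sigma_additive (density w0 mw).
Proof.
move=> A mA tA mUA; rewrite /density ge0_integral_bigcup//=.
- by apply: is_cvg_ereal_nneg_natsum_cond => n _ _; exact: density_ge0.
- by move=> x _; rewrite lee_fin.
Qed.

HB.instance Definition _ := isMeasure.Build _ _ _
  (density w0 mw) density0 density_ge0 density_sigma_additive.

Import HBNNSimple.

(** Monotone convergence along simple approximations of [f] on both sides; for a simple function
    each side is a finite sum over its range. *)
Lemma ge0_integral_density (f : T -> \bar R) :
  measurable_fun setT f -> (forall x, 0 <= f x) ->
  \int[density w0 mw]_x f x = \int[m]_x (f x * (w x)%:E).
Proof.
move=> mf f0.
pose f_ := nnsfun_approx measurableT mf.
have cf x : (EFin \o f_ ^~ x) n @[n --> \oo] --> f x.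
  by apply: cvg_nnsfun_approx.
have ndf x a b : (a <= b)%N -> ((f_ a x)%:E <= (f_ b x)%:E)%E.
  by move=> ab; rewrite lee_fin; exact/lefP/nd_nnsfun_approx.
transitivity (limn (fun n => \int[density w0 mw]_x (f_ n x)%:E)).
  rewrite -monotone_convergence//.
  - by apply: eq_integral => x _; apply/esym/cvg_lim => //; exact: cf.
  - by move=> n; exact/measurable_EFinP/measurable_funP.
  - by move=> n x _; rewrite lee_fin.
  - by move=> x _ a b ab; exact: ndf.
transitivity (limn (fun n => \int[m]_x ((f_ n x)%:E * (w x)%:E))); last first.
  rewrite -monotone_convergence//.
  - apply: eq_integral => x _; apply/cvg_lim => //.
    by apply: cvgeZr => //; exact: cf.
  - move=> n; apply: emeasurable_funM; last exact: mwE.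
    exact/measurable_EFinP/measurable_funP.
  - by move=> n x _; rewrite mule_ge0// lee_fin.
  - by move=> x _ a b ab; rewrite lee_wpmul2r ?lee_fin//; exact: ndf.
congr (limn _); apply/funext => n.
have mfr (r : R) : measurable (f_ n @^-1` [set r]) by exact: measurable_sfunP.
rewrite integralT_nnsfun sintegralE.
transitivity (\int[m]_x \sum_(r \in range (f_ n)) (r%:E * (\1_(f_ n @^-1` [set r]) x * w x)%:E)); last first.
  apply: eq_integral => x _; rewrite [in RHS]fimfunE -fsumEFin// ge0_mule_fsuml; last first.
    by move=> r; rewrite lee_fin; apply: nnfun_muleindic_ge0.
  apply: eq_fsbigr => r _.
  by rewrite !EFinM muleA.
rewrite ge0_integral_fsum//; last 2 first.
- move=> r; apply: measurable_funeM; apply/measurable_EFinP; apply: measurable_funM => //.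
- move=> r x _; rewrite -EFinM lee_fin mulrA mulr_ge0//.
  by have := nnfun_muleindic_ge0 (f_ n) r x; rewrite -EFinM lee_fin.
apply: eq_fsbigr => r; rewrite inE => -[x _ <-].
rewrite ge0_integralZl//; last 3 first.
- by apply/measurable_EFinP; apply: measurable_funM.
- by move=> y _; rewrite lee_fin mulr_ge0.
- by rewrite lee_fin.
congr (_ * _); rewrite /density [LHS]integral_mkcond; apply: eq_integral => y _.
by rewrite patchE indicE; case: ifPn; rewrite ?mul1r ?mul0r.
Qed.

Lemma integral_density (f : T -> \bar R) :
  measurable_fun setT f ->
  \int[density w0 mw]_x f x = \int[m]_x (f x * (w x)%:E).
Proof.
move=> mf; rewrite [LHS]integralE [RHS]integralE.
rewrite !ge0_integral_density//; last 2 first.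
- exact: measurable_funeneg.
- exact: measurable_funepos.
congr (_ - _); apply: eq_integral => x _.
- by rewrite !funeposE maxe_pMl ?mul0e// lee_fin.
- by rewrite !funenegE -mulNe maxe_pMl ?mul0e// lee_fin.
Qed.

End DensityMeasure.

Section DensitySigmaFinite.
Local Open Scope ereal_scope.
Context d (T : measurableType d) (R : realType).
Variable m : {sigma_finite_measure set T -> \bar R}.
Variables (w : T -> R) (w0 : forall x, (0 <= w x)%R) (mw : measurable_fun setT w).

(** An exhaustion of [m] is cut by the sublevel sets [w <= n]: on each piece the density is at most
    [n], so its mass stays finite. *)
Let density_sigma_finite : sigma_finite setT (density m w0 mw).
Proof.
have /sigma_finiteP[F [TF ndF Foo]] := sigma_finiteT m.
exists (fun n => F n `&` (w @^-1` `]-oo, (n%:R)%R]%classic)).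
  apply/esym; rewrite -subTset => x _.
  have [i _ Fix] : (\bigcup_n F n) x by rewrite -TF.
  exists (maxn i (Num.truncn (w x)).+1) => //; split.
    by apply: (subsetPset _ _ (ndF i _ (leq_maxl _ _))).
  rewrite /= in_itv/= (le_trans (ltW (truncnS_gt _)))// ler_nat leq_maxr//.
move=> n; have [mFn Fnoo] := Foo n.
have mwn : measurable (w @^-1` `]-oo, (n%:R)%R]%classic).
  by rewrite -[X in measurable X]setTI; exact: mw.
split; first exact: measurableI.
apply: (@le_lt_trans _ _ (\int[m]_(x in F n `&` (w @^-1` `]-oo, (n%:R)%R]%classic)) n%:R%:E)).
  apply: ge0_le_integral => //.
  - exact: measurableI.
  - by move=> x _; rewrite lee_fin.
  - by apply/measurable_EFinP; exact: measurable_funTS.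
  - by move=> x [_]; rewrite /= in_itv/= lee_fin.
rewrite integral_cst; last exact: measurableI.
apply: (@le_lt_trans _ _ (n%:R%:E * m (F n))).
  by rewrite lee_wpmul2l ?lee_fin// le_measure ?inE//; exact: measurableI.
by rewrite lte_mul_pinfty// ?lee_fin.
Qed.

HB.instance Definition _ := Measure_isSigmaFinite.Build _ _ _
  (density m w0 mw) density_sigma_finite.

End DensitySigmaFinite.

Section Substitution.
Local Open Scope ereal_scope.
Context (R : realType).
Notation mu := (@lebesgue_measure R).

(** No derivative is involved: it is enough to know the image measure on half-open intervals. Adding
    Lebesgue measure on the complement of [I] makes the image agree with length on all of them, and
    uniqueness of Lebesgue measure concludes. The alternative [rho x = 0] or [I (phi x)] allows [f]
    to be replaced by its restriction to [I]. *)
Lemma substitution_density (rho phi : R -> R) (I : set R) :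
  (forall x, (0 <= rho x)%R) -> measurable_fun setT rho ->
  measurable_fun setT phi -> measurable I ->
  (forall x, rho x = 0%R \/ I (phi x)) ->
  (forall a b, (a < b)%R ->
     \int[mu]_(x in phi @^-1` `]a, b]%classic) (rho x)%:E = mu (`]a, b]%classic `&` I)) ->
  forall f : R -> \bar R, measurable_fun setT f -> (forall x, 0 <= f x) ->
  \int[mu]_x (f (phi x) * (rho x)%:E) = \int[mu]_(y in I) f y.
Proof.
move=> rho0 mrho mphi mI rhoI ocE f mf f0.
pose nu0 : {measure set (measurableTypeR R) -> \bar R} :=
  pushforward (density mu rho0 mrho) (phi : measurableTypeR R -> measurableTypeR R).
pose nu : {measure set (measurableTypeR R) -> \bar R} := nu0 mphi.
have mCI : measurable (~` I) by exact: measurableC.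
have i0 (x : R) : (0 <= \1_(~` I) x :> R)%R by [].
have mi : measurable_fun setT (\1_(~` I) : R -> R) by exact: measurable_indic.
pose la : {measure set (measurableTypeR R) -> \bar R} := density mu i0 mi.
have laE A : measurable A -> la A = mu (A `&` ~` I).
  by move=> mA; rewrite /la /= /density integral_indic// setIC.
pose s : {measure set (measurableTypeR R) -> \bar R} := measure_add nu la.
have sD A : s A = nu A + la A by exact: measure_addE.
have sE A : measurable A -> mu A = s A.
  move=> mA; apply: lebesgue_measure_unique => // X [[a b]] _ <-.
  rewrite sD laE// /nu /= /pushforward /density.
  have [ab|ba] := ltP a b; last first.
    by rewrite set_itv_ge ?bnd_simp -?leNgt// preimage_set0 integral_set0 set0I !measure0 adde0.
  rewrite ocE// -measureU//=.
  - by rewrite -setIUr setUv setIT.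
  - exact: measurableI.
  - exact: measurableI.
  - by rewrite setIACA setICr setI0.
have nuI A : measurable A -> A `<=` I -> nu A = mu A.
  move=> mA AI; rewrite sE// sD laE//.
  by rewrite (_ : A `&` ~` I = set0) ?measure0 ?adde0// -subset0 => x [/AI].
transitivity (\int[nu]_(y in I) f y); last first.
  by apply: eq_measure_integral => A mA AI; exact: nuI.
rewrite [RHS]integral_mkcond.
have mfI : measurable_fun setT (f \_ I).
  by apply/(measurable_restrictT f mI); exact: measurable_funTS.
have fI0 y : 0 <= (f \_ I) y by rewrite patchE; case: ifP.
have m1 : measurable_fun setT (f \_ I \o phi) by exact: measurableT_comp.
have p1 x : 0 <= (f \_ I \o phi) x by exact: fI0.
rewrite ge0_integral_pushforward// preimage_setT ge0_integral_density//.
apply: eq_integral => x _ /=; rewrite patchE.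
have [->|Ix] := rhoI x; first by rewrite !mule0.
by rewrite mem_set.
Qed.

Lemma integral_lebesgue_scale (k : R) (f : R -> \bar R) : (0 < k)%R ->
  measurable_fun setT f -> (forall x, 0 <= f x) ->
  \int[mu]_x f (k * x)%R = k^-1%:E * \int[mu]_x f x.
Proof.
move=> k0 mf f0.
have mk : measurable_fun setT (fun x : R => k * x)%R by exact: mulrl_measurable.
rewrite -[X in _ = _ * X](@substitution_density (fun=> k) (fun x => k * x)%R setT)//; last 3 first.
- by move=> x; exact: ltW.
- by move=> x; right.
- move=> a b ab; rewrite setIT (_ : _ @^-1` _ = `](a / k)%R, (b / k)%R]%classic); last first.
    apply/seteqP; split => x /=; rewrite !in_itv/=.
      by rewrite ltr_pdivrMr// ler_pdivlMr// ![(x * k)%R]mulrC.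
    by rewrite ltr_pdivrMr// ler_pdivlMr// ![(x * k)%R]mulrC.
  rewrite integral_cst//= !lebesgue_measure_itv/= !lte_fin ab ltr_pM2r ?invr_gt0// ab.
  by rewrite -!EFinB -EFinM -mulrBl mulrC divfK// gt_eqF.
rewrite ge0_integralZr//; last 2 first.
- exact: (measurableT_comp mf mk).
- by rewrite lee_fin ltW.
by rewrite muleC -muleA -EFinM divff ?mule1// gt_eqF.
Qed.

Lemma integral_lebesgue_reflect (c : R) (f : R -> \bar R) :
  measurable_fun setT f -> (forall x, 0 <= f x) ->
  \int[mu]_x f (c - x)%R = \int[mu]_x f x.
Proof.
move=> mf f0.
rewrite -[RHS](@substitution_density (fun=> 1%R) (fun x => c - x)%R setT)//; last 3 first.
- by apply: measurable_funB.
- by move=> x; right.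
- move=> a b ab; rewrite setIT (_ : _ @^-1` _ = `[(c - b)%R, (c - a)%R[%classic); last first.
    apply/seteqP; split => x /=; rewrite !in_itv/=.
      by move=> /andP[? ?]; apply/andP; split; lra.
    by move=> /andP[? ?]; apply/andP; split; lra.
  rewrite integral_cst//= mul1e !lebesgue_measure_itv/= !lte_fin ab ltrD2l ltrN2 ab.
  by rewrite -!EFinB; congr EFin; ring.
by apply: eq_integral => x _; rewrite mule1.
Qed.

(** The weight is cut off at negative [x], where [x^2/2] would cover the half-line a second time;
    the preimage of an interval is then []p, q]], and its weighted mass is an increment of the
    primitive [x^2/2]. *)
Lemma integral_half_square (f : R -> \bar R) :
  measurable_fun setT f -> (forall x, 0 <= f x) ->
  \int[mu]_(x in `]0%R, +oo[) (f (x ^+ 2 / 2)%R * x%:E) = \int[mu]_(x in `]0%R, +oo[) f x.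
Proof.
move=> mf f0.
have m0 : measurable (`]0%R, +oo[%classic : set R) by [].
pose rho (x : R) := (x * \1_(`]0%R, +oo[%classic : set R) x)%R.
have rhoE (x : R) : rho x = if (0 < x)%R then x else 0%R.
  rewrite /rho indicE; case: ifPn => x0.
    by rewrite mem_set ?mulr1//= in_itv/= x0.
  by rewrite memNset ?mulr0//= in_itv/= (negbTE x0).
rewrite -[RHS](@substitution_density rho (fun x => x ^+ 2 / 2)%R `]0%R, +oo[%classic)//.
- rewrite integral_mkcond; apply: eq_integral => x _; rewrite patchE rhoE.
  case: ifPn => [|/negP]; first by rewrite inE /= in_itv/= andbT => ->.
  by rewrite inE /= in_itv/= andbT => /negP/negbTE ->; rewrite mule0.
- by move=> x; rewrite rhoE; case: ifPn => // /ltW.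
- by apply: measurable_funM => //; exact: measurable_indic.
- by apply: measurable_funM => //; exact: measurable_funX.
- move=> x; rewrite rhoE; case: ifPn => x0; [right|by left].
  by rewrite /= in_itv/= andbT divr_gt0// exprn_gt0.
move=> a b ab.
have [b0|b0] := leP b 0%R.
  rewrite (_ : _ `&` _ = set0) ?measure0; last first.
    by rewrite -subset0 => x [/=]; rewrite !in_itv/= andbT => /andP[_ xb]; lra.
  rewrite integral_mkcond integral0_eq// => x _; rewrite patchE; case: ifPn => //.
  rewrite inE /= in_itv/= rhoE => /andP[_ xb]; case: ifPn => // x0.
  have : (0 < x ^+ 2 / 2)%R by rewrite divr_gt0// exprn_gt0.
  by move=> ?; exfalso; lra.
(* Only the part of []a, b]] above [0] has preimages with [x > 0]. *)
pose a' := Num.max a 0%R.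
have a'0 : (0 <= a')%R by rewrite /a' le_max lexx orbT.
have a'b : (a' < b)%R by rewrite /a' gt_max ab b0.
pose p := Num.sqrt (2 * a'); pose q := Num.sqrt (2 * b).
have pq : (p < q)%R by rewrite /p /q ltr_sqrt; lra.
have p0 : (0 <= p)%R by exact: sqrtr_ge0.
have p2 : (p ^+ 2 = 2 * a')%R by rewrite sqr_sqrtr//; lra.
have q2 : (q ^+ 2 = 2 * b)%R by rewrite sqr_sqrtr//; lra.
transitivity (\int[mu]_(x in `]p, q]) x%:E).
  rewrite [LHS]integral_mkcond [RHS]integral_mkcond; apply: eq_integral => x _.
  rewrite !patchE rhoE.
  have [x0|x0] := ltP 0%R x; last first.
    rewrite [X in _ = if X then _ else _](_ : _ = false); first by case: ifP.
    by apply: memNset => /=; rewrite in_itv/= => /andP[px _]; lra.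
  have -> : (x \in (fun x => x ^+ 2 / 2)%R @^-1` `]a, b]%classic) = (x \in `]p, q]%classic).
    apply/idP/idP; rewrite !inE/= !in_itv/= => /andP[h1 h2].
      apply/andP; split.
        rewrite -(ltr_pXn2r (n:=2))// ?nnegrE ?(ltW x0)// p2 /a'.
        have : (0 < x ^+ 2)%R by rewrite exprn_gt0.
        by case: (leP a 0%R); lra.
      by rewrite -(ler_pXn2r (n:=2))// ?nnegrE ?(ltW x0) ?sqrtr_ge0// q2; lra.
    have : (p ^+ 2 < x ^+ 2)%R by rewrite ltr_pXn2r// ?nnegrE// ltW.
    have : (x ^+ 2 <= q ^+ 2)%R by rewrite ler_pXn2r// ?nnegrE ?sqrtr_ge0// ltW.
    rewrite p2 q2 => h3 h4; apply/andP; split; last by lra.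
    have : (a <= a')%R by rewrite /a' le_max lexx.
    by lra.
  by case: ifPn.
rewrite integral_itv_obnd_cbnd; last by apply/measurable_EFinP.
rewrite (@continuous_FTC2 _ (fun x => x) (fun x => x ^+ 2 / 2)%R)//.
- rewrite -EFinB p2 q2 (_ : `]a, b]%classic `&` _ = `]a', b]%classic).
    by rewrite lebesgue_measure_itv/= lte_fin a'b -EFinB; congr EFin; field.
  apply/seteqP; split => x /=; rewrite !in_itv/= andbT /a' gt_max.
    by move=> [/andP[-> ->] ->].
  by move=> /andP[/andP[-> ->] ->].
- by apply: continuous_subspaceT => x; exact: cvg_id.
- have dF (x : R) : derivable (fun x : R => x ^+ 2 / 2)%R x 1 by [].
  have cF : continuous (fun x : R => x ^+ 2 / 2)%R.
    by move=> x; apply: differentiable_continuous; apply/derivable1_diffP.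
  split => //.
  + exact/cvg_at_right_filter/cF.
  + exact/cvg_at_left_filter/cF.
- move=> x _; rewrite derive1E deriveM// derive_cst scaler0 add0r exp_derive.
  by rewrite /GRing.scale/= mulr1 expr1; field.
Qed.

End Substitution.

(** Used with [c = pi]: the left side is the difference of two arctangent tails, the right side the
    length of []a, b]] inside []0, c[]. *)
Lemma clamp_length (R : realType) (a b c : R) : a < b -> 0 < c ->
  Num.max (- (c / 2)) (Num.min (c / 2) (c / 2 - a)) -
   Num.max (- (c / 2)) (Num.min (c / 2) (c / 2 - b)) =
   if Num.max a 0 < Num.min b c then Num.min b c - Num.max a 0 else 0.
Proof.
move=> ab c0.
have [h1|h1] := leP b c; have [h2|h2] := leP a 0;
  have [h3|h3] := leP (c / 2) (c / 2 - b); have [h4|h4] := leP (c / 2) (c / 2 - a);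
  rewrite ?(max_r (_ : - (c / 2) <= c / 2)); try lra.
all: do 2? case: (leP (- (c / 2)) _) => ?; case: ifPn; rewrite ?ltNge ?negbK; lra.
Qed.

(** * The cotangent as coordinate on the half-circle *)

Section AtanSubstitution.
Local Open Scope ereal_scope.
Context (R : realType).
Notation mu := (@lebesgue_measure R).

(** The derivative of [atan], that is, the Jacobian of the substitution [t = pi/2 - atan c]. *)
Definition cauchy_fun (c : R) : R := (1 + c ^+ 2)^-1.

Lemma cauchy_fun_ge0 c : (0 <= cauchy_fun c)%R.
Proof. by rewrite invr_ge0 addr_ge0// sqr_ge0. Qed.

Lemma continuous_cauchy_fun : continuous cauchy_fun.
Proof.
move=> x; apply: cvgV; first by rewrite gt_eqF// ltr_wpDr ?sqr_ge0.
by apply: cvgD; [exact: cvg_cst|exact: exprn_continuous].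
Qed.

Lemma measurable_cauchy_fun : measurable_fun setT cauchy_fun.
Proof. exact: continuous_measurable_fun continuous_cauchy_fun. Qed.

Lemma integral_cauchy_fun_ge (p : R) :
  \int[mu]_(c in `[p, +oo[) (cauchy_fun c)%:E = (pi / 2 - atan p)%:E.
Proof.
rewrite (@ge0_continuous_FTC2y _ _ atan p (pi / 2))//.
- by move=> x _; exact: cauchy_fun_ge0.
- by apply: continuous_subspaceT; exact: continuous_cauchy_fun.
- exact: cvgy_atan.
- exact/cvg_at_right_filter/continuous_atan.
- by move=> x _; rewrite derive1_atan.
Qed.

Lemma integral_cauchy_fun : \int[mu]_c (cauchy_fun c)%:E = pi%:E.
Proof.
have mf : measurable_fun setT (fun c => (cauchy_fun c)%:E).
  by apply/measurable_EFinP; exact: measurable_cauchy_fun.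
have h0 : \int[mu]_(c in `[0%R, +oo[) (cauchy_fun c)%:E = (pi / 2)%:E.
  by rewrite integral_cauchy_fun_ge atan0 subr0.
rewrite -(setC0) -{1}(set_itvoc0 0%R) setCitv/= ge0_integral_setU//=; first last.
- by rewrite disj_set2E; apply/eqP; rewrite -subset0 => x []/= /[!in_itv]/=; rewrite andbT; lra.
- by move=> x _; rewrite lee_fin cauchy_fun_ge0.
- by apply: measurable_funTS.
rewrite integral_itv_obnd_cbnd; last by apply: measurable_funTS.
rewrite h0 (_ : \int[mu]_(x in `]-oo, 0%R]) _ = \int[mu]_(x in `]-oo, 0%R]) (cauchy_fun (- x))%:E).
  rewrite -(@ge0_integration_by_substitution0 _ (fun x => (cauchy_fun x)%:E))// ?h0.
    by rewrite -EFinD; congr EFin; field.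
  by move=> x; rewrite lee_fin cauchy_fun_ge0.
by apply: eq_integral => x _; rewrite /cauchy_fun sqrrN.
Qed.

(** Clamping [t] to [[- pi/2, pi/2]] treats the empty, the full and the generic preimage by one
    formula. *)
Lemma integral_cauchy_fun_atan_ge (t : R) :
  \int[mu]_(c in atan @^-1` `[t, +oo[%classic) (cauchy_fun c)%:E =
  (pi / 2 - Num.max (- (pi / 2)) (Num.min (pi / 2) t))%:E.
Proof.
have p0 := pi_gt0 R.
have [tl|tl] := leP (pi / 2)%R t.
  rewrite (_ : _ @^-1` _ = set0) ?integral_set0.
    by rewrite max_r ?subrr//; lra.
  rewrite -subset0 => x /=; rewrite in_itv/= andbT => h.
  by have := atan_ltpi2 x; lra.
have [tl2|tl2] := leP t (- (pi / 2))%R.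
  rewrite (_ : _ @^-1` _ = setT) ?integral_cauchy_fun; first by congr EFin; field.
  apply/seteqP; split => // x _ /=; rewrite in_itv/= andbT.
  by have := atan_gtNpi2 x; lra.
rewrite (_ : _ @^-1` _ = `[tan t, +oo[%classic).
  rewrite integral_cauchy_fun_ge tanK ?in_itv/= ?tl ?tl2//.
have E : atan (tan t) = t by rewrite tanK// in_itv/= tl tl2.
apply/seteqP; split => x /=; rewrite !in_itv/= !andbT.
  by rewrite !leNgt; apply: contra => h; rewrite -E; exact: lt_atan.
by move=> h; rewrite -E; exact: le_atan.
Qed.

(** Here [c] is the cotangent of [t]. The preimage of []a, b]] is a difference of two sets
    [atan c >= t1] and [atan c >= t2], whose masses are known. *)
Lemma integral_atan_substitution (f : R -> \bar R) :
  measurable_fun setT f -> (forall x, 0 <= f x) ->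
  \int[mu]_c (f (pi / 2 - atan c)%R * (cauchy_fun c)%:E) = \int[mu]_(t in `]0%R, pi[) f t.
Proof.
move=> mf f0; have p0 := pi_gt0 R.
have matan : measurable_fun setT (@atan R).
  by apply: continuous_measurable_fun => x; exact: continuous_atan.
apply: (@substitution_density _ cauchy_fun (fun c => pi / 2 - atan c)%R `]0%R, pi[%classic) => //.
- exact: cauchy_fun_ge0.
- exact: measurable_cauchy_fun.
- exact: measurable_funB.
- move=> x; right; rewrite /= in_itv/=.
  by have := atan_gtNpi2 x; have := atan_ltpi2 x; move=> *; apply/andP; split; lra.
move=> a b ab.
pose t1 := (pi / 2 - b)%R; pose t2 := (pi / 2 - a)%R.
have mpre t : measurable (atan @^-1` `[t, +oo[%classic : set R).
  by rewrite -[X in measurable X]setTI; exact: matan.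
have mcau (D : set R) : measurable_fun D (fun c => (cauchy_fun c)%:E).
  by apply/measurable_EFinP; apply: measurable_funTS; exact: measurable_cauchy_fun.
set L := \int[mu]_(x in _) _.
have mS : measurable ((fun c => pi / 2 - atan c)%R @^-1` `]a, b]%classic : set R).
  by rewrite -[X in measurable X]setTI; apply: measurable_funB.
(* The difference of tails is written as a sum, and solved for [L] once both tails are seen to be
   finite. *)
have : \int[mu]_(c in atan @^-1` `[t1, +oo[%classic) (cauchy_fun c)%:E =
       L + \int[mu]_(c in atan @^-1` `[t2, +oo[%classic) (cauchy_fun c)%:E.
  rewrite -ge0_integral_setU//.
  - congr (integral _ _ _); apply/seteqP; split => x /=; rewrite !in_itv/= !andbT /t1 /t2.
      move=> h; have [h2|h2] := leP (pi / 2 - a)%R (atan x); [by right|left].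
      by apply/andP; split; lra.
    by move=> [/andP[h1 h2]|h]; lra.
  - exact: mpre.
  - exact: mcau.
  - by move=> x _; rewrite lee_fin cauchy_fun_ge0.
  - rewrite disj_set2E; apply/eqP; rewrite -subset0 => x []/=; rewrite !in_itv/= andbT /t2.
    by move=> /andP[h1 h2] h3; lra.
rewrite !integral_cauchy_fun_atan_ge => h.
have {h} -> : L = (Num.max (- (pi / 2)) (Num.min (pi / 2) t2) - Num.max (- (pi / 2)) (Num.min (pi / 2) t1))%:E.
  move: h; case: L => [l||]//; rewrite -EFinD => -[h]; congr EFin; lra.
have -> : mu (`]a, b]%classic `&` `]0%R, pi[%classic) =
   (if (Num.max a 0 < Num.min b pi)%R then Num.min b pi - Num.max a 0 else 0)%:E.
  have [bp|bp] := ltP b pi.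
    rewrite (_ : _ `&` _ = `]Num.max a 0%R, b]%classic).
      by rewrite lebesgue_measure_itv/= lte_fin; case: ifP => // _; rewrite -EFinB.
    apply/seteqP; split => x /=; rewrite !in_itv/= gt_max.
      by move=> [/andP[-> ->] /andP[-> _]].
    by move=> /andP[/andP[-> h1] h2]; rewrite h1 h2/=; split => //; lra.
  rewrite (_ : _ `&` _ = `]Num.max a 0%R, pi[%classic).
    by rewrite lebesgue_measure_itv/= lte_fin; case: ifP => // _; rewrite -EFinB.
  apply/seteqP; split => x /=; rewrite !in_itv/= gt_max.
    by move=> [/andP[-> _] /andP[-> ->]].
  by move=> /andP[/andP[-> h1] h2]; rewrite h1 h2/=; split => //; lra.
by congr EFin; rewrite /t1 /t2; apply: clamp_length => //; exact: pi_gt0.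
Qed.

End AtanSubstitution.

(** * The Gamma function *)

Section SeriesExchange.
Local Open Scope ereal_scope.
Context d (T : measurableType d) (R : realType).
Variable m : {measure set T -> \bar R}.

(** Dominated convergence for the partial sums; the dominating function is the sum of the [|f k|],
    integrable because its integral is at most the sum of the [u k]. *)
Lemma integral_series (f : nat -> T -> R) (g : T -> R) (u : nat -> R) :
  (forall n, measurable_fun setT (f n)) ->
  (forall n, \int[m]_x `|f n x|%:E <= (u n)%:E) ->
  cvgn (series u) ->
  (forall x, series (f ^~ x) n @[n --> \oo] --> g x) ->
  m.-integrable setT (EFin \o g) /\
  series (fun k => Rintegral m setT (f k)) n @[n --> \oo] --> Rintegral m setT g.
Proof.
move=> mf fu cu fg.
pose G x := \sum_(k <oo) `|f k x|%:E.
have mabs k : measurable_fun setT (fun x => `|f k x|%:E).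
  by apply/measurable_EFinP; apply: measurableT_comp.
have u0 k : (0 <= u k)%R.
  by rewrite -lee_fin (le_trans _ (fu k))// integral_ge0.
have mG : measurable_fun setT G.
  by apply: ge0_emeasurable_sum => // k x _ _; rewrite lee_fin.
have G0 x : 0 <= G x by apply: nneseries_ge0 => k _ _; rewrite lee_fin.
have su : \sum_(k <oo) (u k)%:E = (limn (series u))%:E.
  rewrite -EFin_lim//; congr (limn _); apply/funext => n /=.
  by rewrite /series/= sumEFin.
have iG : m.-integrable setT G.
  apply/integrableP; split => //.
  under eq_integral do rewrite gee0_abs//.
  rewrite integral_nneseries//.
  apply: (@le_lt_trans _ _ (\sum_(k <oo) (u k)%:E)); last by rewrite su ltry.
  by apply: lee_nneseries => // k _ _; exact: integral_ge0.
have igf k : m.-integrable setT (EFin \o f k).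
  apply/integrableP; split; first exact/measurable_EFinP.
  by apply: (le_lt_trans (fu k)); rewrite ltry.
have mg : measurable_fun setT g.
  apply: (@measurable_fun_cvg _ _ _ _ (fun n x => series (f ^~ x) n)) => //.
  by move=> n; rewrite /series/=; apply: measurable_sum.
have fG x n : `|(series (f ^~ x) n)%:E| <= G x.
  apply: (@le_trans _ _ (\sum_(0 <= k < n) `|f k x|%:E)).
    by rewrite sumEFin lee_fin /series/= ler_norm_sum.
  by apply: nneseries_lim_ge => k _ _; rewrite lee_fin.
have [] := @dominated_convergence _ _ _ m setT measurableT
  (fun n x => (series (f ^~ x) n)%:E) (EFin \o g) G.
- by move=> n; apply/measurable_EFinP; rewrite /series/=; apply: measurable_sum.
- exact/measurable_EFinP.
- by apply: aeW => x _; apply: cvg_EFin; [exact: nearW|exact: fg].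
- exact: iG.
- by apply: aeW => x n _; exact: fG.
move=> ig _ cv; split => //.
have gfin : \int[m]_x (g x)%:E \is a fin_num by exact: integrable_fin_num.
rewrite -[X in _ --> X]/(fine (\int[m]_x (g x)%:E)).
have -> : series (fun k => Rintegral m setT (f k)) =
  (fun n => fine (\int[m]_x (series (f ^~ x) n)%:E)).
  apply/funext => n; rewrite /series/=.
  under [in RHS]eq_integral do rewrite -sumEFin.
  rewrite integral_sum//= -sum_fine// => k _.
  exact: (integrable_fin_num measurableT (igf k)).
apply: fine_cvg; rewrite fineK//.
Qed.

End SeriesExchange.

Lemma indic_ge (R : realType) (a x : R) :
  \1_(`[a, +oo[%classic : set R) x = (a <= x)%R%:R :> R.
Proof.
by rewrite indicE; congr (nat_of_bool _)%:R; apply/idP/idP; rewrite inE/= in_itv/= andbT.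
Qed.

Lemma indic_gt (R : realType) (a x : R) :
  \1_(`]a, +oo[%classic : set R) x = (a < x)%R%:R :> R.
Proof.
by rewrite indicE; congr (nat_of_bool _)%:R; apply/idP/idP; rewrite inE/= in_itv/= andbT.
Qed.

Lemma powRD_gt0 (R : realType) (t p q : R) : 0 < t -> t `^ (p + q) = t `^ p * t `^ q.
Proof. by move=> t0; rewrite powRD// (gt_eqF t0) implybT. Qed.

Lemma powRB1 (R : realType) (t p : R) : 0 < t -> t `^ (p - 1) = t `^ p / t.
Proof.
move=> t0; rewrite powRB; first by rewrite powRr1// ltW.
by rewrite (gt_eqF t0) implybT.
Qed.

(** * Euler's integral: recurrence, finiteness, Gaussian form *)

Section GammaFunction.
Local Open Scope ereal_scope.
Context (R : realType).
Notation mu := (@lebesgue_measure R).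

(** The extended-real value behind [Gamma], which would turn a divergent integral into [0];
    finiteness becomes a provable statement. *)
Definition gamma_int (p : R) : \bar R :=
  \int[mu]_(t in `]0%R, +oo[) (powR t (p - 1) * expR (- t))%:E.

Lemma measurable_expRN (D : set R) : measurable_fun D (fun t : R => expR (- t)).
Proof. by apply: measurable_funTS; apply: measurableT_comp. Qed.

Lemma measurable_powR_expRN (p : R) (D : set R) :
  measurable_fun D (fun t : R => powR t p * expR (- t))%R.
Proof.
apply: measurable_funM; last exact: measurable_expRN.
by apply: measurable_funTS; exact: measurable_powR.
Qed.

Lemma gamma_int_ge0 (p : R) : 0 <= gamma_int p.
Proof. by apply: integral_ge0 => t _; rewrite lee_fin mulr_ge0 ?powR_ge0 ?expR_ge0. Qed.

Lemma derive_expRNM (k x : R) : is_derive x 1%R (fun t : R => expR (- (k * t))) (- k * expR (- (k * x)))%R.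
Proof.
have h : is_derive x 1%R (fun t : R => - (k * t))%R (- k)%R.
  have -> : (fun t : R => - (k * t))%R = (- k)%R \*: (@id R).
    by apply/funext => t /=; rewrite /GRing.scale/= mulNr.
  by apply: is_derive_eq; rewrite /GRing.scale/= mulr1.
rewrite mulrC; exact: (@is_derive1_comp R expR (fun t : R => - (k * t))%R x _ _ (is_derive_expR _) h).
Qed.

Lemma integral_expRN_ge (k a : R) : (0 < k)%R ->
  \int[mu]_(t in `[a, +oo[) (expR (- (k * t)))%:E = (expR (- (k * a)) / k)%:E.
Proof.
move=> k0.
have dF (x : R) : is_derive x 1%R (fun t : R => - k^-1 * expR (- (k * t)))%R (expR (- (k * x)))%R.
  have h := derive_expRNM k x.
  have -> : (fun t : R => - k^-1 * expR (- (k * t)))%R = (- k^-1)%R \*: (fun t : R => expR (- (k * t)))%R.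
    by apply/funext.
  by apply: is_derive_eq; rewrite /GRing.scale/= mulrA mulrNN mulVf ?mul1r// gt_eqF.
have cF : continuous (fun t : R => - k^-1 * expR (- (k * t)))%R.
  by move=> x; apply: differentiable_continuous; apply/derivable1_diffP; apply: ex_derive.
have cf : continuous (fun t : R => expR (- (k * t)))%R.
  move=> x; apply: differentiable_continuous; apply/derivable1_diffP.
  by have := derive_expRNM k x => h; apply: ex_derive.
rewrite (@ge0_continuous_FTC2y _ _ (fun t : R => - k^-1 * expR (- (k * t)))%R a 0)//.
- by rewrite -EFinB; congr EFin; rewrite sub0r mulNr opprK mulrC.
- exact: continuous_subspaceT.
- rewrite -[X in _ --> X](mulr0 (- k^-1)%R); apply: cvgM; first exact: cvg_cst.
  have : expR (- u)%R @[u --> +oo%R] --> (0 : R)%R by exact: cvgr_expR.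
  move=> h; apply: (cvg_comp (fun t => k * t)%R (fun u => expR (- u))%R _ h).
  by apply: gt0_cvgMry => //; exact: cvg_id.
- exact/cvg_at_right_filter/cF.
- by move=> x _; rewrite derive1E; apply: derive_val.
Qed.

(** Supplies the factor [1/p] in the recurrence of the Gamma integral. *)
Lemma integral_powRN_ge1 (p : R) : (0 < p)%R ->
  \int[mu]_(t in `[1%R, +oo[) (powR t (- p - 1))%:E = (p^-1)%:E.
Proof.
move=> p0.

have dF (x : R) : (0 < x)%R -> is_derive x 1%R (fun t : R => - p^-1 * powR t (- p))%R (powR x (- p - 1))%R.
  move=> x0; have h := is_derive1_powR (- p) x0.
  have -> : (fun t : R => - p^-1 * powR t (- p))%R = (- p^-1)%R \*: (fun t : R => powR t (- p))%R.
    by apply/funext.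
  apply: is_derive_eq; rewrite /GRing.scale/= mulrA mulrNN mulVf ?mul1r// gt_eqF//.
have cF (q x : R) : (0 < x)%R -> {for x, continuous (fun t : R => powR t q)}.
  move=> x0; apply: differentiable_continuous; apply/derivable1_diffP.
  by have h := is_derive1_powR q x0; apply: ex_derive.
have lny : @ln R x @[x --> +oo%R] --> +oo%R.
  apply/cvgryPge => A; near=> x.
  have x0 : (0 < x)%R by near: x; exact: nbhs_pinfty_gt.
  rewrite -(expRK A) ler_ln ?posrE ?expR_gt0//.
rewrite (@ge0_continuous_FTC2y _ _ (fun t : R => - p^-1 * powR t (- p))%R 1 0)//.
- by rewrite -EFinB; congr EFin; rewrite sub0r mulNr opprK powR1/= mulr1.
- by move=> x _; exact: powR_ge0.
- apply: continuous_in_subspaceT => x; rewrite inE/= in_itv/= andbT => x1.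
  by apply: cF; exact: lt_le_trans x1.
- rewrite -[X in _ --> X](mulr0 (- p^-1)%R); apply: cvgM; first exact: cvg_cst.
  apply: (@cvg_trans _ (expR (- (p * ln x)) @[x --> +oo%R])).
    by apply: near_eq_cvg; near=> x; rewrite /powR gt_eqF ?mulNr//.
  apply: (cvg_comp (fun t => p * ln t)%R (fun u => expR (- u))%R _ (@cvgr_expR R)).
  exact: gt0_cvgMry.
- by move=> x x1; have h := dF x (lt_trans ltr01 x1); apply: ex_derive.
- apply/cvg_at_right_filter; apply: cvgM; first exact: cvg_cst.
  by apply: cF.
- move=> x; rewrite in_itv/= andbT => x1; rewrite derive1E.
  by have h := dF x (lt_trans ltr01 x1); apply: derive_val.
Unshelve. all: by end_near. Qed.

(** Tonelli replaces integration by parts and works before finiteness is known. For [t > 0],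
    [t^(p-1) e^(-t)] is the integral over [l >= 1] of [t^p e^(-l t)]; integrating in [t] first and
    scaling leaves [l^(-p-1)] times the integral for [p + 1]. *)
Lemma gamma_intS (p : R) : (0 < p)%R -> gamma_int p = p^-1%:E * gamma_int (p + 1).
Proof.
move=> p0.
pose i1 (l : R) : R := \1_(`[1%R, +oo[%classic : set R) l.
pose i0 (t : R) : R := \1_(`]0%R, +oo[%classic : set R) t.
have mi1 : measurable_fun setT i1 by exact: measurable_indic.
have mi0 : measurable_fun setT i0 by exact: measurable_indic.
have i1E l : i1 l = (1 <= l)%R%:R%R.
  exact: indic_ge.
have i0E t : i0 t = (0 < t)%R%:R%R.
  exact: indic_gt.
pose F (z : R * R) : \bar R := (i1 z.1 * (i0 z.2 * (powR z.2 p * expR (- (z.1 * z.2)))))%:E.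
have mF : measurable_fun setT F.
  apply/measurable_EFinP; apply: measurable_funM.
    exact: (measurableT_comp mi1 measurable_fst).
  apply: measurable_funM; first exact: (measurableT_comp mi0 measurable_snd).
  apply: measurable_funM; first exact: (measurableT_comp (measurable_powR p) measurable_snd).
  by apply: measurableT_comp => //; apply: measurableT_comp => //; exact: measurable_funM.
have F0 z : 0 <= F z.
  by rewrite lee_fin !mulr_ge0 ?powR_ge0 ?expR_ge0 ?i1E ?i0E.
have gE q : gamma_int q = \int[mu]_t (i0 t * (powR t (q - 1) * expR (- t)))%:E.
  rewrite /gamma_int integral_mkcond; apply: eq_integral => t _.
  rewrite patchE /i0 indicE; case: ifPn => _; first by rewrite mul1r.
  by rewrite mul0r.
have mg q : measurable_fun setT (fun t : R => (i0 t * (powR t (q - 1) * expR (- t)))%:E).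
  by apply/measurable_EFinP; apply: measurable_funM => //; exact: measurable_powR_expRN.
have g0 q (t : R) : 0 <= (i0 t * (powR t (q - 1) * expR (- t)))%:E.
  by rewrite lee_fin !mulr_ge0 ?powR_ge0 ?expR_ge0 ?i0E.
transitivity (\int[mu]_t \int[mu]_l F (l, t)).
  rewrite gE; apply: eq_integral => t _; rewrite /F/= i0E.
  have [t0|t0] := ltP 0%R t; last first.
    by rewrite mul0r integral0_eq// => l _; rewrite mul0r mulr0.
  rewrite mul1r.
  have me : measurable_fun setT (fun l : R => expR (- (l * t))).
    apply: measurableT_comp => //; apply: measurableT_comp => //.
    by apply: measurable_funM => //; exact: measurable_cst.
  transitivity (\int[mu]_l ((powR t p)%:E * (i1 l * expR (- (l * t)))%:E)); last first.
    by apply: eq_integral => l _; rewrite -EFinM; congr EFin; rewrite mulr1n; ring.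
  rewrite ge0_integralZl_EFin//=; last 3 first.
  - by move=> l _; rewrite lee_fin mulr_ge0 ?expR_ge0// i1E.
  - by apply/measurable_EFinP; apply: measurable_funM.
  - exact: powR_ge0.
  transitivity ((powR t p)%:E * \int[mu]_(l in `[1%R, +oo[) (expR (- (t * l)))%:E); last first.
    congr (_ * _); rewrite integral_mkcond; apply: eq_integral => l _.
    by rewrite patchE /i1 indicE [(t * l)%R]mulrC; case: ifPn => _; rewrite ?mul1r ?mul0r.
  rewrite integral_expRN_ge// -EFinM mulr1; congr EFin.
  by rewrite powRB1//; field; rewrite gt_eqF.
rewrite -(@fubini_tonelli _ _ _ _ _ mu mu F)//.
rewrite -(integral_powRN_ge1 p0) [X in _ = X * _]integral_mkcond -ge0_integralZr//; last 3 first.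
- apply/(measurable_restrictT _ _).1 => //; apply/measurable_EFinP; apply: measurable_funTS.
  exact: measurable_powR.
- by move=> l _; rewrite patchE; case: ifPn => // _; rewrite lee_fin powR_ge0.
- exact: gamma_int_ge0.
apply: eq_integral => l _; rewrite patchE /F/=.
case: ifPn => l1; last first.
  rewrite mul0e integral0_eq// => t _.
  by rewrite /i1 indicE (negbTE l1) mul0r.
have {}l1 : (1 <= l)%R by move: l1; rewrite inE/= in_itv/= andbT.
have l0 : (0 < l)%R by exact: lt_le_trans l1.
pose h (t : R) := (i0 t * (powR t (p + 1 - 1) * expR (- t)))%:E.
have -> : gamma_int (p + 1) = l%:E * \int[mu]_t h (l * t)%R.
  rewrite gE (@integral_lebesgue_scale R l h l0 (mg (p + 1)%R) (g0 (p + 1)%R)).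
  by rewrite muleA -EFinM divff ?mul1e// gt_eqF.
have mhl : measurable_fun setT (fun t : R => h (l * t)%R).
  exact (measurableT_comp (mg (p + 1)%R) (mulrl_measurable l)).
have hl0 (t : R) : setT t -> 0 <= h (l * t)%R by move=> _; exact: g0.
have l0' : 0 <= (powR l (- p - 1))%:E * l%:E by rewrite -EFinM lee_fin mulr_ge0 ?powR_ge0// ltW.
rewrite muleA -(ge0_integralZl mu measurableT mhl hl0 l0').
apply: eq_integral => t _; rewrite /h -!EFinM; congr EFin.
rewrite i1E l1 mul1r !i0E pmulr_rgt0//.
have [t0|t0] := ltP 0%R t; last by rewrite !mul0r mulr0.
rewrite !mul1r addrK powRM ?ltW// powRB1// powRN.
by field; rewrite ?gt_eqF ?powR_gt0.
Qed.


Lemma gamma_int1 : gamma_int 1 = 1.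
Proof.
rewrite /gamma_int integral_itv_obnd_cbnd; last first.
  by apply/measurable_EFinP; exact: measurable_powR_expRN.
transitivity (\int[mu]_(t in `[0%R, +oo[) (expR (- (1 * t)))%:E).
  by apply: eq_integral => t _; rewrite subrr powRr0 !mul1r.
by rewrite integral_expRN_ge// mulr0 oppr0 expR0 divr1.
Qed.

Lemma gamma_int_nat n : gamma_int n.+1%:R = (n`!%:R)%:E.
Proof.
elim: n => [|n IH]; first by rewrite gamma_int1.
move: IH; rewrite (@gamma_intS n.+1%:R)// natr1 factS => h.
rewrite natrM EFinM -h muleA -EFinM divff ?mul1e//.
Qed.

(** For [q >= 1] the estimate [t^(q-1) <= 1 + t^n] reduces to the integer values; the recurrence
    then reaches every [p > 0]. *)
Lemma gamma_int_lty (p : R) : (0 < p)%R -> gamma_int p < +oo.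
Proof.
have H q : (1 <= q)%R -> gamma_int q < +oo.
  move=> q1; pose n := (Num.truncn q).+1.
  have qn : (q <= n%:R)%R by rewrite ltW// truncnS_gt.
  apply: (@le_lt_trans _ _ (gamma_int 1 + gamma_int n.+1%:R)); last first.
    by rewrite gamma_int1 gamma_int_nat -EFinD ltry.
  rewrite /gamma_int -ge0_integralD//=; last 4 first.
  - by move=> t _; rewrite lee_fin mulr_ge0 ?powR_ge0 ?expR_ge0.
  - by apply/measurable_EFinP; exact: measurable_powR_expRN.
  - by move=> t _; rewrite lee_fin mulr_ge0 ?powR_ge0 ?expR_ge0.
  - by apply/measurable_EFinP; exact: measurable_powR_expRN.
  apply: ge0_le_integral => //=.
  - by move=> t _; rewrite lee_fin mulr_ge0 ?powR_ge0 ?expR_ge0.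
  - by apply/measurable_EFinP; exact: measurable_powR_expRN.
  - apply/measurable_EFinP; apply: measurable_funD; exact: measurable_powR_expRN.
  move=> t; rewrite in_itv/= andbT => t0.
  rewrite -EFinD lee_fin -mulrDl ler_wpM2r ?expR_ge0// subrr powRr0.
  have [t1|t1] := leP t 1%R.
    rewrite (@le_trans _ _ 1%R)//; last by rewrite lerDl powR_ge0.
    rewrite -[leRHS](powRr0 t); apply: ger_powR; [by rewrite t0|lra].
  rewrite (@le_trans _ _ (powR t (n.+1%:R - 1)))// ?lerDr//.
  apply: ler_powR; [exact: ltW|rewrite -natr1; lra].
move=> p0; rewrite gamma_intS//.
by rewrite lte_mul_pinfty ?lee_fin ?invr_ge0 ?ltW// H// lerDr ltW.
Qed.

(** For exponents [q >= 1] the integrand is at least [e^(-2)] on [[1, 2]]; the recurrence covers the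
    remaining [p]. *)
Lemma gamma_int_gt0 (p : R) : (0 < p)%R -> 0 < gamma_int p.
Proof.
have H q : (1 <= q)%R -> 0 < gamma_int q.
  move=> q1; apply: (@lt_le_trans _ _ (\int[mu]_(t in `[1%R, 2%R]) (expR (- 2))%:E)).
    rewrite integral_cst//= lebesgue_measure_itv/= lte_fin ltr1n/= -EFinB -EFinM lte_fin.
    by rewrite mulr_gt0 ?expR_gt0//; lra.
  apply: (@le_trans _ _ (\int[mu]_(t in `[1%R, 2%R]) (powR t (q - 1) * expR (- t))%:E)).
    apply: ge0_le_integral => //=.
    - by apply/measurable_EFinP; exact: measurable_powR_expRN.
    move=> t; rewrite in_itv/= => /andP[t1 t2]; rewrite lee_fin.
    rewrite -[leLHS]mul1r ler_pM ?expR_ge0// ?ler_expR ?lerN2//.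
    have : (powR t 0 <= powR t (q - 1))%R by apply: ler_powR => //; lra.
    by rewrite powRr0.
  apply: ge0_subset_integral => //=.
  - by apply/measurable_EFinP; exact: measurable_powR_expRN.
  - by move=> t _; rewrite lee_fin mulr_ge0 ?powR_ge0 ?expR_ge0.
  - by move=> t /=; rewrite !in_itv/= andbT => /andP[t1 _]; exact: lt_le_trans t1.
move=> p0; rewrite gamma_intS//.
by rewrite mule_gt0 ?lte_fin ?invr_gt0// H// lerDr ltW.
Qed.

Lemma gammaE (p : R) : (0 < p)%R -> (Gamma p)%:E = gamma_int p.
Proof.
by move=> p0; rewrite /Gamma /Rintegral fineK// ge0_fin_numE ?gamma_int_lty ?gamma_int_ge0.
Qed.

Lemma gamma_gt0 (p : R) : (0 < p)%R -> (0 < Gamma p :> R)%R.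
Proof. by move=> p0; rewrite -lte_fin gammaE// gamma_int_gt0. Qed.

Lemma gammaS (p : R) : (0 < p)%R -> Gamma (p + 1) = (p * Gamma p :> R)%R.
Proof.
move=> p0; apply: EFin_inj; rewrite EFinM !gammaE ?addr_gt0// (gamma_intS p0).
by rewrite muleA -EFinM divff ?mul1e// gt_eqF.
Qed.

(* The Gaussian form of Gamma, through [t = x^2/2]. *)
Lemma integral_gauss_powR (p : R) : (0 < p)%R ->
  \int[mu]_(x in `]0%R, +oo[) (powR x (2 * p - 1) * expR (- (x ^+ 2 / 2)))%:E =
  (powR 2 (p - 1) * Gamma p)%:E.
Proof.
move=> p0; rewrite EFinM gammaE// /gamma_int.
have mf : measurable_fun setT (fun t : R => (powR t (p - 1) * expR (- t))%:E).
  by apply/measurable_EFinP; exact: measurable_powR_expRN.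
rewrite -(integral_half_square mf); last first.
  by move=> t; rewrite lee_fin mulr_ge0 ?powR_ge0 ?expR_ge0.
rewrite -ge0_integralZl//=; last 2 first.
- apply: emeasurable_funM; last by apply/measurable_EFinP.
  apply/measurable_EFinP; apply: measurable_funTS.
  have mh : measurable_fun setT (fun x : R => x ^+ 2 / 2)%R.
    by apply: measurable_funM => //; exact: measurable_funX.
  exact (measurableT_comp (@measurable_powR_expRN (p - 1) setT) mh).
- move=> x; rewrite /= in_itv/= andbT => x0.
  by rewrite -EFinM lee_fin !mulr_ge0 ?powR_ge0 ?expR_ge0// ltW.
apply: eq_integral => x; rewrite inE/= in_itv/= andbT => x0.
rewrite -!EFinM; congr EFin.
rewrite [RHS](_ : _ = (powR 2 (p - 1) * powR (x ^+ 2 / 2) (p - 1) * x) * expR (- (x ^+ 2 / 2)))%R; last by ring.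
congr (_ * _)%R.
rewrite powRM ?sqr_ge0// (_ : (2 * p - 1 = (p - 1) + (p - 1) + 1)%R); last by ring.
rewrite (powRD_gt0 (p - 1 + (p - 1)) 1 x0) (powRD_gt0 (p - 1) (p - 1) x0) powRr1 ?ltW//.
rewrite expr2 powRM ?ltW// -[(2^-1)%R]powR_inv1// -powRrM mulN1r powRN.
by field; rewrite ?gt_eqF ?powR_gt0.
Qed.

End GammaFunction.

(** * Polar coordinates *)

Ltac mfun := repeat first
 [ exact: measurable_fst | exact: measurable_snd | exact: measurable_id
 | exact: measurable_cst | assumption
 | apply: measurable_funM | apply: measurable_funD | apply: measurable_funB
 | apply: measurable_funX | apply: measurable_fun_pair ].

Lemma sin_atan (R : realType) (c : R) : sin (atan c) = c * (Num.sqrt (1 + c ^+ 2))^-1.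
Proof.
have h : 0 < cos (atan c) by rewrite cos_atan invr_gt0 sqrtr_gt0 ltr_wpDr ?sqr_ge0.
by rewrite -cos_atan -[X in _ = X * _]atanK /tan divfK// gt_eqF.
Qed.

Lemma measurable_sin (R : realType) : measurable_fun setT (@sin R).
Proof. by apply: continuous_measurable_fun; exact: continuous_sin. Qed.

Lemma measurable_cos (R : realType) : measurable_fun setT (@cos R).
Proof. by apply: continuous_measurable_fun; exact: continuous_cos. Qed.

Lemma measurable_sqrt (R : realType) : measurable_fun setT (@Num.sqrt R).
Proof. by apply: continuous_measurable_fun; exact: sqrt_continuous. Qed.

Section PolarCoordinates.
Local Open Scope ereal_scope.
Context (R : realType).
Notation mu := (@lebesgue_measure R).

Lemma integral_itv0y (f : R -> \bar R) :
  \int[mu]_(x in `]0%R, +oo[) f x = \int[mu]_x ((0 < x)%R%:R%:E * f x).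
Proof.
rewrite integral_mkcond; apply: eq_integral => x _; rewrite patchE.
case: ifPn => [|/negP]; rewrite inE/= in_itv/= andbT.
  by move=> ->; rewrite mul1e.
by move=> /negP/negbTE ->; rewrite mul0e.
Qed.

Lemma measurable_gt0 : measurable_fun setT (fun x : R => (0 < x)%R%:R : R).
Proof.
have -> : (fun x : R => (0 < x)%R%:R : R) = \1_(`]0%R, +oo[%classic : set R).
  by apply/funext => x; rewrite indic_gt.
exact: measurable_indic.
Qed.

(** On each horizontal line put [u = v c], exchange [v] and [c], then put [v = r sg c]. The factor
    [sg c] squared is the Jacobian of the cotangent substitution, which turns [c] into the angle. *)
Lemma integral_polar (F : R * R -> \bar R) :
  measurable_fun setT F -> (forall z, 0 <= F z) ->
  \int[mu]_(r in `]0%R, +oo[) \int[mu]_(t in `]0%R, pi[) (r%:E * F (r * cos t, r * sin t)%R) =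
  \int[mu]_(v in `]0%R, +oo[) \int[mu]_u F (u, v).
Proof.
move=> mF F0; rewrite !integral_itv0y; apply/esym.
(* The sine of the angle in []0, pi[] whose cotangent is [c]. *)
pose sg (c : R) := (Num.sqrt (1 + c ^+ 2))^-1%R.
have sg0 c : (0 < sg c)%R by rewrite invr_gt0 sqrtr_gt0 ltr_wpDr ?sqr_ge0.
have sg2 c : (sg c * sg c)%R = cauchy_fun c.
  by rewrite -invfM -expr2 sqr_sqrtr// addr_ge0// sqr_ge0.
have msg : measurable_fun setT sg.
  have -> : sg = (fun c => Num.sqrt (cauchy_fun c)).
    by apply/funext => c; rewrite -sg2 -expr2 sqrtr_sqr gtr0_norm.
  exact (measurableT_comp (@measurable_sqrt R) (@measurable_cauchy_fun R)).
have mfst : measurable_fun setT (fun z : R * R => ((0 < z.1)%R%:R : R)).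
  exact (measurableT_comp measurable_gt0 measurable_fst).
pose H (z : R * R) := ((0 < z.1)%R%:R * z.1)%:E * F (z.1 * z.2, z.1)%R.
have mH : measurable_fun setT H.
  apply: emeasurable_funM; first by apply/measurable_EFinP; mfun.
  by apply: (measurableT_comp mF); mfun.
have g0 (x : R) : (0 <= (0 < x)%R%:R * x :> R)%R.
  by have [/ltW|] := ltP 0%R x; rewrite ?mul1r ?mul0r.
have H0 z : 0 <= H z by rewrite mule_ge0// lee_fin.
transitivity (\int[mu]_v \int[mu]_c H (v, c)).
  apply: eq_integral => v _; rewrite /H/=.
  have [v0|v0] := ltP 0%R v; last first.
    by rewrite mul0e integral0_eq// => c _; rewrite mul0r mul0e.
  have mFv : measurable_fun setT (fun u : R => F (u, v)).
    by apply: (measurableT_comp mF); mfun.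
  have mFv' : measurable_fun setT (fun c : R => F (v * c, v)%R).
    by apply: (measurableT_comp mF); mfun.
  rewrite mul1r mul1e ge0_integralZl//; last by rewrite lee_fin ltW.
  rewrite (@integral_lebesgue_scale _ v (fun u => F (u, v)))//.
  by rewrite muleA -EFinM divff ?mul1e// gt_eqF.
rewrite (@fubini_tonelli _ _ _ _ _ mu mu H)//.
pose H2 (z : R * R) := ((0 < z.1)%R%:R * z.1)%:E * F (z.1 * (sg z.2 * z.2), z.1 * sg z.2)%R * (cauchy_fun z.2)%:E.
have msnd : measurable_fun setT (fun z : R * R => sg z.2).
  exact (measurableT_comp msg measurable_snd).
have mH2 : measurable_fun setT H2.
  apply: emeasurable_funM; last first.
    by apply/measurable_EFinP; exact (measurableT_comp (@measurable_cauchy_fun R) measurable_snd).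
  apply: emeasurable_funM; first by apply/measurable_EFinP; mfun.
  by apply: (measurableT_comp mF); mfun.
have H20 z : 0 <= H2 z by rewrite !mule_ge0// lee_fin ?cauchy_fun_ge0.
transitivity (\int[mu]_c \int[mu]_r H2 (r, c)).
  apply: eq_integral => c _.
  have mHc : measurable_fun setT (fun v : R => H (v, c)).
    by apply: (measurableT_comp mH); mfun.
  have mHc' : measurable_fun setT (fun v : R => H (sg c * v, c)%R).
    by apply: (measurableT_comp mH); mfun.
  transitivity ((sg c)%:E * \int[mu]_r H (sg c * r, c)%R).
    rewrite (@integral_lebesgue_scale _ (sg c) (fun v => H (v, c)))//.
    by rewrite muleA -EFinM divff ?mul1e// gt_eqF.
  rewrite -ge0_integralZl//; last by rewrite lee_fin ltW.
  apply: eq_integral => r _; rewrite /H /H2/= pmulr_rgt0// -sg2.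
  have -> : (sg c * r * c = r * (sg c * c))%R by ring.
  rewrite (mulrC (sg c) r) muleC -!muleA [F _ * _]muleC !muleA -!EFinM.
  by rewrite [RHS]muleAC -EFinM; congr (_%:E * _); ring.
rewrite -(@fubini_tonelli _ _ _ _ _ mu mu H2)//.
apply: eq_integral => r _; rewrite /H2/=.
pose f (t : R) := ((0 < r)%R%:R * r)%:E * F (r * cos t, r * sin t)%R.
have mFf : measurable_fun setT (fun t : R => F (r * cos t, r * sin t)%R).
  have := @measurable_sin R; have := @measurable_cos R => mc ms.
  by apply: (measurableT_comp mF); mfun.
have mf : measurable_fun setT f by apply: emeasurable_funM.
have f0 t : 0 <= f t by rewrite mule_ge0// lee_fin.
transitivity (\int[mu]_c (f (pi / 2 - atan c)%R * (cauchy_fun c)%:E)).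
  apply: eq_integral => c _; congr (_ * _); rewrite /f; congr (_ * F (_, _)).
    have -> : (pi / 2 - atan c = - (atan c - pi / 2))%R by ring.
    by rewrite cosN cosBpihalf sin_atan [(c * _)%R]mulrC.
  have -> : (pi / 2 - atan c = - (atan c - pi / 2))%R by ring.
  by rewrite sinN sinBpihalf opprK cos_atan.
rewrite integral_atan_substitution//.
have [r0|r0] := ltP 0%R r.
  by rewrite mul1e; apply: eq_integral => t _; rewrite /f r0 mul1r.
by rewrite mul0e integral0_eq// => t _; rewrite /f ltNge r0 mul0r mul0e.
Qed.

End PolarCoordinates.

(** * The measures of the Hankel setting *)

Section HankelMeasures.
Context (R : realType).
Notation mu := (@lebesgue_measure R).
Implicit Types alpha x t : R.

(** The denominator of [mu_dens]. It reappears as the ratio of [c_psi] to [wcst] and of [nu_alpha]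
    to the product of [mu_alpha] with itself. *)
Definition hK alpha : R := powR 2 alpha * Gamma (alpha + 1).

(** The constant of [htrans], which gives the angular measure [hP] total mass one. *)
Definition cS alpha : R := Gamma (alpha + 1) / (Gamma (1 / 2) * Gamma (alpha + 1 / 2)).

Lemma Gamma_ge0 (p : R) : 0 <= Gamma p.
Proof.
by apply: Rintegral_ge0 => t _; rewrite mulr_ge0 ?powR_ge0 ?expR_ge0.
Qed.

Lemma hK_ge0 alpha : 0 <= hK alpha.
Proof. by rewrite mulr_ge0 ?powR_ge0 ?Gamma_ge0. Qed.

Lemma cS_ge0 alpha : 0 <= cS alpha.
Proof. by rewrite divr_ge0 ?mulr_ge0 ?Gamma_ge0. Qed.

(** The indicator moves the domain into the density, so that [hmu] is a measure on the whole line
    and later integrals run over [setT]. *)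
Definition hdens alpha x : R := mu_dens alpha x * \1_(`[0, +oo[%classic : set R) x.

Definition tdens alpha t : R :=
  cS alpha * powR (sin t) (2 * alpha) * \1_(`[0, pi]%classic : set R) t.

Lemma mu_dens_ge0 alpha x : 0 <= mu_dens alpha x.
Proof. by rewrite /mu_dens divr_ge0 ?powR_ge0// hK_ge0. Qed.

Lemma hdens_ge0 alpha x : 0 <= hdens alpha x.
Proof. by rewrite mulr_ge0// mu_dens_ge0. Qed.

Lemma measurable_mu_dens alpha : measurable_fun setT (mu_dens alpha).
Proof. by apply: measurable_funM => //; exact: measurable_powR. Qed.

Lemma measurable_hdens alpha : measurable_fun setT (hdens alpha).
Proof.
apply: measurable_funM; first exact: measurable_mu_dens.
exact: measurable_indic.
Qed.

Lemma tdens_ge0 alpha t : 0 <= tdens alpha t.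
Proof. by rewrite mulr_ge0// mulr_ge0 ?cS_ge0 ?powR_ge0. Qed.

Lemma measurable_tdens alpha : measurable_fun setT (tdens alpha).
Proof.
apply: measurable_funM; last exact: measurable_indic.
apply: measurable_funM => //.
exact (measurableT_comp (measurable_powR (2 * alpha)) (@measurable_sin R)).
Qed.

Definition hmu alpha : set (measurableTypeR R) -> \bar R :=
  density mu (hdens_ge0 alpha) (measurable_hdens alpha).
HB.instance Definition _ alpha := Measure.on (hmu alpha).
HB.instance Definition _ alpha := SigmaFiniteMeasure.on (hmu alpha).

Definition hP alpha : set (measurableTypeR R) -> \bar R :=
  density mu (tdens_ge0 alpha) (measurable_tdens alpha).
HB.instance Definition _ alpha := Measure.on (hP alpha).
HB.instance Definition _ alpha := SigmaFiniteMeasure.on (hP alpha).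

Local Open Scope ereal_scope.

Lemma integral_hmu alpha (g : R -> \bar R) : measurable_fun setT g ->
  \int[hmu alpha]_x g x = \int[mu]_(x in `[0%R, +oo[) (g x * (mu_dens alpha x)%:E).
Proof.
move=> mg; rewrite integral_density// [RHS]integral_mkcond; apply: eq_integral => x _.
by rewrite patchE /hdens indicE; case: ifPn => _; rewrite ?mulr1 ?mulr0 ?mule0.
Qed.

Lemma integral_hP alpha (g : R -> \bar R) : measurable_fun setT g ->
  \int[hP alpha]_t g t =
  \int[mu]_(t in `[0%R, pi]) (g t * (cS alpha * powR (sin t) (2 * alpha))%:E).
Proof.
move=> mg; rewrite integral_density// [RHS]integral_mkcond; apply: eq_integral => x _.
by rewrite patchE /tdens indicE; case: ifPn => _; rewrite ?mulr1 ?mulr0 ?mule0.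
Qed.

Lemma ge0_integral_hmu alpha (g : R -> \bar R) : measurable_fun setT g ->
  (forall x, 0 <= g x) ->
  \int[hmu alpha]_x g x =
  (hK alpha)^-1%:E * \int[mu]_(x in `]0%R, +oo[) (g x * (powR x (2 * alpha + 1))%:E).
Proof.
move=> mg g0; rewrite integral_hmu//.
have mp : measurable_fun setT (fun x : R => (powR x (2 * alpha + 1))%:E).
  by apply/measurable_EFinP; exact: measurable_powR.
rewrite -ge0_integralZl//; last 3 first.
- by apply: measurable_funTS; apply: emeasurable_funM.
- by move=> x _; rewrite mule_ge0// lee_fin powR_ge0.
- by rewrite lee_fin invr_ge0 hK_ge0.
rewrite integral_itv_obnd_cbnd; last first.
  apply: measurable_funTS; apply: emeasurable_funM => //; exact: emeasurable_funM.
apply: eq_integral => x _; rewrite /mu_dens EFinM.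
by rewrite [(_^-1)%:E * _]muleC muleA.
Qed.

Lemma ge0_integral_hP alpha (g : R -> \bar R) : measurable_fun setT g ->
  (forall x, 0 <= g x) ->
  \int[hP alpha]_x g x =
  (cS alpha)%:E * \int[mu]_(t in `]0%R, pi[) (g t * (powR (sin t) (2 * alpha))%:E).
Proof.
move=> mg g0; rewrite integral_hP//.
have mp : measurable_fun setT (fun t : R => (powR (sin t) (2 * alpha))%:E).
  apply/measurable_EFinP.
  exact (measurableT_comp (measurable_powR (2 * alpha)) (@measurable_sin R)).
rewrite -ge0_integralZl//; last 3 first.
- by apply: measurable_funTS; apply: emeasurable_funM.
- by move=> x _; rewrite mule_ge0// lee_fin powR_ge0.
- by rewrite lee_fin cS_ge0.
rewrite integral_itv_bndoo; last first.
  apply: measurable_funTS; apply: emeasurable_funM => //.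
  by apply/measurable_EFinP; apply: measurable_funM => //; exact/measurable_EFinP.
apply: eq_integral => x _; rewrite EFinM.
by rewrite muleCA.
Qed.

Lemma integral_itv_oo (a b : R) (f : R -> \bar R) :
  \int[mu]_(x in `]a, b[) f x = \int[mu]_x ((a < x < b)%R%:R%:E * f x).
Proof.
rewrite integral_mkcond; apply: eq_integral => x _; rewrite patchE.
case: ifPn => [|/negP]; rewrite inE/= in_itv/=.
  by move=> ->; rewrite mul1e.
by move=> /negP/negbTE ->; rewrite mul0e.
Qed.

Lemma ge0_integral_hP_reflect alpha (g : R -> \bar R) : measurable_fun setT g ->
  (forall x, 0 <= g x) ->
  \int[hP alpha]_t g (pi - t)%R = \int[hP alpha]_t g t.
Proof.
move=> mg g0.
have mr : measurable_fun setT (fun t : R => pi - t)%R by exact: measurable_funB.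
rewrite ge0_integral_hP//; last exact (measurableT_comp mg mr).
rewrite ge0_integral_hP//; congr (_ * _); rewrite !integral_itv_oo.
pose h (t : R) := (0 < t < pi)%R%:R%:E * (g t * (powR (sin t) (2 * alpha))%:E).
have mi : measurable_fun setT (fun t : R => ((0 < t < pi)%R%:R : R)).
  have -> : (fun t : R => ((0 < t < pi)%R%:R : R)) = \1_(`]0%R, pi[%classic : set R).
    apply/funext => t; rewrite indicE; congr (nat_of_bool _)%:R%R.
    by apply/idP/idP; rewrite inE/= in_itv/=.
  exact: measurable_indic.
have mh : measurable_fun setT h.
  apply: emeasurable_funM; first exact/measurable_EFinP.
  apply: emeasurable_funM => //; apply/measurable_EFinP.
  exact (measurableT_comp (measurable_powR (2 * alpha)) (@measurable_sin R)).
have h0 t : 0 <= h t by rewrite !mule_ge0// lee_fin powR_ge0.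
rewrite -[RHS](integral_lebesgue_reflect pi mh h0).
apply: eq_integral => t _; rewrite /h; congr (_ * (_ * _)).
  congr ((nat_of_bool _)%:R%:E)%R.
  by apply/idP/idP => /andP[h1 h2]; apply/andP; split; lra.
by rewrite sinB sinpi cospi mul0r mulN1r sub0r opprK.
Qed.

Lemma integral_hP_reflect alpha (g : R -> \bar R) : measurable_fun setT g ->
  \int[hP alpha]_t g (pi - t)%R = \int[hP alpha]_t g t.
Proof.
move=> mg; rewrite [LHS]integralE [RHS]integralE.
rewrite -(ge0_integral_hP_reflect alpha (measurable_funepos mg))//.
rewrite -(ge0_integral_hP_reflect alpha (measurable_funeneg mg))//.
by congr (_ - _); apply: eq_integral => t _; rewrite ?funeposE ?funenegE.
Qed.

Lemma ge0_integral_hmu_scale alpha (k : R) (g : R -> \bar R) : (0 < k)%R ->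
  measurable_fun setT g -> (forall x, 0 <= g x) ->
  \int[hmu alpha]_x g (k * x)%R =
  (powR k (- (2 * alpha + 2)))%:E * \int[hmu alpha]_x g x.
Proof.
move=> k0 mg g0.
rewrite ge0_integral_hmu//; last exact (measurableT_comp mg (mulrl_measurable k)).
rewrite ge0_integral_hmu// muleCA; congr (_ * _); rewrite !integral_itv0y.
pose h (x : R) := ((0 < x)%R%:R%:E * (g x * (powR x (2 * alpha + 1))%:E)).
have mh : measurable_fun setT h.
  apply: emeasurable_funM; first by apply/measurable_EFinP; exact: measurable_gt0.
  by apply: emeasurable_funM => //; apply/measurable_EFinP; exact: measurable_powR.
have h0 (x : R) : 0 <= h x by rewrite !mule_ge0// lee_fin ?powR_ge0.
transitivity ((powR k (- (2 * alpha + 1)))%:E * \int[mu]_x h (k * x)%R).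
  rewrite -ge0_integralZl//; last 2 first.
  - exact (measurableT_comp mh (mulrl_measurable k)).
  - by rewrite lee_fin powR_ge0.
  apply: eq_integral => x _; rewrite /h pmulr_rgt0//.
  have [x0|x0] := ltP 0%R x; last by rewrite !mul0e mule0.
  rewrite !mul1e muleCA; congr (_ * _); rewrite -EFinM powRM ?ltW//.
  by rewrite mulrA -powRD_gt0// addNr powRr0 mul1r.
rewrite (@integral_lebesgue_scale _ k h)// muleA -EFinM; congr (_%:E * _).
rewrite -[(k^-1)%R]powR_inv1 ?ltW// -powRD_gt0//; congr powR; ring.
Qed.

Lemma integral_hmu_scale alpha (k : R) (g : R -> \bar R) : (0 < k)%R ->
  measurable_fun setT g ->
  \int[hmu alpha]_x g (k * x)%R =
  (powR k (- (2 * alpha + 2)))%:E * \int[hmu alpha]_x g x.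
Proof.
move=> k0 mg; rewrite [LHS]integralE [in RHS]integralE.
have -> : (fun x => g (k * x)%R)^\+ = (g^\+ \o (fun x => k * x)%R) by rewrite -funepos_comp.
have -> : (fun x => g (k * x)%R)^\- = (g^\- \o (fun x => k * x)%R) by rewrite -funeneg_comp.
rewrite (@ge0_integral_hmu_scale _ _ (g^\+))//; last exact: measurable_funepos.
rewrite (@ge0_integral_hmu_scale _ _ (g^\-))//; last exact: measurable_funeneg.
(* A positive finite factor distributes over the difference of the two parts even when these are
   infinite. *)
have c0 : (0 < powR k (- (2 * alpha + 2)))%R by exact: powR_gt0.
have : 0 <= \int[hmu alpha]_x g^\+ x by exact: integral_ge0.
have : 0 <= \int[hmu alpha]_x g^\- x by exact: integral_ge0.
case: (\int[hmu alpha]_x g^\- x) => [q||]// _; case: (\int[hmu alpha]_x g^\+ x) => [p||]// _.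
- exact: (congr1 EFin (esym (mulrBr _ _ _))).
- by rewrite ?gt0_muley ?lte_fin//= ?gt0_muley ?lte_fin.
- by rewrite ?gt0_muley ?lte_fin//= ?gt0_muleNy ?lte_fin.
- by rewrite ?gt0_muley ?lte_fin//= ?gt0_muleNy ?lte_fin.
Qed.

End HankelMeasures.

(** * Moments of the cosine under the angular measure *)

Section Moments.
Local Open Scope ereal_scope.
Context (R : realType).
Notation mu := (@lebesgue_measure R).
Variable alpha : R.
Hypothesis ha : (- (1 / 2) < alpha)%R.

(** The rising factorial, or Pochhammer symbol. *)
Definition risef (a : R) (n : nat) : R := (\prod_(i < n) (a + i%:R))%R.

Lemma risef0 a : risef a 0 = 1%R.
Proof. by rewrite /risef big_ord0. Qed.

Lemma risefS a n : risef a n.+1 = (risef a n * (a + n%:R))%R.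
Proof. by rewrite /risef big_ord_recr. Qed.

Lemma risefSl a n : risef a n.+1 = (a * risef (a + 1) n)%R.
Proof.
rewrite /risef big_ord_recl/= addr0; congr (_ * _)%R; apply: eq_bigr => i _.
by rewrite -addrA nat1r.
Qed.

Lemma risef_gt0 a n : (0 < a)%R -> (0 < risef a n)%R.
Proof. by move=> a0; apply: prodr_gt0 => i _; rewrite ltr_wpDr. Qed.

Lemma gamma_risef a n : (0 < a)%R -> Gamma (a + n%:R) = (risef a n * Gamma a)%R.
Proof.
move=> a0; elim: n => [|n IH]; first by rewrite addr0 risef0 mul1r.
have an : (0 < a + n%:R)%R by rewrite ltr_wpDr.
by rewrite -natr1 addrA (gammaS an) IH risefS; ring.
Qed.

Lemma hK_gt0 : (0 < hK alpha)%R.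
Proof. by have h := ha; rewrite mulr_gt0 ?powR_gt0// gamma_gt0//; lra. Qed.

Lemma cS_gt0 : (0 < cS alpha)%R.
Proof. by have h := ha; rewrite divr_gt0 ?mulr_gt0 ?gamma_gt0//; lra. Qed.

Lemma measurable_gauss_half : measurable_fun setT (fun x : R => expR (- (x ^+ 2 / 2))).
Proof.
apply: measurableT_comp => //; apply: measurableT_comp => //.
by apply: measurable_funM => //; exact: measurable_funX.
Qed.

Lemma integral_even_gauss (k : nat) :
  \int[mu]_u (u ^+ (2 * k) * expR (- (u ^+ 2 / 2)))%:E =
  (2 * (powR 2 (k%:R - 1 / 2) * Gamma (k%:R + 1 / 2)))%:E.
Proof.
pose f (u : R) := (u ^+ (2 * k) * expR (- (u ^+ 2 / 2)))%:E.
have mf : measurable_fun setT f.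
  apply/measurable_EFinP; apply: measurable_funM; first exact: measurable_funX.
  exact: measurable_gauss_half.
have f0 u : 0 <= f u by rewrite lee_fin mulr_ge0 ?expR_ge0// exprM exprn_ge0 ?sqr_ge0.
have fE u : f (0 - u)%R = f u by rewrite /f sub0r sqrrN !exprM sqrrN.
have h : \int[mu]_(u in `]0%R, +oo[) f u = (powR 2 (k%:R - 1 / 2) * Gamma (k%:R + 1 / 2))%:E.
  transitivity (\int[mu]_(x in `]0%R, +oo[) (powR x (2 * (k%:R + 1 / 2) - 1) * expR (- (x ^+ 2 / 2)))%:E).
    apply: eq_integral => x; rewrite inE/= in_itv/= andbT => x0; rewrite /f; congr ((_ * _)%:E).
    rewrite (_ : 2 * (k%:R + 1 / 2) - 1 = (2 * k)%:R)%R; last by rewrite natrM; field.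
    by rewrite powR_mulrn// ltW.
  rewrite integral_gauss_powR; last by rewrite ltr_wpDl//; lra.
  by congr ((powR 2 _ * _)%:E); lra.
have mi : measurable_fun setT (fun x : R => (0 < x)%R%:R%:E : \bar R).
  by apply/measurable_EFinP; exact: measurable_gt0.
have mg : measurable_fun setT (fun u : R => (0 < u)%R%:R%:E * f u) by exact: emeasurable_funM.
have mr : measurable_fun setT (fun u : R => 0 - u)%R by exact: measurable_funB.
have g0 (u : R) : 0 <= (0 < u)%R%:R%:E * f u by rewrite mule_ge0// lee_fin.
have mg' : measurable_fun setT (fun u : R => (0 < 0 - u)%R%:R%:E * f (0 - u)%R).
  exact (measurableT_comp mg mr).
have g0' (u : R) : 0 <= (0 < 0 - u)%R%:R%:E * f (0 - u)%R by exact: g0.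
rewrite -[LHS]/(\int[mu]_u f u).
(* The line is folded at the origin; the two open half-lines miss only this null point. *)
transitivity (\int[mu]_u ((0 < u)%R%:R%:E * f u + (0 < 0 - u)%R%:R%:E * f (0 - u)%R)); last first.
  rewrite ge0_integralD// (integral_lebesgue_reflect 0 mg g0) -integral_itv0y h.
  by rewrite -EFinD; congr EFin; ring.
apply: ae_eq_integral => //; first exact: emeasurable_funD.
exists [set 0%R]; split => //; first exact: lebesgue_measure_set1.
move=> u /= hu; apply: contrapT => u0; apply: hu => _.
rewrite fE sub0r oppr_gt0.
have [u1|u1|u1] := ltgtP u 0%R; last by [].
  by rewrite mul0e mul1e add0e.
by rewrite mul0e mul1e adde0.
Qed.

(** A Beta integral, obtained by evaluating the integral of [u^(2k) v^(2 alpha) e^(-(u^2+v^2)/2)]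
    over the upper half-plane both in polar and in Cartesian coordinates and dividing by the radial
    factor. *)
Lemma integral_cos_sin_powR (k : nat) :
  \int[mu]_(t in `]0%R, pi[) (cos t ^+ (2 * k) * powR (sin t) (2 * alpha))%:E =
  (Gamma (alpha + 1 / 2) * Gamma (k%:R + 1 / 2) / Gamma (alpha + 1 + k%:R))%:E.
Proof.
have msin := @measurable_sin R; have mcos := @measurable_cos R.
pose F (z : R * R) := (z.1 ^+ (2 * k) * powR z.2 (2 * alpha) *
   (expR (- (z.1 ^+ 2 / 2)) * expR (- (z.2 ^+ 2 / 2))))%:E.
have mp2 : measurable_fun setT (fun z : R * R => powR z.2 (2 * alpha)).
  exact (measurableT_comp (measurable_powR (2 * alpha)) measurable_snd).
have me1 : measurable_fun setT (fun z : R * R => expR (- (z.1 ^+ 2 / 2))).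
  exact (measurableT_comp measurable_gauss_half measurable_fst).
have me2 : measurable_fun setT (fun z : R * R => expR (- (z.2 ^+ 2 / 2))).
  exact (measurableT_comp measurable_gauss_half measurable_snd).
have mF : measurable_fun setT F by apply/measurable_EFinP; mfun.
have F0 z : 0 <= F z.
  by rewrite lee_fin !mulr_ge0 ?expR_ge0 ?powR_ge0// exprM exprn_ge0 ?sqr_ge0.
have := integral_polar mF F0.
set S := \int[mu]_(t in `]0%R, pi[) _.
have mS : measurable_fun setT (fun t : R => (cos t ^+ (2 * k) * powR (sin t) (2 * alpha))%:E).
  apply/measurable_EFinP; apply: measurable_funM; first exact: measurable_funX.
  exact (measurableT_comp (measurable_powR (2 * alpha)) msin).
have S0 t : 0 <= (cos t ^+ (2 * k) * powR (sin t) (2 * alpha))%:E.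
  by rewrite lee_fin mulr_ge0 ?powR_ge0// exprM exprn_ge0 ?sqr_ge0.
have h := ha.
have k0 : (0 <= k%:R :> R)%R by [].
pose p := (k%:R + alpha + 1)%R.
have p0 : (0 < p)%R by rewrite /p; lra.
have mN q : measurable_fun setT (fun r : R => (powR r q * expR (- (r ^+ 2 / 2)))%:E).
  apply/measurable_EFinP; apply: measurable_funM; first exact: measurable_powR.
  exact: measurable_gauss_half.
have N0 (q r : R) : 0 <= (powR r q * expR (- (r ^+ 2 / 2)))%:E.
  by rewrite lee_fin mulr_ge0 ?powR_ge0 ?expR_ge0.
have -> : \int[mu]_(r in `]0%R, +oo[) \int[mu]_(t in `]0%R, pi[) (r%:E * F (r * cos t, r * sin t)%R) =
   (powR 2 (p - 1) * Gamma p)%:E * S.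
  rewrite -integral_gauss_powR// -ge0_integralZr//; last 2 first.
  - by apply: measurable_funTS; exact: mN.
  - by apply: integral_ge0.
  apply: eq_integral => r; rewrite inE/= in_itv/= andbT => r0.
  rewrite -ge0_integralZl//; last by apply: measurable_funTS.
  apply: eq_integral => t; rewrite inE/= in_itv/= => /andP[t0 tp].
  have st : (0 <= sin t)%R by apply: sin_ge0_pi; rewrite !ltW.
  rewrite /F/= -!EFinM; congr EFin.
  rewrite powRM ?(ltW r0)// exprMn -expRD.
  have -> : (- ((r * cos t) ^+ 2 / 2) + - ((r * sin t) ^+ 2 / 2) = - (r ^+ 2 / 2))%R.
    rewrite -[in RHS](mulr1 (r ^+ 2)%R) -(cos2Dsin2 t); ring.
  rewrite (_ : 2 * p - 1 = 2 * alpha + (2 * k)%:R + 1)%R; last by rewrite /p natrM; ring.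
  rewrite (powRD_gt0 (2 * alpha + (2 * k)%:R) 1 r0) (powRD_gt0 (2 * alpha) _ r0) powRr1 ?(ltW r0)//.
  by rewrite powR_mulrn ?(ltW r0)//; ring.
have -> : \int[mu]_(v in `]0%R, +oo[) \int[mu]_u F (u, v) =
   (powR 2 (alpha + 1 / 2 - 1) * Gamma (alpha + 1 / 2))%:E *
   (2 * (powR 2 (k%:R - 1 / 2) * Gamma (k%:R + 1 / 2)))%:E.
  rewrite -integral_even_gauss -integral_gauss_powR; last by lra.
  have me : measurable_fun setT (fun u : R => (u ^+ (2 * k) * expR (- (u ^+ 2 / 2)))%:E).
    apply/measurable_EFinP; apply: measurable_funM; first exact: measurable_funX.
    exact: measurable_gauss_half.
  have e0 (u : R) : 0 <= (u ^+ (2 * k) * expR (- (u ^+ 2 / 2)))%:E.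
    by rewrite lee_fin mulr_ge0 ?expR_ge0// exprM exprn_ge0 ?sqr_ge0.
  rewrite -ge0_integralZr//; last 2 first.
  - by apply: measurable_funTS; exact: mN.
  - by apply: integral_ge0.
  apply: eq_integral => v _.
  have cv0 : 0 <= (powR v (2 * (alpha + 1 / 2) - 1) * expR (- (v ^+ 2 / 2)))%:E.
    by rewrite lee_fin mulr_ge0 ?powR_ge0 ?expR_ge0.
  transitivity (\int[mu]_u ((powR v (2 * (alpha + 1 / 2) - 1) * expR (- (v ^+ 2 / 2)))%:E *
      (u ^+ (2 * k) * expR (- (u ^+ 2 / 2)))%:E)); last first.
    exact: (ge0_integralZl mu measurableT me (fun u _ => e0 u) cv0).
  apply: eq_integral => u _; rewrite /F/= -!EFinM; congr EFin.
  rewrite (_ : 2 * (alpha + 1 / 2) - 1 = 2 * alpha)%R; last by field.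
  ring.
move=> hS.
have c0 : (0 < powR 2 (p - 1) * Gamma p)%R by rewrite mulr_gt0 ?powR_gt0 ?gamma_gt0.
have -> : S = (powR 2 (p - 1) * Gamma p)^-1%:E * ((powR 2 (p - 1) * Gamma p)%:E * S).
  by rewrite muleA -EFinM mulVf ?mul1e// gt_eqF.
rewrite hS -!EFinM; congr EFin.
have -> : (p - 1 = (alpha + 1 / 2 - 1) + ((k%:R - 1 / 2) + 1))%R by rewrite /p; field.
have t0 : (0 < 2 :> R)%R by [].
rewrite (powRD_gt0 (alpha + 1 / 2 - 1) _ t0) (powRD_gt0 (k%:R - 1 / 2) _ t0) powRr1//.
have -> : (alpha + 1 + k%:R = p)%R by rewrite /p; ring.
move: (powR_gt0 (alpha + 1 / 2 - 1) t0) (powR_gt0 (k%:R - 1 / 2) t0) (gamma_gt0 p0).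
move: (powR 2 (alpha + 1 / 2 - 1)) (powR 2 (k%:R - 1 / 2)) (Gamma p).
move: (Gamma (alpha + 1 / 2)) (Gamma (k%:R + 1 / 2)).
by move=> A B C D E C0 D0 E0; field; rewrite !gt_eqF.
Qed.

Lemma integral_hP_cos_even (k : nat) :
  \int[hP alpha]_t (cos t ^+ (2 * k))%:E = (risef (1 / 2) k / risef (alpha + 1) k)%:E.
Proof.
have h := ha.
rewrite ge0_integral_hP; last 2 first.
- apply/measurable_EFinP; apply: measurable_funX; exact: measurable_cos.
- by move=> t; rewrite lee_fin exprM exprn_ge0 ?sqr_ge0.
rewrite (_ : \int[mu]_(t in _) _ =
  (Gamma (alpha + 1 / 2) * Gamma (k%:R + 1 / 2) / Gamma (alpha + 1 + k%:R))%:E); last first.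
  by rewrite -integral_cos_sin_powR; apply: eq_integral => t _; rewrite EFinM.
rewrite -EFinM; congr EFin; rewrite [(k%:R + 1 / 2)%R]addrC.
have a1 : (0 < alpha + 1)%R by lra.
have a2 : (0 < 1 / 2 :> R)%R by lra.
have a3 : (0 < alpha + 1 / 2 :> R)%R by lra.
rewrite (gamma_risef _ a1) (gamma_risef _ a2) /cS.
move: (gamma_gt0 a1) (gamma_gt0 a2) (gamma_gt0 a3) (risef_gt0 k a1) (risef_gt0 k a2).
move: (Gamma (alpha + 1)) (Gamma (1 / 2)) (Gamma (alpha + 1 / 2)) (risef (alpha + 1) k) (risef (1 / 2) k).
by move=> A B C D E A0 B0 C0 D0 E0; field; rewrite !gt_eqF.
Qed.

(** The reflection [t -> pi - t] changes the sign of an odd power, and a finite integral equal to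
    its opposite is [0]. *)
Lemma integral_hP_cos_odd (k : nat) :
  \int[hP alpha]_t (cos t ^+ (2 * k).+1)%:E = 0.
Proof.
have mc : measurable_fun setT (fun t : R => (cos t ^+ (2 * k).+1)%:E).
  by apply/measurable_EFinP; apply: measurable_funX; exact: measurable_cos.
have ic : (hP alpha).-integrable setT (fun t : R => (cos t ^+ (2 * k).+1)%:E).
  apply/integrableP; split => //.
  apply: (@le_lt_trans _ _ (\int[hP alpha]_t (cos t ^+ (2 * 0))%:E)); last first.
    by rewrite integral_hP_cos_even ltry.
  apply: ge0_le_integral => //.
  - exact: measurableT_comp.
  - by apply/measurable_EFinP; apply: measurable_funX; exact: measurable_cos.
  - by move=> t _ /=; rewrite lee_fin normrX exprn_ile1// ler_norml cos_geN1 cos_le1.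
have := integral_hP_reflect alpha mc.
have iE : \int[hP alpha]_t (cos (pi - t) ^+ (2 * k).+1)%:E =
   (-1)%:E * \int[hP alpha]_t (cos t ^+ (2 * k).+1)%:E.
  rewrite -integralZl//; apply: eq_integral => t _; rewrite -EFinM; congr EFin.
  by rewrite cosB cospi sinpi mul0r mulN1r addr0 exprNn exprS exprM sqrrN expr1n expr1n mulr1.
rewrite iE; have := integrable_fin_num measurableT ic.
case: (\int[hP alpha]_t _) => [r||]// _; rewrite -EFinM => -[] hr; congr EFin; lra.
Qed.

End Moments.

(** * Total mass, Gaussian moments and the exchange identity *)

Section HankelKernelMeasure.
Local Open Scope ereal_scope.
Context (R : realType).
Notation mu := (@lebesgue_measure R).
Variable alpha : R.
Hypothesis ha : (- (1 / 2) < alpha)%R.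

Lemma hP_setT : hP alpha setT = 1.
Proof.
have := integral_hP_cos_even ha 0; rewrite !risef0 divr1 => <-.
under [RHS]eq_integral do rewrite muln0 expr0.
by rewrite integral_cst// mul1e.
Qed.

(** The rising factorial produced here is the one in the denominators of the Bessel coefficients;
    this is what makes the Gaussian its own transform. *)
Lemma integral_hmu_gauss (n : nat) :
  \int[hmu alpha]_x (x ^+ (2 * n) * expR (- (x ^+ 2 / 2)))%:E =
  (2 ^+ n * risef (alpha + 1) n)%:E.
Proof.
have h := ha.
rewrite ge0_integral_hmu; last 2 first.
- apply/measurable_EFinP; apply: measurable_funM; first exact: measurable_funX.
  exact: measurable_gauss_half.
- by move=> x; rewrite lee_fin mulr_ge0 ?expR_ge0// exprM exprn_ge0 ?sqr_ge0.
have a1 : (0 < alpha + 1)%R by lra.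
have an : (0 < alpha + 1 + n%:R)%R by rewrite ltr_wpDr.
rewrite (_ : \int[mu]_(x in _) _ =
  (powR 2 (alpha + 1 + n%:R - 1) * Gamma (alpha + 1 + n%:R))%:E); last first.
  rewrite -integral_gauss_powR//; apply: eq_integral => x; rewrite inE/= in_itv/= andbT => x0.
  rewrite -EFinM; congr EFin.
  rewrite (_ : 2 * (alpha + 1 + n%:R) - 1 = (2 * alpha + 1) + (2 * n)%:R)%R; last first.
    by rewrite natrM; ring.
  by rewrite (powRD_gt0 (2 * alpha + 1) _ x0) powR_mulrn ?(ltW x0)//; ring.
rewrite -EFinM; congr EFin; rewrite gamma_risef// /hK.
have t0 : (0 < 2 :> R)%R by [].
rewrite (_ : alpha + 1 + n%:R - 1 = alpha + n%:R)%R; last by ring.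
rewrite (powRD_gt0 alpha _ t0) powR_mulrn//.
move: (powR_gt0 alpha t0) (gamma_gt0 a1); move: (powR 2 alpha) (Gamma (alpha + 1)) (risef _ _) (2 ^+ n)%R.
by move=> A B C D A0 B0; field; rewrite !gt_eqF.
Qed.

(** The norm of the plane vector [(x + y cos t, y sin t)]: the point at which [htrans] evaluates its
    function. *)
Definition hw (x y t : R) : R := Num.sqrt (x ^+ 2 + y ^+ 2 + 2 * x * y * cos t).

Lemma hwE x y t : hw x y t = Num.sqrt ((x + y * cos t) ^+ 2 + (y * sin t) ^+ 2).
Proof.
rewrite /hw; congr Num.sqrt.
have -> : (y ^+ 2 = y ^+ 2 * (cos t ^+ 2 + sin t ^+ 2))%R by rewrite cos2Dsin2 mulr1.
ring.
Qed.

Lemma hw_ge0 x y t : (0 <= hw x y t)%R. Proof. exact: sqrtr_ge0. Qed.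

Lemma hw_sqr x y t : (hw x y t ^+ 2 = x ^+ 2 + y ^+ 2 + 2 * x * y * cos t)%R.
Proof.
rewrite hwE sqr_sqrtr ?addr_ge0 ?sqr_ge0//.
have -> : (y ^+ 2 = y ^+ 2 * (cos t ^+ 2 + sin t ^+ 2))%R by rewrite cos2Dsin2 mulr1.
ring.
Qed.

Lemma hwC x y t : hw x y t = hw y x t.
Proof. by rewrite /hw; congr Num.sqrt; ring. Qed.

Lemma measurable_hw d (T : measurableType d) (f g h : T -> R) :
  measurable_fun setT f -> measurable_fun setT g -> measurable_fun setT h ->
  measurable_fun setT (fun z => hw (f z) (g z) (h z)).
Proof.
move=> mf mg mh.
have mc : measurable_fun setT (fun z => cos (h z)) by exact (measurableT_comp (@measurable_cos R) mh).
have mm : measurable_fun setT (fun z => f z ^+ 2 + g z ^+ 2 + 2 * f z * g z * cos (h z))%R by mfun.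
exact (measurableT_comp (@measurable_sqrt R) mm).
Qed.

(** With [u = x cos t] and [v = x sin t] the weights combine into [v^(2 alpha) du dv], while
    [hw y x t] and [x] become the distances of [(u, v)] from [(- y, 0)] and from the origin. *)
Lemma integral_hw_cartesian (y : R) (G : R * R -> \bar R) :
  measurable_fun setT G -> (forall z, 0 <= G z) ->
  \int[hmu alpha]_x \int[hP alpha]_t G (hw y x t, x) =
  ((hK alpha)^-1 * cS alpha)%:E *
  \int[mu]_(v in `]0%R, +oo[) \int[mu]_u
     (G (Num.sqrt ((y + u) ^+ 2 + v ^+ 2), Num.sqrt (u ^+ 2 + v ^+ 2))%R *
      (powR v (2 * alpha))%:E).
Proof.
move=> mG G0; have h := ha.
pose F (z : R * R) := G (Num.sqrt ((y + z.1) ^+ 2 + z.2 ^+ 2), Num.sqrt (z.1 ^+ 2 + z.2 ^+ 2))%R *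
  (powR z.2 (2 * alpha))%:E.
have mp : measurable_fun setT (fun z : R * R => (powR z.2 (2 * alpha))%:E).
  apply/measurable_EFinP.
  exact (measurableT_comp (measurable_powR (2 * alpha)) measurable_snd).
have mF : measurable_fun setT F.
  apply: emeasurable_funM => //.
  have m1 : measurable_fun setT (fun z : R * R => (y + z.1) ^+ 2 + z.2 ^+ 2)%R by mfun.
  have m2 : measurable_fun setT (fun z : R * R => z.1 ^+ 2 + z.2 ^+ 2)%R by mfun.
  have m3 := measurableT_comp (@measurable_sqrt R) m1.
  have m4 := measurableT_comp (@measurable_sqrt R) m2.
  exact (measurableT_comp mG (measurable_fun_pair m3 m4)).
have F0 z : 0 <= F z by rewrite mule_ge0// lee_fin powR_ge0.
rewrite -(integral_polar mF F0).
pose G0' (z : R * R) := G (hw y z.1 z.2, z.1).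
have mG0 : measurable_fun setT G0'.
  have m3 : measurable_fun setT (fun z : R * R => hw y z.1 z.2) by apply: measurable_hw; mfun.
  exact (measurableT_comp mG (measurable_fun_pair m3 measurable_fst)).
have G00 z : 0 <= G0' z by exact: G0.
pose Phi (x : R) := \int[hP alpha]_t G0' (x, t).
have mPhi : measurable_fun setT Phi.
  exact (@measurable_fun_fubini_tonelli_F _ _ _ _ _ (hP alpha) G0' mG0 G00).
have Phi0 x : 0 <= Phi x by exact: integral_ge0.
rewrite (ge0_integral_hmu alpha mPhi Phi0) EFinM -muleA; congr (_ * _).
have c0 := cS_gt0 ha.
have mPx : measurable_fun setT (fun x : R => Phi x * (powR x (2 * alpha + 1))%:E).
  by apply: emeasurable_funM => //; apply/measurable_EFinP; exact: measurable_powR.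
rewrite (_ : \int[mu]_(r in _) \int[mu]_(t in _) _ =
  (cS alpha)^-1%:E * \int[mu]_(x in `]0%R, +oo[) (Phi x * (powR x (2 * alpha + 1))%:E)).
  by rewrite muleA -EFinM divff ?mul1e// gt_eqF.
rewrite -ge0_integralZl//; last 3 first.
- by apply: measurable_funTS.
- by move=> x _; rewrite mule_ge0// lee_fin powR_ge0.
- by rewrite lee_fin invr_ge0 ltW.
apply: eq_integral => x; rewrite inE/= in_itv/= andbT => x0.
have mGx : measurable_fun setT (fun t : R => G0' (x, t)).
  by apply: (measurableT_comp mG0); mfun.
have mps : measurable_fun setT (fun t : R => (powR (sin t) (2 * alpha))%:E).
  apply/measurable_EFinP.
  exact (measurableT_comp (measurable_powR (2 * alpha)) (@measurable_sin R)).
rewrite /Phi (ge0_integral_hP alpha mGx)//.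
rewrite !muleA -EFinM mulVf ?gt_eqF// mul1e.
rewrite -ge0_integralZr//; last 3 first.
- by apply: measurable_funTS; apply: emeasurable_funM.
- by move=> t _; rewrite mule_ge0// lee_fin powR_ge0.
- by rewrite lee_fin powR_ge0.
apply: eq_integral => t; rewrite inE/= in_itv/= => /andP[t0 tp].
have st : (0 <= sin t)%R by apply: sin_ge0_pi; rewrite !ltW.
rewrite /F /G0'/= hwE powRM ?(ltW x0)//.
have -> : Num.sqrt ((x * cos t) ^+ 2 + (x * sin t) ^+ 2) = x.
  by rewrite !exprMn -mulrDr cos2Dsin2 mulr1 sqrtr_sqr gtr0_norm.
rewrite muleCA -!muleA; congr (_ * _); rewrite -!EFinM; congr EFin.
by rewrite powRD_gt0// powRr1 ?(ltW x0)//; ring.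
Qed.

Lemma integral_hw_swap (y : R) (G : R * R -> \bar R) :
  measurable_fun setT G -> (forall z, 0 <= G z) ->
  \int[hmu alpha]_x \int[hP alpha]_t G (hw y x t, x) =
  \int[hmu alpha]_x \int[hP alpha]_t G (x, hw y x t).
Proof.
move=> mG G0.
pose G' (z : R * R) := G (z.2, z.1).
have mG' : measurable_fun setT G' by apply: (measurableT_comp mG); mfun.
have G'0 z : 0 <= G' z by exact: G0.
rewrite [RHS](integral_hw_cartesian y mG' G'0) (integral_hw_cartesian y mG G0).
apply: (congr1 (fun z => _ * z)).
apply: eq_integral => v _.
rewrite /G'.
pose k (u : R) := G (Num.sqrt (u ^+ 2 + v ^+ 2), Num.sqrt ((y + u) ^+ 2 + v ^+ 2))%R *
  (powR v (2 * alpha))%:E.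
have mk : measurable_fun setT k.
  apply: emeasurable_funM => //.
  have m1 : measurable_fun setT (fun u : R => (y + u) ^+ 2 + v ^+ 2)%R by mfun.
  have m2 : measurable_fun setT (fun u : R => u ^+ 2 + v ^+ 2)%R by mfun.
  have m3 := measurableT_comp (@measurable_sqrt R) m1.
  have m4 := measurableT_comp (@measurable_sqrt R) m2.
  exact (measurableT_comp mG (measurable_fun_pair m4 m3)).
have k0 u : 0 <= k u by rewrite mule_ge0// lee_fin powR_ge0.
(* The reflection interchanges the two centres [(- y, 0)] and [(0, 0)] and fixes [v]. *)
rewrite -(integral_lebesgue_reflect (- y) mk k0).
apply: eq_integral => u _; rewrite /k; congr (G (Num.sqrt _, Num.sqrt _) * _); ring.
Qed.

End HankelKernelMeasure.

(** * Transport of measures to the type of reals *)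

Section OnReals.
Local Open Scope ereal_scope.
Context (R : realType).

(** Pushforward along the identity from [measurableTypeR R] to [R]: the measurable sets are the
    same, but the structure is the one for which the abstract sections are stated. *)
Definition on_reals (m : set (measurableTypeR R) -> \bar R) : set R -> \bar R :=
  pushforward m (fun x : measurableTypeR R => x : R).

Let mid : measurable_fun setT (fun x : measurableTypeR R => x : R).
Proof. by move=> _ Y mY; rewrite setTI. Qed.

Section measure_on_reals.
Variable m : {measure set (measurableTypeR R) -> \bar R}.

Let on_reals0 : on_reals m set0 = 0. Proof. exact: measure0. Qed.
Let on_reals_ge0 A : 0 <= on_reals m A. Proof. exact: measure_ge0. Qed.
Let on_reals_sigma_additive : semi_sigma_additive (on_reals m).
Proof. move=> A mA tA mUA; exact: (@measure_semi_sigma_additive _ _ _ m). Qed.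

HB.instance Definition _ := isMeasure.Build _ R _ (on_reals m)
  on_reals0 on_reals_ge0 on_reals_sigma_additive.

End measure_on_reals.

Section sigma_finite_on_reals.
Variable m : {sigma_finite_measure set (measurableTypeR R) -> \bar R}.

Let on_reals_sigma_finite : sigma_finite setT (on_reals m).
Proof.
have [F TF Foo] := sigma_finiteT m.
by exists F => // n; have := Foo n.
Qed.

HB.instance Definition _ := Measure_isSigmaFinite.Build _ R _ (on_reals m) on_reals_sigma_finite.
End sigma_finite_on_reals.

Lemma integral_on_reals (m : {measure set (measurableTypeR R) -> \bar R}) (f : R -> \bar R) :
  measurable_fun setT f -> \int[on_reals m]_x f x = \int[m]_x f x.
Proof.
move=> mf.
have H (g : R -> \bar R) : measurable_fun setT g -> (forall x, 0 <= g x) ->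
    \int[on_reals m]_x g x = \int[m]_x g x.
  move=> mg g0.
  rewrite -(preimage_setT (fun x : measurableTypeR R => x : R)).
  rewrite -(@ge0_integral_pushforward _ _ _ _ _ _ mid m setT g)//.
rewrite [LHS]integralE [RHS]integralE (H f^\+) ?(H f^\-)//.
- exact: measurable_funeneg.
- exact: measurable_funepos.
Qed.

End OnReals.

(** * Combinatorics of the product formula *)

Section CauchyProduct.
Context (R : realType).
Implicit Types A B : nat -> R.

Definition cauchy_prod A B (n : nat) : R := \sum_(i < n.+1) A i * B (n - i)%N.

Lemma series_cauchy_prod A B N :
  series (cauchy_prod A B) N = \sum_(i < N) A i * series B (N - i)%N.
Proof.
elim: N => [|N IH]; first by rewrite big_ord0 /series/= big_nil.
rewrite seriesSr IH /cauchy_prod.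
transitivity (\sum_(i < N.+1) (A i * series B (N - i)%N + A i * B (N - i)%N)).
  rewrite big_split/=; congr (_ + _).
  by rewrite big_ord_recr/= subnn /series/= [in X in _ = _ + _ * X]big_nil mulr0 addr0.
apply: eq_bigr => i _; rewrite -mulrDr; congr (_ * _).
by rewrite subSn ?leq_ord// seriesSr.
Qed.

(** The gap between the product of partial sums and the triangular sum is at most the same gap for
    absolute values. The latter tends to [0] because the triangle of size [n] contains the square of
    side [n/2] and lies in that of side [n]. *)
Lemma cvg_cauchy_prod A B (sa sb : R) :
  cvgn (series (fun n => `|A n|)) -> cvgn (series (fun n => `|B n|)) ->
  series A n @[n --> \oo] --> sa -> series B n @[n --> \oo] --> sb ->
  series (cauchy_prod A B) n @[n --> \oo] --> sa * sb.
Proof.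
move=> cA cB hA hB.
pose nA n := `|A n|; pose nB n := `|B n|.
have ndS (u : nat -> R) p q : (forall n, 0 <= u n) -> (p <= q)%N -> series u p <= series u q.
  move=> u0 pq; rewrite -subr_ge0 sub_series_geq//.
  by apply: sumr_ge0.
have nA0 n : 0 <= nA n by exact: normr_ge0.
have nB0 n : 0 <= nB n by exact: normr_ge0.
have s0 (u : nat -> R) p : (forall n, 0 <= u n) -> 0 <= series u p.
  by move=> u0; rewrite /series/=; apply: sumr_ge0.
have cvgD : series nA n * series nB n - series (cauchy_prod nA nB) n @[n --> \oo] --> 0.
  have cAB : series nA n * series nB n @[n --> \oo] --> limn (series nA) * limn (series nB).
    by apply: cvgM; [exact: cA|exact: cB].
  rewrite -(subrr (limn (series nA) * limn (series nB))); apply: cvgB => //.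
  have half : n./2 @[n --> \oo] --> \oo.
    apply/cvgnyPge => M; near=> n.
    have h : (M.*2 <= n)%N by near: n; exact: nbhs_infty_ge.
    by rewrite -(doubleK M) half_leq.
  have cAB2 := cvg_comp _ _ half cAB.
  apply: (@squeeze_cvgr _ _ _ _ (fun n => series nA n./2 * series nB n./2) (fun n => series nA n * series nB n)) => //.
  apply: nearW => n; rewrite series_cauchy_prod; apply/andP; split.
    have hn : (n./2 <= n)%N by rewrite -[leqRHS]odd_double_half -addnn addnA leq_addl.
    apply: (@le_trans _ _ (\sum_(i < n./2) nA i * series nB (n - i)%N)).
      rewrite {1}/series/= big_mkord mulr_suml; apply: ler_sum => i _.
      rewrite ler_wpM2l//; apply: ndS => //.
      have hi : (i <= n./2)%N by rewrite ltnW.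
      rewrite leq_subRL; last exact: leq_trans hi hn.
      rewrite (@leq_trans (n./2 + n./2))// ?leq_add2r// addnn.
      by rewrite -[leqRHS]odd_double_half leq_addl.
    rewrite (big_ord_widen n (fun i => nA i * series nB (n - i)%N) hn) big_mkcond/=.
    apply: ler_sum => i _; case: ifP => // _.
    by rewrite mulr_ge0// s0.
  rewrite {2}/series/= big_mkord mulr_suml; apply: ler_sum => i _.
  by rewrite ler_wpM2l//; apply: ndS => //; exact: leq_subr.
have cAB : series A n * series B n @[n --> \oo] --> sa * sb by exact: cvgM.
rewrite -[sa * sb]subr0.
have -> : series (cauchy_prod A B) = (fun n => series A n * series B n -
    (series A n * series B n - series (cauchy_prod A B) n)).
  by apply/funext => n; rewrite opprB addrC subrK.
apply: cvgB => //.
apply: norm_cvg0.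
apply: (@squeeze_cvgr _ _ _ _ (fun=> 0) (fun n => series nA n * series nB n - series (cauchy_prod nA nB) n)) => //; last exact: cvg_cst.
apply: nearW => n; rewrite normr_ge0/= !series_cauchy_prod.
have E (u v : nat -> R) : series u n * series v n - \sum_(i < n) u i * series v (n - i)%N =
   \sum_(i < n) u i * (series v n - series v (n - i)%N).
  rewrite {1}/series/= big_mkord mulr_suml -sumrB; apply: eq_bigr => i _.
  by rewrite mulrBr.
rewrite !E (le_trans (ler_norm_sum _ _ _))//; apply: ler_sum => i _.
rewrite normrM ler_wpM2l// !sub_series_geq ?leq_subr//.
exact: ler_norm_sum.
Unshelve. all: by end_near. Qed.

End CauchyProduct.

(** * Rising factorials and the Vandermonde identity *)

Section MomentAlgebra.
Context (R : realType).
Implicit Types (a X Y : R).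

Lemma risefD a p q : risef a (p + q) = risef a p * risef (a + p%:R) q.
Proof.
elim: q => [|q IH]; first by rewrite addn0 risef0 mulr1.
by rewrite addnS !risefS IH natrD; ring.
Qed.

Lemma risefS_shift a i : risef (a + 1) i.+1 = risef a i.+1 + i.+1%:R * risef (a + 1) i.
Proof. by rewrite risefS risefSl -natr1; ring. Qed.

Lemma ffact_pascal (j k : nat) : (j.+1 ^_ k.+1 = j ^_ k.+1 + k.+1 * j ^_ k)%N.
Proof.
rewrite ffactSS; have [kj|jk] := leqP k j.
  by rewrite ffactnSr mulnC [(k.+1 * _)%N]mulnC -mulnDr; congr (_ * _)%N; rewrite addnS subnK.
by rewrite !ffact_small ?muln0//; exact: ltnW.
Qed.

(** A form of the Chu-Vandermonde identity. Induction on [j]: the Pascal rule for falling factorials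
    splits every term, and [risefS_shift] splits the right side in the same way. *)
Lemma vandermonde_risef (j i : nat) a :
  \sum_(k < i.+1) 'C(i, k)%:R * (j ^_ k)%:R * risef (a + k%:R) (i - k) =
  risef (a + j%:R) i.
Proof.
elim: j i a => [|j IH] i a.
  rewrite big_ord_recl/= big1 ?addr0.
    by rewrite bin0 ffactn0 subn0 ?addr0 !mul1r.
  by move=> k _; rewrite ffact0n/= mulr0 mul0r.
case: i => [|i].
  by rewrite big_ord_recl big_ord0 addr0 /= bin0 ffactn0 !risef0 !mulr1.
rewrite big_ord_recl/= bin0 ffactn0 subn0 addr0 !mul1r.
have -> : a + j.+1%:R = (a + j%:R) + 1 by rewrite -natr1; ring.
rewrite risefS_shift -IH [in RHS]big_ord_recl/= bin0 ffactn0 subn0 addr0 !mul1r -addrA; congr (_ + _).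
have -> : (a + j%:R) + 1 = (a + 1) + j%:R by ring.
rewrite -IH mulr_sumr -big_split/=; apply: eq_bigr => k _.
rewrite /bump/= !add1n subSS ffact_pascal natrD natrM.
have -> : a + k.+1%:R = a + 1 + k%:R by rewrite -nat1r; ring.
have h : i.+1%:R * 'C(i, k)%:R = k.+1%:R * 'C(i.+1, k.+1)%:R :> R.
  by rewrite -!natrM mul_bin_diag.
rewrite mulrDr mulrDl; congr (_ + _).
transitivity (k.+1%:R * 'C(i.+1, k.+1)%:R * (j ^_ k)%:R * risef (a + 1 + k%:R) (i - k)); first by ring.
by rewrite -h; ring.
Qed.

Lemma fact_double (k : nat) : ((2 * k)`!)%:R = 4 ^+ k * k`!%:R * risef (1 / 2) k :> R.
Proof.
elim: k => [|k IH]; first by rewrite muln0 risef0 !mulr1.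
rewrite (_ : 2 * k.+1 = (2 * k).+2)%N; last by rewrite mulnS.
by rewrite !factS !natrM IH risefS exprS -!natr1 natrM; field.
Qed.

(** The preceding identity divided by factorials, which makes it symmetric in [i] and [j]. The bound
    on [i + j] guarantees that every [k] below both [i] and [j] is at most [M], so the truncated sum
    loses no term. *)
Lemma vandermonde_coef a (i j M : nat) : 0 < a -> (i + j <= M.*2.+1)%N ->
  \sum_(k < M.+1 | (k <= i)%N && (k <= j)%N)
     (k`!%:R * risef a k * (i - k)`!%:R * (j - k)`!%:R)^-1 =
  risef a (i + j) / (i`!%:R * j`!%:R * risef a i * risef a j).
Proof.
move=> a0 ijM.
have f0 n : n`!%:R != 0 :> R by rewrite pnatr_eq0 -lt0n fact_gt0.
have r0 n : risef a n != 0 by rewrite gt_eqF// risef_gt0.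
rewrite addnC risefD -(vandermonde_risef j i a); set S := \sum_(k < i.+1) _.
rewrite [RHS](_ : _ = S / (i`!%:R * j`!%:R * risef a i)); last first.
  by field; rewrite !f0 !r0.
rewrite /S {S}.
rewrite mulr_suml.
have F (k : nat) : (k <= i)%N -> (k <= j)%N ->
   (k`!%:R * risef a k * (i - k)`!%:R * (j - k)`!%:R)^-1 =
   'C(i, k)%:R * (j ^_ k)%:R * risef (a + k%:R) (i - k) / (i`!%:R * j`!%:R * risef a i).
  move=> ki kj.
  have hi : i`!%:R = 'C(i, k)%:R * k`!%:R * (i - k)`!%:R :> R by rewrite -!natrM -mulnA bin_fact.
  have hj : j`!%:R = (j ^_ k)%:R * (j - k)`!%:R :> R by rewrite -natrM ffact_fact.
  have hr : risef a i = risef a k * risef (a + k%:R) (i - k) by rewrite -risefD subnKC.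
  have := f0 i; have := f0 j; have := r0 i; rewrite hi hj hr !mulf_eq0 !negb_or.
  move=> /andP[h1 h2] /andP[h3 h4] /andP[/andP[h5 h6] h7].
  by field; rewrite h1 h2 h3 h4 h5 h6 h7.
transitivity (\sum_(k < (maxn M i).+1 | (k <= i)%N && (k <= j)%N)
   ('C(i, k)%:R * (j ^_ k)%:R * risef (a + k%:R) (i - k) / (i`!%:R * j`!%:R * risef a i))).
  rewrite (big_ord_widen_cond (maxn M i).+1 (fun k => (k <= i)%N && (k <= j)%N)
    (fun k : nat => (k`!%:R * risef a k * (i - k)`!%:R * (j - k)`!%:R)^-1)); last by rewrite ltnS leq_maxl.
  apply: eq_big => k.
    case ki : (k <= i)%N => //=; case kj : (k <= j)%N => //=.
    by move: ijM ki kj; lia.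
  by move=> /andP[/andP[ki kj] _]; exact: F.
rewrite (big_ord_widen_cond (maxn M i).+1 xpredT
    (fun k : nat => 'C(i, k)%:R * (j ^_ k)%:R * risef (a + k%:R) (i - k) / (i`!%:R * j`!%:R * risef a i))); last by rewrite ltnS leq_maxr.
rewrite big_mkcond [RHS]big_mkcond; apply: eq_bigr => k _ /=; rewrite ltnS.
case ki : (k <= i)%N => //=; case: leqP => // jk.
by rewrite ffact_small// mulr0 !mul0r.
Qed.


Lemma sum_even_terms (F : nat -> R) (n : nat) : (forall k, odd k -> F k = 0) ->
  \sum_(k < n.+1) F k = \sum_(k < n./2.+1) F (2 * k)%N.
Proof.
move=> F0; elim: n => [|n IH].
  by rewrite !big_ord_recl !big_ord0.
rewrite big_ord_recr IH/= uphalf_half.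
case: (boolP (odd n)) => on /=; last first.
  by rewrite add0n F0 ?addr0//= on.
rewrite add1n [RHS]big_ord_recr/=; congr (_ + F _).
by rewrite -[in LHS](odd_double_half n) on mul2n doubleS.
Qed.

(** The shift [i = l + k] expresses the range by two conditions that are symmetric in [i] and
    [n - i], ready for an exchange of sums. *)
Lemma sum_shift_window (h : nat -> R) (n k : nat) : (2 * k <= n)%N ->
  \sum_(l < (n - 2 * k).+1) h l =
  \sum_(i < n.+1 | (k <= i)%N && (k <= n - i)%N) h (i - k)%N.
Proof.
move=> kn.
have kn' : (k <= n)%N by apply: leq_trans kn; rewrite leq_pmull.
rewrite -(big_mkord (fun i => (k <= i)%N && (k <= n - i)%N) (fun i => h (i - k)%N)).
rewrite -(big_mkord xpredT h).
rewrite (_ : (n - 2 * k).+1 = (n - k).+1 - k)%N; last first.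
  by rewrite mul2n -addnn subnDA subSn// leq_subRL// addnn -mul2n.
transitivity (\sum_(k <= i < (n - k).+1) h (i - k)%N).
  have := big_addn 0 (n - k).+1 k xpredT (fun i => h (i - k)%N); rewrite add0n => ->.
  by apply: eq_bigr => i _; rewrite addnK.
rewrite (big_nat_widenl _ 0%N)// (big_nat_widen _ _ n.+1) ?ltnS ?leq_subr//.
rewrite big_nat_cond [RHS]big_nat_cond; apply: eq_bigl => i.
by move: kn kn'; lia.
Qed.

(* Expansion of [E (S + D cos t)^n] for the measure with these moments; the sum
   of two squares [S = X + Y], [D = 2 x y] makes it symmetric in X and Y. *)
Lemma moment_expansion a (mm : nat -> R) (S D X Y : R) (n : nat) : 0 < a ->
  (forall k, mm (2 * k)%N = risef (1 / 2) k / risef a k) ->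
  (forall k, odd k -> mm k = 0) ->
  S = X + Y -> D ^+ 2 = 4 * X * Y ->
  \sum_(k < n.+1) 'C(n, k)%:R * S ^+ (n - k) * D ^+ k * mm k =
  n`!%:R * risef a n *
  \sum_(i < n.+1) (X ^+ i / (i`!%:R * risef a i)) * (Y ^+ (n - i) / ((n - i)`!%:R * risef a (n - i))).
Proof.
move=> a0 mmE mmO SE DE.
have f0 p : p`!%:R != 0 :> R by rewrite pnatr_eq0 -lt0n fact_gt0.
have r0 p : risef a p != 0 by rewrite gt_eqF// risef_gt0.
have h0 p : risef (1 / 2) p != 0 :> R by rewrite gt_eqF// risef_gt0//; lra.
rewrite (@sum_even_terms (fun k => 'C(n, k)%:R * S ^+ (n - k) * D ^+ k * mm k)); last first.
  by move=> k ok; rewrite mmO// mulr0.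
(* General term after expanding [(X + Y)^(n - 2k)] and [D^(2k) = (4 X Y)^k]; the powers of [4] and
   the factor [risef (1/2) k] of the moment cancel against [(2k)!]. *)
pose g (k l : nat) : R := X ^+ (l + k) * Y ^+ (n - (l + k)) *
  (k`!%:R * risef a k * l`!%:R * (n - 2 * k - l)`!%:R)^-1.
transitivity (n`!%:R * \sum_(k < n./2.+1) \sum_(l < (n - 2 * k).+1) g k l).
  rewrite mulr_sumr; apply: eq_bigr => k _.
  have kn : (2 * k <= n)%N.
    have := leq_ord k; rewrite -leq_double -mul2n => /leq_trans; apply.
    by rewrite -[leqRHS]odd_double_half leq_addl.
  have -> : S ^+ (n - 2 * k) = (n - 2 * k)`!%:R *
     \sum_(l < (n - 2 * k).+1) X ^+ l * Y ^+ (n - 2 * k - l) / (l`!%:R * (n - 2 * k - l)`!%:R).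
    rewrite SE addrC exprDn mulr_sumr; apply: eq_bigr => l _.
    have hl : (l <= n - 2 * k)%N by exact: leq_ord.
    have := bin_fact hl => /(congr1 (fun x => x%:R : R)); rewrite !natrM -mulr_natr => hb.
    rewrite -hb; field; by rewrite !f0.
  have hb : 'C(n, 2 * k)%:R * (2 * k)`!%:R * (n - 2 * k)`!%:R = n`!%:R :> R.
    by rewrite -(bin_fact kn) !natrM mulrA.
  rewrite mmE exprM DE -hb fact_double.
  rewrite !mulr_sumr mulr_suml mulr_suml; apply: eq_bigr => l _.
  have hl : (l <= n - 2 * k)%N by exact: leq_ord.
  have -> : g k l = X ^+ l * X ^+ k * (Y ^+ (n - 2 * k - l) * Y ^+ k) /
      (k`!%:R * risef a k * l`!%:R * (n - 2 * k - l)`!%:R).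
    rewrite /g -!exprD; congr (_ * Y ^+ _ / _).
    by move: kn hl; lia.
  rewrite !exprMn; field; rewrite !f0 !r0//.
rewrite -mulrA; congr (_ * _).
transitivity (\sum_(k < n./2.+1) \sum_(i < n.+1 | (k <= i)%N && (k <= n - i)%N)
  X ^+ i * Y ^+ (n - i) * (k`!%:R * risef a k * (i - k)`!%:R * (n - i - k)`!%:R)^-1).
  apply: eq_bigr => k _.
  have kn : (2 * k <= n)%N.
    have := leq_ord k; rewrite -leq_double -mul2n => /leq_trans; apply.
    by rewrite -[leqRHS]odd_double_half leq_addl.
  rewrite (sum_shift_window (g k) kn); apply: eq_bigr => i /andP[ki kni].
  rewrite /g subnK//; congr (_ * (_ * _`!%:R)^-1).
  by rewrite mul2n -addnn; lia.
(* For a fixed exponent [i] of [X] the inner sum over [k] is the Vandermonde sum for [i] and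
   [n - i]. *)
rewrite (exchange_big_dep xpredT)//= mulr_sumr; apply: eq_bigr => i _.
rewrite -mulr_sumr vandermonde_coef//; last first.
  by rewrite subnKC ?leq_ord// -[leqLHS]odd_double_half; case: (odd n).
rewrite subnKC ?leq_ord//; field.
by rewrite !f0 !r0.
Qed.

End MomentAlgebra.

(** * The normalized Bessel function *)

Section RintegralLemmas.
Context d (T : measurableType d) (R : realType).
Variable m : {measure set T -> \bar R}.

Lemma Rintegral_sum (I : Type) (s : seq I) (f : I -> T -> R) :
  (forall i, m.-integrable setT (EFin \o f i)) ->
  Rintegral m setT (fun t => \sum_(i <- s) f i t) = \sum_(i <- s) Rintegral m setT (f i).
Proof.
move=> fi; rewrite /Rintegral.
under eq_integral do rewrite -sumEFin.
rewrite integral_sum//= -sum_fine// => i _.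
exact: (integrable_fin_num measurableT (fi i)).
Qed.

Lemma integrable_bounded (f : T -> R) (M : R) : (m setT < +oo)%E ->
  measurable_fun setT f -> (forall t, `|f t| <= M) -> m.-integrable setT (EFin \o f).
Proof.
move=> moo mf fM; apply/integrableP; split; first exact/measurable_EFinP.
apply: (@le_lt_trans _ _ (\int[m]_t (`|M|)%:E)%E); last first.
  by rewrite integral_cst// lte_mul_pinfty.
apply: ge0_le_integral => //.
- by apply: measurableT_comp => //; exact/measurable_EFinP.
- by move=> t _ /=; rewrite lee_fin (le_trans (fM t))// ler_norm.
Qed.

Lemma ge0_integral_le_cst (f : T -> R) (M : R) : m setT = 1%E ->
  measurable_fun setT f -> (forall t, `|f t| <= M) ->
  (\int[m]_t `|f t|%:E <= M%:E)%E.
Proof.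
move=> m1 mf fM; rewrite -[leRHS]mule1 -m1 -integral_cst//.
apply: ge0_le_integral => //.
- by apply/measurable_EFinP; exact: measurableT_comp.
- by move=> t _; rewrite lee_fin.
Qed.

End RintegralLemmas.

(** * Power series, Poisson integral and product formula *)

Section BesselFunction.
Context (R : realType) (a : R) (P : {sigma_finite_measure set R -> \bar R}).
Hypothesis a_gt : 1 / 2 < a.
Hypothesis P1 : P setT = 1%E.
Hypothesis cos_even : forall k,
  (\int[P]_t (cos t ^+ (2 * k))%:E = (risef (1 / 2) k / risef a k)%:E)%E.
Hypothesis cos_odd : forall k, (\int[P]_t (cos t ^+ (2 * k).+1)%:E = 0)%E.

(** The coefficients of [j_alpha] for [a = alpha + 1], the two Gamma factors being simplified by
    [Gamma (a + n) = risef a n * Gamma a]. *)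
Definition bc (n : nat) : R := (-1) ^+ n / (n`!%:R * risef a n * 4 ^+ n).
Definition jb (z : R) : R := limn (series (fun n => bc n * z ^+ (2 * n))).

Let a0 : 0 < a. Proof. have h := a_gt; lra. Qed.

(** Every factor [a + i] exceeds [1/2]. This crude bound is enough to dominate the Bessel series by
    the exponential series of [z^2/2]. *)
Lemma risef_ge n : 2^-1 ^+ n <= risef a n.
Proof.
elim: n => [|n IH]; first by rewrite risef0 expr0.
rewrite risefS exprSr ler_pM ?exprn_ge0 ?invr_ge0//.
have h := a_gt; have : (0 <= n%:R :> R) by []; lra.
Qed.

Lemma bc_bound n : `|bc n| <= (n`!%:R * 2 ^+ n)^-1.
Proof.
have f0 : 0 < n`!%:R :> R by rewrite ltr0n fact_gt0.
have r0 := risef_gt0 n a0.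
have p0 : 0 < n`!%:R * risef a n * 4 ^+ n by rewrite !mulr_gt0// exprn_gt0.
rewrite /bc normrM normrX normrN1 expr1n mul1r normfV (gtr0_norm p0).
rewrite lef_pV2 ?posrE// ?mulr_gt0 ?exprn_gt0// -mulrA ler_pM2l//.
have -> : 4 = 2 * 2 :> R by rewrite -natrM.
rewrite exprMn mulrA -[leLHS]mul1r ler_pM2r ?exprn_gt0//.
have := risef_ge n; rewrite exprVn -ler_pdivrMr ?invr_gt0 ?exprn_gt0//.
by rewrite div1r.
Qed.

Lemma jb_term_bound z n : `|bc n * z ^+ (2 * n)| <= exp_coeff (z ^+ 2 / 2) n.
Proof.
have z0 : 0 <= (z ^+ 2) ^+ n by apply: exprn_ge0; exact: sqr_ge0.
rewrite normrM exprM (ger0_norm z0) /exp_coeff/=.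
have -> : (z ^+ 2 / 2) ^+ n / n`!%:R = (n`!%:R * 2 ^+ n)^-1 * (z ^+ 2) ^+ n.
  by rewrite expr_div_n -mulrA -invfM mulrC [2 ^+ n * _]mulrC.
by rewrite ler_wpM2r ?bc_bound.
Qed.

Lemma cvg_norm_jb z : cvgn (series (fun n => `|bc n * z ^+ (2 * n)|)).
Proof.
apply: (series_le_cvg _ _ (jb_term_bound z)) => //.
- by move=> n; rewrite /exp_coeff/= divr_ge0 ?exprn_ge0// divr_ge0 ?sqr_ge0.
- exact: is_cvg_series_exp_coeff.
Qed.

Lemma cvg_jb z : series (fun n => bc n * z ^+ (2 * n)) n @[n --> \oo] --> jb z.
Proof. by apply: normed_cvg; exact: cvg_norm_jb. Qed.

Lemma measurable_jb : measurable_fun setT jb.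
Proof.
apply: (@measurable_fun_cvg _ _ _ setT (fun (n : nat) (z : R) => series (fun k => bc k * z ^+ (2 * k)) n)) => //.
- move=> n; rewrite /series/=; apply: measurable_sum => i.
  by apply: measurable_funM => //; exact: measurable_funX.
- by move=> z _; exact: cvg_jb.
Qed.

Let mcos : measurable_fun setT (@cos R). Proof. exact: measurable_cos. Qed.

Let Poo : (P setT < +oo)%E. Proof. by rewrite P1 ltry. Qed.

Lemma fact_double_ge (n : nat) : n`!%:R <= (2 * n)`!%:R :> R.
Proof. by rewrite ler_nat; apply: leq_fact; rewrite leq_pmull. Qed.

(** The Poisson integral: the cosine series is integrated term by term against the even moments. Its
    purpose is the bound by [1] that follows. *)
Lemma jb_poisson z : jb z = Rintegral P setT (fun t => cos (z * cos t)).
Proof.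
pose f n t : R := cos_coeff' (z * cos t) n.
(* Since [n!] is at most [(2n)!], the terms of the cosine series are dominated by those of
   [exp (z^2)], uniformly in [t]. *)
pose u n : R := exp_coeff (z ^+ 2) n.
have fu n t : `|f n t| <= u n.
  rewrite /f /cos_coeff' /u /exp_coeff/= exprnP -mul2n normrM normfV normrM normrX normrN1 expr1n mul1r.
  rewrite -exprM normrX normrM exprMn [X in _ / X]ger0_norm//.
  apply: ler_pM => //.
  - rewrite -[leRHS]mulr1 exprM real_normK ?num_real// -exprM ler_wpM2l//.
      by rewrite exprM exprn_ge0 ?sqr_ge0.
    by rewrite exprn_ile1// ler_norml cos_geN1 cos_le1.
  - by rewrite lef_pV2 ?posrE ?ltr0n ?fact_gt0// fact_double_ge.
have mf n : measurable_fun setT (f n).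
  apply: measurable_funM => //; apply: measurable_funM => //; apply: measurable_funX.
  exact: measurable_funM.
have [_ h] := @integral_series _ _ _ P f (fun t => cos (z * cos t)) u mf
  (fun n => ge0_integral_le_cst P1 (mf n) (fu n)) (@is_cvg_series_exp_coeff _ _)
  (fun t => @cvg_cos_coeff' _ _).
apply: (cvg_unique (@Rhausdorff R) (@cvg_jb z)).
apply: cvg_trans h; apply: near_eq_cvg; apply: nearW => N.
congr (series _ N); apply/funext => n.
rewrite /f /cos_coeff'.
transitivity (fine (\int[P]_t (((-1) ^+ n * z ^+ (2 * n) / (2 * n)`!%:R)%:E * (cos t ^+ (2 * n))%:E))%E).
  rewrite /Rintegral; congr fine; apply: eq_integral => t _; rewrite -EFinM; congr EFin.
  by rewrite -exprnP -mul2n exprMn; ring.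
rewrite integralZl//; last first.
  apply: (@integrable_bounded _ _ _ P (fun t => cos t ^+ (2 * n)) 1) => //.
    exact: measurable_funX.
  by move=> t; rewrite normrX exprn_ile1// ler_norml cos_geN1 cos_le1.
rewrite cos_even -EFinM/= fact_double /bc.
have f0 : n`!%:R != 0 :> R by rewrite pnatr_eq0 -lt0n fact_gt0.
have r0 : risef a n != 0 by rewrite gt_eqF// risef_gt0.
have h0 : risef (1 / 2) n != 0 :> R by rewrite gt_eqF// risef_gt0//; lra.
have e0 : 4 ^+ n != 0 :> R by rewrite expf_neq0.
by field; rewrite f0 r0 h0 e0.
Qed.

Lemma jb_le1 z : `|jb z| <= 1.
Proof.
have mc : measurable_fun setT (fun t => cos (z * cos t)).
  by apply: measurableT_comp => //; exact: measurable_funM.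
have c1 t : `|cos (z * cos t)| <= 1 by rewrite ler_norml cos_geN1 cos_le1.
rewrite jb_poisson (le_trans (le_normr_Rintegral _ _))//.
  exact: (@integrable_bounded _ _ _ P (fun t => cos (z * cos t)) 1).
rewrite -lee_fin fineK.
  exact: ge0_integral_le_cst.
rewrite ge0_fin_numE ?integral_ge0//.
by apply: le_lt_trans (ge0_integral_le_cst P1 mc c1) _; rewrite ltry.
Qed.

Lemma Rintegral_binomial_cos (S D : R) (n : nat) (X Y : R) :
  S = X + Y -> D ^+ 2 = 4 * X * Y ->
  Rintegral P setT (fun t => (S + D * cos t) ^+ n) =
  n`!%:R * risef a n *
  \sum_(i < n.+1) (X ^+ i / (i`!%:R * risef a i)) * (Y ^+ (n - i) / ((n - i)`!%:R * risef a (n - i))).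
Proof.
move=> SE DE.
pose mm k := Rintegral P setT (fun t => cos t ^+ k).
have ic k : P.-integrable setT (EFin \o (fun t => cos t ^+ k)).
  apply: (@integrable_bounded _ _ _ P (fun t => cos t ^+ k) 1) => //.
    exact: measurable_funX.
  by move=> t; rewrite normrX exprn_ile1// ler_norml cos_geN1 cos_le1.
rewrite -(@moment_expansion _ a mm S D X Y n a0)//.
- transitivity (Rintegral P setT (fun t => \sum_(k < n.+1) ('C(n, k)%:R * S ^+ (n - k) * D ^+ k) * cos t ^+ k)).
    apply: eq_Rintegral => t _; rewrite exprDn; apply: eq_bigr => k _.
    by rewrite exprMn -mulr_natr; ring.
  rewrite Rintegral_sum.
    by apply: eq_bigr => k _; rewrite RintegralZl.
  move=> k; have h := integrableZl measurableT ('C(n, k)%:R * S ^+ (n - k) * D ^+ k) (ic k).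
  by apply: eq_integrable h => // t _ /=; rewrite EFinM.
- by move=> k; rewrite /mm /Rintegral cos_even.
- move=> k ok; rewrite /mm /Rintegral -(odd_double_half k) ok add1n -mul2n cos_odd//.
Qed.

(** The square of [hw x y t] is [S + D cos t], so each integrated term is a binomial moment, and
    [moment_expansion] with [X = x^2], [Y = y^2] identifies it with a term of the Cauchy product of
    the two Bessel series. *)
Lemma jb_product xi x y :
  Rintegral P setT (fun t => jb (xi * hw x y t)) = jb (x * xi) * jb (y * xi).
Proof.
pose S := x ^+ 2 + y ^+ 2; pose D := 2 * x * y.
have hwS t : hw x y t ^+ 2 = S + D * cos t by rewrite hw_sqr.
pose f n t : R := bc n * (xi * hw x y t) ^+ (2 * n).
(* A bound for half the square of the Bessel argument, because [hw x y t] never exceeds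
   [|x| + |y|]. *)
pose M := (`|xi| * (`|x| + `|y|)) ^+ 2 / 2.
have mhw : measurable_fun setT (fun t => hw x y t) by apply: measurable_hw.
have mf n : measurable_fun setT (f n).
  apply: measurable_funM => //; apply: measurable_funX; exact: measurable_funM.
have fu n t : `|f n t| <= exp_coeff M n.
  apply: (le_trans (jb_term_bound _ _)); rewrite /exp_coeff/= ler_wpM2r//.
  rewrite lerXn2r ?nnegrE ?divr_ge0 ?sqr_ge0// /M ler_wpM2r// !exprMn.
  rewrite real_normK ?num_real// ler_wpM2l ?sqr_ge0// hwS /S /D sqrrD.
  rewrite !real_normK ?num_real//.
  have : `|x * y * cos t| <= `|x| * `|y|.
    by rewrite !normrM ler_piMr ?mulr_ge0// ler_norml cos_geN1 cos_le1.
  by move=> /ler_normlP[_ h]; lra.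
have [_ h] := @integral_series _ _ _ P f (fun t => jb (xi * hw x y t)) (exp_coeff M) mf
  (fun n => ge0_integral_le_cst P1 (mf n) (fu n)) (@is_cvg_series_exp_coeff _ _)
  (fun t => @cvg_jb _).
apply: (cvg_unique (@Rhausdorff R) h).
have := cvg_cauchy_prod (@cvg_norm_jb (x * xi)) (@cvg_norm_jb (y * xi)) (@cvg_jb (x * xi)) (@cvg_jb (y * xi)).
apply: cvg_trans; apply: near_eq_cvg; apply: nearW => N.
congr (series _ N); apply/funext => n; apply/esym.
transitivity (Rintegral P setT (fun t => (bc n * xi ^+ (2 * n)) * (S + D * cos t) ^+ n)).
  apply: eq_Rintegral => t _; rewrite /f exprMn [hw _ _ _ ^+ _]exprM hwS; ring.
rewrite RintegralZl//; last first.
  apply: (@integrable_bounded _ _ _ P (fun t => (S + D * cos t) ^+ n) ((`|S| + `|D|) ^+ n)) => //.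
    apply: measurable_funX; apply: measurable_funD => //; exact: measurable_funM.
  move=> t; rewrite normrX lerXn2r ?nnegrE ?addr_ge0//.
  rewrite (le_trans (ler_normD _ _))// lerD2l normrM ler_piMr//.
  by rewrite ler_norml cos_geN1 cos_le1.
rewrite (@Rintegral_binomial_cos S D n (x ^+ 2) (y ^+ 2))//; last by rewrite /D; ring.
rewrite /cauchy_prod !mulr_sumr; apply: eq_bigr => i _.
have hi : (i <= n)%N by exact: leq_ord.
have f0 p : p`!%:R != 0 :> R by rewrite pnatr_eq0 -lt0n fact_gt0.
have r0 p : risef a p != 0 by rewrite gt_eqF// risef_gt0.
have e0 p : 4 ^+ p != 0 :> R by rewrite expf_neq0.
rewrite /bc !exprMn !exprM !expr2 !exprMn.
have E (z : R) : z ^+ n = z ^+ i * z ^+ (n - i) by rewrite -exprD subnKC.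
rewrite (E (-1)) (E xi) (E 4).
by field; rewrite ?f0 ?r0 ?e0.
Qed.

End BesselFunction.

(** * Fubini for real-valued integrals *)

Section RintegralFubini.
Context d1 d2 (T1 : measurableType d1) (T2 : measurableType d2) (R : realType).
Variables (m1 : {sigma_finite_measure set T1 -> \bar R}).
Variables (m2 : {sigma_finite_measure set T2 -> \bar R}).
Implicit Types f : T1 * T2 -> R.

Lemma measurable_Rintegral1 f : measurable_fun setT f ->
  measurable_fun setT (fun x => Rintegral m2 setT (fun y => f (x, y))).
Proof.
move=> mf; rewrite /Rintegral; apply: measurableT_comp => //.
under eq_fun do rewrite integralE.
have mF : measurable_fun setT (EFin \o f) by exact/measurable_EFinP.
apply: emeasurable_funB.
- have h := @measurable_fun_fubini_tonelli_F _ _ _ _ _ m2 _ (measurable_funepos mF) (fun z => funepos_ge0 (EFin \o f) z).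
  apply: eq_measurable_fun h => x _; apply: eq_integral => y _.
  by rewrite !funeposE.
- have h := @measurable_fun_fubini_tonelli_F _ _ _ _ _ m2 _ (measurable_funeneg mF) (fun z => funeneg_ge0 (EFin \o f) z).
  apply: eq_measurable_fun h => x _; apply: eq_integral => y _.
  by rewrite !funenegE.
Qed.

(** The inner integrals are finite only almost everywhere, and [fine] replaces an infinite value by
    [0]; the comparison with the extended-real iterated integral is therefore almost everywhere. *)
Lemma Rintegral_fubini1 f : (m1 \x m2)%E.-integrable setT (EFin \o f) ->
  Rintegral m1 setT (fun x => Rintegral m2 setT (fun y => f (x, y))) =
  Rintegral (m1 \x m2)%E setT f.
Proof.
move=> fi; rewrite [RHS]/Rintegral -(integral12_prod_meas1 fi)/=; congr fine.
have iF := integrable_fubini_F fi.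
apply: ae_eq_integral => //.
- apply/measurable_EFinP; apply: measurable_Rintegral1.
  by apply/measurable_EFinP; exact: measurable_int fi.
- exact: measurable_int iF.
- have := integrable_ae measurableT iF; apply: filterS => x /(_ I) h _.
  by rewrite /Rintegral fineK.
Qed.

Lemma Rintegral_fubini2 f : (m1 \x m2)%E.-integrable setT (EFin \o f) ->
  Rintegral m2 setT (fun y => Rintegral m1 setT (fun x => f (x, y))) =
  Rintegral (m1 \x m2)%E setT f.
Proof.
move=> fi; rewrite [RHS]/Rintegral -(integral21_prod_meas1 fi)/=; congr fine.
have mfi := measurable_int _ fi.
have iG : m2.-integrable setT (fubini_G m1 (EFin \o f)).
  apply/integrableP; split; first exact: (measurable_fubini_G fi).
  apply: le_lt_trans ((integrable21ltyP m1 m2 mfi).1 fi).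
  apply: ge0_le_integral => //.
  - by apply: measurableT_comp => //; exact: (measurable_fubini_G fi).
  - apply: (@measurable_fun_fubini_tonelli_G _ _ _ _ _ m1 (abse \o (EFin \o f))) => //.
      exact: measurableT_comp.
    by move=> z; exact: abse_ge0.
  - move=> y _; apply: le_abse_integral => //.
    exact (measurableT_comp mfi (pair2_measurable y)).
have mf : measurable_fun setT f by apply/measurable_EFinP; exact: measurable_int fi.
have mG : measurable_fun setT (fun y => fine (fubini_G m1 (EFin \o f) y)).
  by apply: measurableT_comp => //; exact: measurable_int iG.
apply: ae_eq_integral => //.
- exact/measurable_EFinP.
- exact: measurable_int iG.
- have := integrable_ae measurableT iG; apply: filterS => x /(_ I) h _.
  by rewrite /Rintegral fineK.
Qed.

Lemma ge0_integral_fubini1 f : measurable_fun setT f -> (forall z, 0 <= f z) ->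
  (\int[m1 \x m2]_z (f z)%:E = \int[m1]_x \int[m2]_y (f (x, y))%:E)%E.
Proof.
move=> mf f0; rewrite (@fubini_tonelli1 _ _ _ _ _ m1 m2 (EFin \o f))//.
exact/measurable_EFinP.
Qed.

Lemma ge0_integral_fubini2 f : measurable_fun setT f -> (forall z, 0 <= f z) ->
  (\int[m1 \x m2]_z (f z)%:E = \int[m2]_y \int[m1]_x (f (x, y))%:E)%E.
Proof.
move=> mf f0; rewrite (@fubini_tonelli2 _ _ _ _ _ m1 m2 (EFin \o f))//.
exact/measurable_EFinP.
Qed.

End RintegralFubini.

(** * Integrability and integrals of real-valued functions *)

Section Integrability.
Context d (T : measurableType d) (R : realType).
Variable m : {measure set T -> \bar R}.
Implicit Types f g : T -> R.

Lemma ge0_integrable f : measurable_fun setT f -> (forall x, 0 <= f x) ->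
  (\int[m]_x (f x)%:E < +oo)%E -> m.-integrable setT (EFin \o f).
Proof.
move=> mf f0 foo; apply/integrableP; split; first exact/measurable_EFinP.
by under eq_integral do rewrite /= ger0_norm//.
Qed.

Lemma le_integrableR f g : measurable_fun setT f -> m.-integrable setT (EFin \o g) ->
  (forall x, `|f x| <= g x) -> m.-integrable setT (EFin \o f).
Proof.
move=> mf gi fg; apply: (le_integrable measurableT _ _ gi) => //.
  exact/measurable_EFinP.
by move=> x _; rewrite /= lee_fin (le_trans (fg x))// ler_norm.
Qed.

Lemma integrableDR f g : m.-integrable setT (EFin \o f) -> m.-integrable setT (EFin \o g) ->
  m.-integrable setT (EFin \o (fun x => f x + g x)).
Proof. by move=> fi gi; apply: eq_integrable (integrableD measurableT fi gi). Qed.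

Lemma integrableBR f g : m.-integrable setT (EFin \o f) -> m.-integrable setT (EFin \o g) ->
  m.-integrable setT (EFin \o (fun x => f x - g x)).
Proof. by move=> fi gi; apply: eq_integrable (integrableB measurableT fi gi). Qed.

Lemma integrableZR f (k : R) : m.-integrable setT (EFin \o f) ->
  m.-integrable setT (EFin \o (fun x => k * f x)).
Proof. by move=> fi; apply: eq_integrable (integrableZl measurableT k fi). Qed.

Lemma integrable_measurable f : m.-integrable setT (EFin \o f) -> measurable_fun setT f.
Proof. by move=> /measurable_int/measurable_EFinP. Qed.

Lemma EFin_Rintegral f : m.-integrable setT (EFin \o f) ->
  (Rintegral m setT f)%:E = (\int[m]_x (f x)%:E)%E.
Proof. by move=> fi; rewrite /Rintegral fineK//; exact: integrable_fin_num fi. Qed.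

Lemma RintegralDT f g : m.-integrable setT (EFin \o f) -> m.-integrable setT (EFin \o g) ->
  Rintegral m setT (fun x => f x + g x) = Rintegral m setT f + Rintegral m setT g.
Proof. by move=> fi gi; rewrite RintegralD. Qed.

Lemma RintegralBT f g : m.-integrable setT (EFin \o f) -> m.-integrable setT (EFin \o g) ->
  Rintegral m setT (fun x => f x - g x) = Rintegral m setT f - Rintegral m setT g.
Proof. by move=> fi gi; rewrite RintegralB. Qed.

Lemma RintegralZT f (k : R) : m.-integrable setT (EFin \o f) ->
  Rintegral m setT (fun x => k * f x) = k * Rintegral m setT f.
Proof. by move=> fi; rewrite RintegralZl. Qed.

Lemma RintegralZrT f (k : R) : m.-integrable setT (EFin \o f) ->
  Rintegral m setT (fun x => f x * k) = Rintegral m setT f * k.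
Proof. by move=> fi; rewrite RintegralZr. Qed.

(* A non-integrable function has integral [0] after [fine], whatever the scalar. *)
Lemma RintegralZr_measurable f (k : R) : measurable_fun setT f ->
  Rintegral m setT (fun x => f x * k) = Rintegral m setT f * k.
Proof.
have main g : measurable_fun setT g -> ~ m.-integrable setT (EFin \o g) ->
    Rintegral m setT g = 0.
  move=> mg ng; rewrite /Rintegral.
  have [gfin|/negPf] := boolP ((\int[m]_x (g x)%:E)%E \is a fin_num); last first.
    by case: (integral _ _ _).
  (* A finite difference forces both the positive and the negative part to have finite integral,
     which is integrability. *)
  case: ng; apply/integrableP; have mG : measurable_fun setT (EFin \o g) by exact/measurable_EFinP.
  split => //; move: gfin; rewrite integralE fin_numB => /andP[fp fm].
  rewrite [X in (X < _)%E](_ : _ = \int[m]_x ((EFin \o g)^\+ x + (EFin \o g)^\- x))%E.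
    rewrite ge0_integralD//; [|exact: measurable_funepos|exact: measurable_funeneg].
    by rewrite lte_add_pinfty// -ge0_fin_numE ?integral_ge0.
  by apply: eq_integral => x _; have /(congr1 (fun h => h x)) := fune_abse (EFin \o g).
move=> mf; have [->|k0] := eqVneq k 0.
  rewrite mulr0; under eq_Rintegral do rewrite mulr0.
  by rewrite /Rintegral integral0.
have [fi|nf] := pselect (m.-integrable setT (EFin \o f)); first exact: RintegralZrT.
rewrite (main f)// mul0r main//; first exact: measurable_funM.
move=> fi; apply: nf; have h := integrableZR k^-1 fi; apply: eq_integrable h => // x _.
by rewrite /= mulrC mulfK.
Qed.

Lemma integrable_normR f : m.-integrable setT (EFin \o f) ->
  m.-integrable setT (EFin \o (fun x => `|f x|)).
Proof. by move=> /integrable_abse. Qed.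

(** Covers every measurable [f]: when the integral is infinite the left side is [0]. *)
Lemma le_norm_Rintegral f : measurable_fun setT f ->
  (`|Rintegral m setT f|%:E <= \int[m]_x `|f x|%:E)%E.
Proof.
move=> mf; rewrite /Rintegral.
have mF : measurable_fun setT (EFin \o f) by exact/measurable_EFinP.
apply: (@le_trans _ _ `|\int[m]_x (f x)%:E|%E); last first.
  exact: (le_abse_integral m measurableT mF).
by case: (integral _ _ _) => [r| |] //=; rewrite ?normr0 ?leey.
Qed.

Lemma le_RintegralT f g : m.-integrable setT (EFin \o f) -> m.-integrable setT (EFin \o g) ->
  (forall x, f x <= g x) -> Rintegral m setT f <= Rintegral m setT g.
Proof. by move=> fi gi fg; apply: le_Rintegral. Qed.

Lemma ge0_le_integralR f g : measurable_fun setT f -> measurable_fun setT g ->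
  (forall x, 0 <= f x) -> (forall x, f x <= g x) ->
  (\int[m]_x (f x)%:E <= \int[m]_x (g x)%:E)%E.
Proof.
move=> mf mg f0 fg; apply: ge0_le_integral => //.
- by move=> x _; rewrite lee_fin.
- exact/measurable_EFinP.
- exact/measurable_EFinP.
- by move=> x _; rewrite lee_fin.
Qed.

Lemma ge0_integralDR f g : measurable_fun setT f -> measurable_fun setT g ->
  (forall x, 0 <= f x) -> (forall x, 0 <= g x) ->
  (\int[m]_x (f x + g x)%:E = \int[m]_x (f x)%:E + \int[m]_x (g x)%:E)%E.
Proof.
move=> mf mg f0 g0; under eq_integral do rewrite EFinD.
by rewrite ge0_integralD//; try exact/measurable_EFinP; move=> x _; rewrite lee_fin.
Qed.

Lemma ge0_integralZR f (k : R) : measurable_fun setT f -> 0 <= k ->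
  (forall x, 0 <= f x) -> (\int[m]_x (k * f x)%:E = k%:E * \int[m]_x (f x)%:E)%E.
Proof.
move=> mf k0 f0; under eq_integral do rewrite EFinM.
by rewrite ge0_integralZl//; [exact/measurable_EFinP|move=> x _; rewrite lee_fin].
Qed.

End Integrability.

Section TensorIntegrability.
Context d1 d2 (T1 : measurableType d1) (T2 : measurableType d2) (R : realType).
Variables (m1 : {sigma_finite_measure set T1 -> \bar R}).
Variables (m2 : {sigma_finite_measure set T2 -> \bar R}).
Implicit Types f : T1 * T2 -> R.

Lemma integrable_prodP f : measurable_fun setT f ->
  (\int[m1]_x \int[m2]_y `|f (x, y)|%:E < +oo)%E ->
  (m1 \x m2)%E.-integrable setT (EFin \o f).
Proof.
move=> mf foo; apply/(@integrable12ltyP _ _ _ _ _ m1 m2 (EFin \o f)) => //.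
exact/measurable_EFinP.
Qed.

Lemma integrable_prod2P f : measurable_fun setT f ->
  (\int[m2]_y \int[m1]_x `|f (x, y)|%:E < +oo)%E ->
  (m1 \x m2)%E.-integrable setT (EFin \o f).
Proof.
move=> mf foo; apply/(@integrable21ltyP _ _ _ _ _ m1 m2 (EFin \o f)) => //.
exact/measurable_EFinP.
Qed.

Lemma integrable_tensor f (u : T1 -> R) (v : T2 -> R) : measurable_fun setT f ->
  m1.-integrable setT (EFin \o u) -> m2.-integrable setT (EFin \o v) ->
  (forall x y, `|f (x, y)| <= u x * v y) ->
  (m1 \x m2)%E.-integrable setT (EFin \o f).
Proof.
move=> mf ui vi fuv.
have mu_ := integrable_measurable ui; have mv := integrable_measurable vi.
apply: (@le_integrableR _ _ _ _ f (fun z => `|u z.1| * `|v z.2|)) => //; last first.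
  by case=> x y; rewrite (le_trans (fuv x y))// -normrM ler_norm.
apply: integrable_prodP.
  by apply: measurable_funM; apply: measurableT_comp => //; apply: measurableT_comp.
have iu := integrable_fin_num measurableT (integrable_normR ui).
have iv := integrable_fin_num measurableT (integrable_normR vi).
under eq_integral => x _ do under eq_integral => y _ do rewrite /= ger0_norm ?mulr_ge0// .
have E x : (\int[m2]_y (`|u x| * `|v y|)%:E = `|u x|%:E * \int[m2]_y `|v y|%:E)%E.
  by rewrite ge0_integralZR//; exact: measurableT_comp.
under eq_integral do rewrite E.
rewrite ge0_integralZr//; last 2 first.
- by apply/measurable_EFinP; exact: measurableT_comp.
- by apply: integral_ge0 => x _; rewrite lee_fin.
by rewrite -ge0_fin_numE ?fin_numM// mule_ge0// integral_ge0// => x _; rewrite lee_fin.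
Qed.

End TensorIntegrability.

(** * Hankel translation and transform *)

(* [m] plays the role of mu_alpha with [a = alpha + 1], and [P] that of the
   probability [c_alpha sin^(2 alpha) d theta] on [0, pi]. *)
Record hankel_measures (R : realType) (a : R)
    (m P : {sigma_finite_measure set R -> \bar R}) : Prop := HankelMeasures {
  hm_gt : 1 / 2 < a ;
  hm_P1 : P setT = 1%E ;
  hm_cos_even : forall k,
    (\int[P]_t (cos t ^+ (2 * k))%:E = (risef (1 / 2) k / risef a k)%:E)%E ;
  hm_cos_odd : forall k, (\int[P]_t (cos t ^+ (2 * k).+1)%:E = 0)%E ;
  hm_swap : forall (y : R) (G : R * R -> \bar R),
    measurable_fun setT G -> (forall z, 0 <= G z)%E ->
    (\int[m]_x \int[P]_t G (hw y x t, x) = \int[m]_x \int[P]_t G (x, hw y x t))%E ;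
  hm_gauss : forall n : nat,
    (\int[m]_x (x ^+ (2 * n) * expR (- (x ^+ 2 / 2)))%:E = (2 ^+ n * risef a n)%:E)%E ;
  hm_scale : forall (k : R) (g : R -> \bar R), 0 < k -> measurable_fun setT g ->
    (\int[m]_x g (k * x)%R = (powR k (- (2 * a)))%:E * \int[m]_x g x)%E
}.

Section HankelTransform.
Context (R : realType) (a : R) (m P : {sigma_finite_measure set R -> \bar R}).
Hypothesis H : hankel_measures a m P.

Let a_gt : 1 / 2 < a. Proof. exact: hm_gt H. Qed.
Let P1 : P setT = 1%E. Proof. exact: hm_P1 H. Qed.

Let a0 : 0 < a. Proof. have h := a_gt; lra. Qed.

Let mjb : measurable_fun setT (jb a). Proof. exact: measurable_jb. Qed.

Let jb1 z : `|jb a z| <= 1. Proof. exact: (jb_le1 a_gt P1 (hm_cos_even H)). Qed.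

Let Poo : (P setT < +oo)%E. Proof. by rewrite P1 ltry. Qed.

Let integral_P_cst (k : R) : (\int[P]_t k%:E = k%:E)%E.
Proof. by have -> : (\int[P]_t k%:E = k%:E * P setT)%E; [exact: integral_cst|rewrite P1 mule1]. Qed.

Let mjbM d (T : measurableType d) (f g : T -> R) :
  measurable_fun setT f -> measurable_fun setT g -> measurable_fun setT (fun z => jb a (f z * g z)).
Proof. by move=> mf mg; apply: measurableT_comp => //; exact: measurable_funM. Qed.

Definition htr (phi : R -> R) (x y : R) : R := Rintegral P setT (fun t => phi (hw x y t)).

Lemma htrC phi x y : htr phi x y = htr phi y x.
Proof. by rewrite /htr; under eq_Rintegral do rewrite hwC. Qed.

Lemma htr_jb xi x y : htr (fun w => jb a (w * xi)) x y = jb a (x * xi) * jb a (y * xi).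
Proof.
rewrite -(jb_product a_gt P1 (hm_cos_even H) (hm_cos_odd H)).
by rewrite /htr; under eq_Rintegral do rewrite mulrC.
Qed.

Lemma measurable_hw_pair (y : R) : measurable_fun setT (fun q : R * R => hw y q.1 q.2).
Proof. by apply: measurable_hw. Qed.

Lemma measurable_hw_last (x y : R) : measurable_fun setT (hw x y).
Proof. by apply: measurable_hw. Qed.

Lemma measurable_htr phi : measurable_fun setT phi ->
  measurable_fun setT (fun z : R * R => htr phi z.1 z.2).
Proof.
move=> mphi; rewrite /htr.
apply: (@measurable_Rintegral1 _ _ (R * R)%type R R P (fun z => phi (hw z.1.1 z.1.2 z.2))).
by apply: (measurableT_comp mphi); apply: measurable_hw => //; apply: measurableT_comp.
Qed.

Lemma measurable_htrl phi y : measurable_fun setT phi -> measurable_fun setT (fun x => htr phi x y).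
Proof.
by move=> mphi; exact (measurableT_comp (measurable_htr mphi) (pair2_measurable y)).
Qed.

Lemma measurable_htrr phi x : measurable_fun setT phi -> measurable_fun setT (htr phi x).
Proof.
by move=> mphi; exact (measurableT_comp (measurable_htr mphi) (pair1_measurable x)).
Qed.

Lemma ge0_integral_hw_swap (y : R) (G : R * R -> R) :
  measurable_fun setT G -> (forall z, 0 <= G z) ->
  (\int[m \x P]_q (G (hw y q.1 q.2, q.1))%:E = \int[m \x P]_q (G (q.1, hw y q.1 q.2))%:E)%E.
Proof.
move=> mG G0.
have mh := measurable_hw_pair y.
have mG1 : measurable_fun setT (fun q : R * R => G (hw y q.1 q.2, q.1)).
  by apply: (measurableT_comp mG); exact: measurable_fun_pair.
have mG2 : measurable_fun setT (fun q : R * R => G (q.1, hw y q.1 q.2)).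
  by apply: (measurableT_comp mG); exact: measurable_fun_pair.
rewrite (ge0_integral_fubini1 m P mG1 (fun=> G0 _)) (ge0_integral_fubini1 m P mG2 (fun=> G0 _)).
apply: (hm_swap H y (G := EFin \o G)); first exact/measurable_EFinP.
by move=> z; rewrite lee_fin.
Qed.

Lemma Rintegral_hw_swap (y : R) (G : R * R -> R) : measurable_fun setT G ->
  Rintegral (m \x P)%E setT (fun q => G (hw y q.1 q.2, q.1)) =
  Rintegral (m \x P)%E setT (fun q => G (q.1, hw y q.1 q.2)).
Proof.
move=> mG; rewrite /Rintegral; congr fine.
rewrite integralE [RHS]integralE.
have E (F : R * R -> R * R) : (\int[m \x P]_x ((fun x => (G (F x))%:E)^\+ x) =
   \int[m \x P]_x (Num.max (G (F x)) 0)%:E)%E /\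
   (\int[m \x P]_x ((fun x => (G (F x))%:E)^\- x) =
   \int[m \x P]_x (Num.max (- G (F x)) 0)%:E)%E.
  by split; apply: eq_integral => x _; rewrite ?funeposE ?funenegE EFin_max ?EFinN.
have [-> ->] := E (fun q => (hw y q.1 q.2, q.1)).
have [-> ->] := E (fun q => (q.1, hw y q.1 q.2)).
rewrite (@ge0_integral_hw_swap y (fun z => Num.max (G z) 0)).
- rewrite (@ge0_integral_hw_swap y (fun z => Num.max (- G z) 0))//.
    by apply: measurable_maxr => //; exact: measurableT_comp.
  by move=> z; rewrite le_max lexx orbT.
- by apply: measurable_maxr.
- by move=> z; rewrite le_max lexx orbT.
Qed.

Lemma ge0_integral_fst (phi : R -> R) : measurable_fun setT phi ->
  (forall x, 0 <= phi x) ->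
  (\int[m \x P]_q (phi q.1)%:E = \int[m]_x (phi x)%:E)%E.
Proof.
move=> mphi p0; rewrite ge0_integral_fubini1//; last by apply: measurableT_comp.
by apply: eq_integral => x _; rewrite /= integral_P_cst.
Qed.

(** Invariance of [m] under translation: the exchange applied to a function of the first coordinate,
    the angular measure having mass one. *)
Lemma ge0_integral_hw (phi : R -> R) (y : R) : measurable_fun setT phi ->
  (forall x, 0 <= phi x) ->
  (\int[m \x P]_q (phi (hw y q.1 q.2))%:E = \int[m]_x (phi x)%:E)%E.
Proof.
move=> mphi p0; rewrite (@ge0_integral_hw_swap y (fun z => phi z.1))//; last exact: measurableT_comp.
exact: ge0_integral_fst.
Qed.

Lemma integrable_fst phi : m.-integrable setT (EFin \o phi) ->
  (m \x P)%E.-integrable setT (EFin \o (fun q => phi q.1)).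
Proof.
move=> ip; have mp := integrable_measurable ip; apply/integrableP; split.
  by apply/measurable_EFinP; apply: measurableT_comp.
have /integrableP[_ h] := ip.
rewrite (_ : integral _ _ _ = \int[m \x P]_q (`|phi q.1|)%:E)%E//.
by rewrite (@ge0_integral_fst (fun x => `|phi x|))//; apply: measurableT_comp.
Qed.

Lemma integrable_hw phi y : m.-integrable setT (EFin \o phi) ->
  (m \x P)%E.-integrable setT (EFin \o (fun q => phi (hw y q.1 q.2))).
Proof.
move=> ip; have mp := integrable_measurable ip; apply/integrableP; split.
  by apply/measurable_EFinP; apply: (measurableT_comp mp); exact: measurable_hw_pair.
have /integrableP[_ h] := ip.
rewrite (_ : integral _ _ _ = \int[m \x P]_q (`|phi (hw y q.1 q.2)|)%:E)%E//.
by rewrite (@ge0_integral_hw (fun x => `|phi x|))//; apply: measurableT_comp.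
Qed.

Lemma integral_norm_htr_le phi y : measurable_fun setT phi ->
  (\int[m]_x `|htr phi x y|%:E <= \int[m]_x `|phi x|%:E)%E.
Proof.
move=> mp.
have mn : measurable_fun setT (fun x => `|phi x|) by apply: measurableT_comp.
rewrite -(ge0_integral_hw y mn)// ge0_integral_fubini1//; last first.
  by apply: (measurableT_comp mn); exact: measurable_hw_pair.
apply: ge0_le_integral => //.
- by apply/measurable_EFinP; apply: measurableT_comp => //; exact: measurable_htrl.
- apply: (@measurable_fun_fubini_tonelli_F _ _ _ _ _ P (fun q => (`|phi (hw y q.1 q.2)|)%:E)) => //.
  by apply/measurable_EFinP; apply: (measurableT_comp mn); exact: measurable_hw_pair.
- move=> x _; rewrite htrC; apply: le_norm_Rintegral.
  by apply: (measurableT_comp mp); exact: measurable_hw_last.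
Qed.

Lemma integrable_htr phi y : m.-integrable setT (EFin \o phi) ->
  m.-integrable setT (EFin \o (fun x => htr phi x y)).
Proof.
move=> ip; have mp := integrable_measurable ip; apply/integrableP; split.
  by apply/measurable_EFinP; exact: measurable_htrl.
have /integrableP[_ h] := ip.
exact: le_lt_trans (integral_norm_htr_le y mp) h.
Qed.

(** The translation is self-adjoint: this is the exchange for the product of [psi] in one coordinate
    with [phi] in the other. Boundedness of [psi] makes both double integrals converge
    absolutely. *)
Lemma htr_adjoint (phi psi : R -> R) y (M : R) : m.-integrable setT (EFin \o phi) ->
  measurable_fun setT psi -> (forall x, `|psi x| <= M) ->
  Rintegral m setT (fun x => psi x * htr phi x y) =
  Rintegral m setT (fun x => phi x * htr psi x y).
Proof.
move=> ip mpsi psiM; have mp := integrable_measurable ip.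
have iw := integrable_hw y ip.
have M0 : 0 <= M by apply: le_trans (psiM 0).
have i1 : (m \x P)%E.-integrable setT (EFin \o (fun q => psi q.1 * phi (hw y q.1 q.2))).
  apply: (@le_integrableR _ _ _ _ _ (fun q => M * `|phi (hw y q.1 q.2)|)).
  - by apply: measurable_funM; [exact: measurableT_comp|exact: integrable_measurable iw].
  - by apply: integrableZR; exact: integrable_normR iw.
  - by move=> q; rewrite normrM ler_wpM2r.
have i2 : (m \x P)%E.-integrable setT (EFin \o (fun q => psi (hw y q.1 q.2) * phi q.1)).
  have i2' := integrable_fst ip.
  apply: (@le_integrableR _ _ _ _ _ (fun q => M * `|phi q.1|)).
  - apply: measurable_funM; last exact: integrable_measurable i2'.
    by apply: (measurableT_comp mpsi); exact: measurable_hw_pair.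
  - by apply: integrableZR; exact: integrable_normR i2'.
  - by move=> q; rewrite normrM ler_wpM2r.
transitivity (Rintegral (m \x P)%E setT (fun q => psi q.1 * phi (hw y q.1 q.2))).
  rewrite -Rintegral_fubini1//.
  have h := ae_integrable1 i1.
  have iH := integrable_htr y ip.
  have i1F := integrable_fubini_F i1.
  rewrite /Rintegral; congr fine; apply: ae_eq_integral => //.
  - apply/measurable_EFinP; apply: measurable_funM => //; exact: measurable_htrl.
  - apply/measurable_EFinP; apply: measurableT_comp => //; exact: measurable_int i1F.
  have := ae_integrable1 iw; apply: filterS => x /= ix _; congr EFin.
  by rewrite htrC /htr -RintegralZT.
transitivity (Rintegral (m \x P)%E setT (fun q => psi (hw y q.1 q.2) * phi q.1)).
  rewrite (@Rintegral_hw_swap y (fun z => psi z.2 * phi z.1))//.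
  by apply: measurable_funM; apply: measurableT_comp.
rewrite -Rintegral_fubini1//; apply: eq_Rintegral => x _.
rewrite /= RintegralZrT; first by rewrite mulrC htrC.
apply: (@integrable_bounded _ _ _ P (fun t => psi (hw y x t)) M) => //.
by apply: (measurableT_comp mpsi); exact: measurable_hw_last.
Qed.

Definition hht (h : R -> R) (xi : R) : R := Rintegral m setT (fun x => h x * jb a (x * xi)).

Lemma integrable_mul_bounded (f g : R -> R) (M : R) : m.-integrable setT (EFin \o f) ->
  measurable_fun setT g -> (forall x, `|g x| <= M) ->
  m.-integrable setT (EFin \o (fun x => f x * g x)).
Proof.
move=> fi mg gM; have mf := integrable_measurable fi.
apply: (@le_integrableR _ _ _ _ _ (fun x => M * `|f x|)).
- exact: measurable_funM.
- by apply: integrableZR; exact: integrable_normR.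
- by move=> x; rewrite normrM mulrC ler_wpM2r.
Qed.

Lemma integrable_mul_jb h xi : m.-integrable setT (EFin \o h) ->
  m.-integrable setT (EFin \o (fun x => h x * jb a (x * xi))).
Proof. by move=> hi; apply: (@integrable_mul_bounded _ _ 1) => //; exact: mjbM. Qed.

Lemma measurable_hht h : measurable_fun setT h -> measurable_fun setT (hht h).
Proof.
move=> mh.
apply: (@measurable_Rintegral1 _ _ R R R m (fun z => h z.2 * jb a (z.2 * z.1))).
by apply: measurable_funM; [exact: measurableT_comp|exact: mjbM].
Qed.

Lemma hht_bound h xi : m.-integrable setT (EFin \o h) ->
  `|hht h xi| <= Rintegral m setT (fun x => `|h x|).
Proof.
move=> hi; rewrite /hht (le_trans (le_normr_Rintegral _ _))//; first exact: integrable_mul_jb.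
apply: le_RintegralT => //.
- by apply: integrable_normR; exact: integrable_mul_jb.
- exact: integrable_normR.
- by move=> x; rewrite normrM ler_piMr.
Qed.

(** The generalized convolution of the Hankel setting. At a fixed scale, the real and imaginary
    parts of the wavelet transform are combinations of convolutions with dilates. *)
Definition cv (f phi : R -> R) (x : R) : R := Rintegral m setT (fun y => f y * htr phi x y).

Section convolution.
Variables f phi : R -> R.
Hypotheses (fi : m.-integrable setT (EFin \o f)) (phii : m.-integrable setT (EFin \o phi)).

Let mf : measurable_fun setT f. Proof. exact: integrable_measurable fi. Qed.
Let mphi : measurable_fun setT phi. Proof. exact: integrable_measurable phii. Qed.

Lemma measurable_cv : measurable_fun setT (cv f phi).
Proof.
apply: (@measurable_Rintegral1 _ _ R R R m (fun z => f z.2 * htr phi z.1 z.2)).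
by apply: measurable_funM; [exact: measurableT_comp|exact: measurable_htr].
Qed.

(** Tonelli, integrating in [x] first: translation does not increase the integral of [|phi|], which
    leaves the product of the two [L^1] norms. *)
Lemma integrable_cv_kernel :
  (m \x m)%E.-integrable setT (EFin \o (fun z => f z.2 * htr phi z.1 z.2)).
Proof.
have mk : measurable_fun setT (fun z : R * R => f z.2 * htr phi z.1 z.2).
  by apply: measurable_funM; [exact: measurableT_comp|exact: measurable_htr].
apply: integrable_prod2P => //.
have /integrableP[_ /= hf] := fi; have /integrableP[_ /= hp] := phii.
have p0 : (0 <= \int[m]_x `|phi x|%:E)%E by apply: integral_ge0.
apply: (@le_lt_trans _ _ (\int[m]_y (`|f y|%:E * \int[m]_x `|phi x|%:E))%E).
  apply: ge0_le_integral => //.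
  - by move=> y _; apply: integral_ge0.
  - apply: (@measurable_fun_fubini_tonelli_G _ _ _ _ _ m (fun z => (`|f z.2 * htr phi z.1 z.2|)%:E)) => //.
    by apply/measurable_EFinP; exact: measurableT_comp.
  - apply: emeasurable_funM => //; apply/measurable_EFinP; exact: measurableT_comp.
  move=> y _; rewrite [leLHS](_ : _ = `|f y|%:E * \int[m]_x `|htr phi x y|%:E)%E.
    by rewrite lee_wpmul2l// ?lee_fin// integral_norm_htr_le.
  rewrite -ge0_integralZR//; first by apply: eq_integral => x _; rewrite /= normrM.
  by apply: measurableT_comp => //; exact: measurable_htrl.
rewrite ge0_integralZr//.
  by rewrite -ge0_fin_numE ?fin_numM ?ge0_fin_numE ?mule_ge0 ?integral_ge0.
by apply/measurable_EFinP; exact: measurableT_comp.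
Qed.

Lemma cv_bounded (M : R) x : (forall y, `|f y| <= M) ->
  `|cv f phi x| <= M * Rintegral m setT (fun x => `|phi x|).
Proof.
move=> fM.
have iH := integrable_htr x phii.
have iH' : m.-integrable setT (EFin \o htr phi x).
  by apply: eq_integrable iH => // y _; rewrite /= htrC.
have iHn : m.-integrable setT (EFin \o (fun y => M * `|htr phi x y|)).
  by apply: integrableZR; exact: integrable_normR.
have M0 : 0 <= M by apply: le_trans (fM 0).
rewrite /cv (le_trans (le_normr_Rintegral _ _))//.
  by under eq_fun do rewrite mulrC; exact: integrable_mul_bounded iH' mf fM.
apply: (@le_trans _ _ (Rintegral m setT (fun y => M * `|htr phi x y|))).
  apply: le_RintegralT => //.
    apply: integrable_normR.
    by under eq_fun do rewrite mulrC; exact: integrable_mul_bounded iH' mf fM.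
  by move=> y; rewrite normrM ler_wpM2r.
rewrite RintegralZT ?ler_wpM2l//; last exact: integrable_normR.
rewrite -lee_fin EFin_Rintegral; last exact: integrable_normR.
rewrite EFin_Rintegral; last exact: integrable_normR.
under eq_integral do rewrite htrC.
exact: integral_norm_htr_le.
Qed.

Lemma integrable_cv : m.-integrable setT (EFin \o cv f phi).
Proof.
apply/integrableP; split; first by apply/measurable_EFinP; exact: measurable_cv.
have /(integrable12ltyP) h := integrable_cv_kernel.
apply: le_lt_trans (h (measurable_int _ integrable_cv_kernel)) => /=.
apply: ge0_le_integral => //.
- by apply/measurable_EFinP; apply: measurableT_comp => //; exact: measurable_cv.
- apply: (@measurable_fun_fubini_tonelli_F _ _ _ _ _ m (fun z => (`|f z.2 * htr phi z.1 z.2|)%:E)) => //.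
  apply/measurable_EFinP; apply: measurableT_comp => //.
  exact: integrable_measurable integrable_cv_kernel.
- move=> x _; apply: le_norm_Rintegral; apply: measurable_funM => //; exact: measurable_htrr.
Qed.

(** The convolution theorem. After Fubini, self-adjointness moves the translation from [phi] onto
    the Bessel kernel, where the product formula factors it. *)
Lemma hht_cv xi : hht (cv f phi) xi = hht f xi * hht phi xi.
Proof.
have iK := integrable_cv_kernel.
pose F z := (f z.2 * htr phi z.1 z.2) * jb a (z.1 * xi).
have mF : measurable_fun setT F.
  by apply: measurable_funM; [exact: integrable_measurable iK|exact: mjbM].
have iF : (m \x m)%E.-integrable setT (EFin \o F).
  apply: (@le_integrableR _ _ _ _ _ (fun z => `|f z.2 * htr phi z.1 z.2|)) => //.
    exact: integrable_normR.
  by move=> z; rewrite normrM ler_piMr.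
transitivity (Rintegral (m \x m)%E setT F).
  rewrite -Rintegral_fubini1// /hht; apply: eq_Rintegral => x _.
  rewrite /F /cv/= RintegralZr_measurable//; apply: measurable_funM => //; exact: measurable_htrr.
rewrite -Rintegral_fubini2//.
transitivity (Rintegral m setT (fun y => (f y * jb a (y * xi)) * hht phi xi)).
  apply: eq_Rintegral => y _; rewrite /F/=.
  transitivity (f y * Rintegral m setT (fun x => jb a (x * xi) * htr phi x y)).
    rewrite -RintegralZT.
      by apply: eq_Rintegral => x _; ring.
    under eq_fun do rewrite mulrC.
    by apply: (@integrable_mul_bounded _ _ 1) => //; [exact: integrable_htr|exact: mjbM].
  rewrite (@htr_adjoint _ _ _ 1)//; last exact: mjbM.
  under eq_Rintegral do rewrite htr_jb mulrA.
  rewrite RintegralZrT; last exact: integrable_mul_jb.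
  by rewrite -/(hht phi xi); ring.
by rewrite RintegralZrT//; exact: integrable_mul_jb.
Qed.

End convolution.

End HankelTransform.

(** * The heat kernel *)

Section MarkovKernel.
Local Open Scope ereal_scope.
Context d (T : measurableType d) (R : realType) (m : {sigma_finite_measure set T -> \bar R}).
Variable k : T * T -> R.
Hypotheses (mk : measurable_fun setT k) (k0 : forall z, (0 <= k z)%R).
Hypothesis ksym : forall x y, k (x, y) = k (y, x).
Hypothesis k1 : forall x, \int[m]_y (k (x, y))%:E = 1.

Let mk1 x : measurable_fun setT (fun y => k (x, y)).
Proof. exact (measurableT_comp mk (pair1_measurable x)). Qed.

Let mu1 (u : T -> R) : measurable_fun setT u -> measurable_fun setT (fun z : T * T => u z.1).
Proof. by move=> ?; apply: measurableT_comp. Qed.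

Let mu2 (u : T -> R) : measurable_fun setT u -> measurable_fun setT (fun z : T * T => u z.2).
Proof. by move=> ?; apply: measurableT_comp. Qed.

Lemma ge0_integral_markov1 (u : T -> R) : measurable_fun setT u -> (forall x, (0 <= u x)%R) ->
  \int[m \x m]_z (u z.1 * k z)%:E = \int[m]_x (u x)%:E.
Proof.
move=> mu u0; rewrite ge0_integral_fubini1//; last 2 first.
- by apply: measurable_funM => //; exact: mu1.
- by move=> z; rewrite mulr_ge0.
by apply: eq_integral => x _ /=; rewrite ge0_integralZR// k1 mule1.
Qed.

Lemma ge0_integral_markov2 (u : T -> R) : measurable_fun setT u -> (forall x, (0 <= u x)%R) ->
  \int[m \x m]_z (u z.2 * k z)%:E = \int[m]_x (u x)%:E.
Proof.
move=> mu u0; rewrite ge0_integral_fubini2//; last 2 first.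
- by apply: measurable_funM => //; exact: mu2.
- by move=> z; rewrite mulr_ge0.
apply: eq_integral => x _ /=; under eq_integral do rewrite ksym.
by rewrite ge0_integralZR// k1 mule1.
Qed.

(** Taken with no factor [1/2]; it is therefore twice the energy gap of [dirichletE]. *)
Definition dirichlet (h : T -> R) : \bar R :=
  \int[m \x m]_z ((h z.1 - h z.2) ^+ 2 * k z)%:E.

Section energy.
Variable h : T -> R.
Hypotheses (mh : measurable_fun setT h) (ih : m.-integrable setT (EFin \o (fun x => h x ^+ 2)%R)).

Let mh2 : measurable_fun setT (fun x => h x ^+ 2)%R. Proof. exact: measurable_funX. Qed.

Let ih1 : (m \x m).-integrable setT (EFin \o (fun z => h z.1 ^+ 2 * k z)%R).
Proof.
apply: ge0_integrable.
- by apply: measurable_funM => //; exact: (mu1 mh2).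
- by move=> z; rewrite mulr_ge0// sqr_ge0.
rewrite (ge0_integral_markov1 mh2)//; last by move=> x; exact: sqr_ge0.
by rewrite -EFin_Rintegral// ltry.
Qed.

Let ih2 : (m \x m).-integrable setT (EFin \o (fun z => h z.2 ^+ 2 * k z)%R).
Proof.
apply: ge0_integrable.
- by apply: measurable_funM => //; exact: (mu2 mh2).
- by move=> z; rewrite mulr_ge0// sqr_ge0.
rewrite (ge0_integral_markov2 mh2)//; last by move=> x; exact: sqr_ge0.
by rewrite -EFin_Rintegral// ltry.
Qed.

Lemma integrable_markov_mul : (m \x m).-integrable setT (EFin \o (fun z => h z.1 * h z.2 * k z)%R).
Proof.
apply: (le_integrableR _ (integrableDR ih1 ih2)).
  by apply: measurable_funM => //; apply: measurable_funM; [exact: mu1|exact: mu2].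
move=> z; rewrite normrM (ger0_norm (k0 z)) -mulrDl ler_wpM2r//.
have := sqr_ge0 (h z.1 - h z.2); have := sqr_ge0 (h z.1 + h z.2).
rewrite !sqrrD sqrrN mulrN ler_norml => p q.
apply/andP; split; move: (sqr_ge0 (h z.1)) (sqr_ge0 (h z.2)); lra.
Qed.

(** Expanding the square: each diagonal term integrates to the integral of [h^2], since the
    symmetric kernel has mass one in either variable. *)
Lemma dirichletE :
  dirichlet h = (2 * (Rintegral m setT (fun x => h x ^+ 2) -
     Rintegral (m \x m) setT (fun z => h z.1 * h z.2 * k z)))%:E.
Proof.
have E1 : Rintegral (m \x m) setT (fun z => h z.1 ^+ 2 * k z)%R = Rintegral m setT (fun x => h x ^+ 2)%R.
  by rewrite /Rintegral (ge0_integral_markov1 mh2)// => x; exact: sqr_ge0.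
have E2 : Rintegral (m \x m) setT (fun z => h z.2 ^+ 2 * k z)%R = Rintegral m setT (fun x => h x ^+ 2)%R.
  by rewrite /Rintegral (ge0_integral_markov2 mh2)// => x; exact: sqr_ge0.
have := integrableBR (integrableDR ih1 ih2) (integrableZR 2 integrable_markov_mul).
have := RintegralBT (integrableDR ih1 ih2) (integrableZR 2 integrable_markov_mul).
rewrite (RintegralDT ih1 ih2) (RintegralZT 2 integrable_markov_mul) E1 E2 => e i.
rewrite /dirichlet [RHS](_ : _ = (Rintegral m setT (fun x => h x ^+ 2) +
  Rintegral m setT (fun x => h x ^+ 2) - 2 * Rintegral (m \x m) setT (fun z => h z.1 * h z.2 * k z))%:E); last by congr EFin; ring.
rewrite -e EFin_Rintegral//; apply: eq_integral => z _; congr EFin; ring.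
Qed.

End energy.

(** From [h x - h y = A + B - C], with [B = g x - g y] and [A], [C] the errors at the two points,
    and [(A + B - C)^2 <= 3 (A^2 + B^2 + C^2)]. It transfers smallness of the form from a regular
    [g] to [h]. *)
Lemma dirichlet_le (h g : T -> R) : measurable_fun setT h -> measurable_fun setT g ->
  dirichlet h <= 3%:E * (\int[m]_x ((h x - g x) ^+ 2)%:E + dirichlet g + \int[m]_x ((h x - g x) ^+ 2)%:E).
Proof.
move=> mh mg.
have md : measurable_fun setT (fun x => (h x - g x) ^+ 2)%R.
  by apply: measurable_funX; exact: measurable_funB.
have d0 x : (0 <= (h x - g x) ^+ 2)%R by exact: sqr_ge0.
have md1 : measurable_fun setT (fun z => (h z.1 - g z.1) ^+ 2 * k z)%R.
  by apply: measurable_funM => //; exact: (mu1 md).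
have md2 : measurable_fun setT (fun z => (h z.2 - g z.2) ^+ 2 * k z)%R.
  by apply: measurable_funM => //; exact: (mu2 md).
have mD (u : T -> R) : measurable_fun setT u -> measurable_fun setT (fun z : T * T => (u z.1 - u z.2) ^+ 2 * k z)%R.
  move=> mu; apply: measurable_funM => //; apply: measurable_funX.
  by apply: measurable_funB; [exact: mu1|exact: mu2].
have p0 (u : T * T -> R) z : (0 <= u z ^+ 2 * k z)%R by rewrite mulr_ge0// sqr_ge0.
have E1 := ge0_integral_markov1 md d0; have E2 := ge0_integral_markov2 md d0.
rewrite -[X in (X + _ + _)%E]E1 -[X in (_ + _ + X)%E]E2 /dirichlet.
have mD1 : measurable_fun setT (fun z => (h z.1 - g z.1) ^+ 2 * k z + (g z.1 - g z.2) ^+ 2 * k z)%R.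
  by apply: measurable_funD => //; exact: mD.
rewrite -ge0_integralDR//; [|exact: mD|by move=> z; exact: (p0 (fun z => h z.1 - g z.1)%R)|by move=> z; exact: (p0 (fun z => g z.1 - g z.2)%R)].
rewrite -ge0_integralDR//; last 2 first.
- by move=> z; rewrite addr_ge0//; [exact: (p0 (fun z => h z.1 - g z.1)%R)|exact: (p0 (fun z => g z.1 - g z.2)%R)].
- by move=> z; exact: (p0 (fun z => h z.2 - g z.2)%R).
rewrite -ge0_integralZR//; last 2 first.
- exact: measurable_funD.
- move=> z; rewrite !addr_ge0//; [exact: (p0 (fun z => h z.1 - g z.1)%R)|exact: (p0 (fun z => g z.1 - g z.2)%R)|exact: (p0 (fun z => h z.2 - g z.2)%R)].
apply: ge0_le_integralR.
- exact: mD.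
- by apply: measurable_funM => //; exact: measurable_funD.
- by move=> z; exact: (p0 (fun z => h z.1 - h z.2)%R).
move=> z; rewrite -!mulrDl mulrA ler_wpM2r//.
set A := (h z.1 - g z.1)%R; set B := (g z.1 - g z.2)%R; set C := (h z.2 - g z.2)%R.
have -> : (h z.1 - h z.2 = A + B - C)%R by rewrite /A /B /C; ring.
have := sqr_ge0 (A - B); have := sqr_ge0 (A + C); have := sqr_ge0 (B + C); nra.
Qed.

End MarkovKernel.

(** For infinite [x] both sides are [0], whether or not [r] vanishes. *)
Lemma fine_mulEFin (R : realType) (r : R) (x : \bar R) : fine (r%:E * x)%E = r * fine x.
Proof.
case: x => [s| |] //=; rewrite mulr0.
- by rewrite /mule/=; case: ifP => // _; case: ifP.
- by rewrite /mule/=; case: ifP => // _; case: ifP.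
Qed.

(** * Gaussians, their transforms and the heat kernel *)

Section GaussianKernel.
Context (R : realType) (a : R) (m P : {sigma_finite_measure set R -> \bar R}).
Hypothesis H : hankel_measures a m P.

Let a_gt : 1 / 2 < a. Proof. exact: hm_gt H. Qed.
Let P1 : P setT = 1%E. Proof. exact: hm_P1 H. Qed.
Let a0 : 0 < a. Proof. have h := a_gt; lra. Qed.
Let Poo : (P setT < +oo)%E. Proof. by rewrite P1 ltry. Qed.
Let mjb : measurable_fun setT (jb a). Proof. exact: measurable_jb. Qed.
Let jb1 z : `|jb a z| <= 1. Proof. exact: (jb_le1 a_gt P1 (hm_cos_even H)). Qed.
Let mjbM d (T : measurableType d) (f g : T -> R) :
  measurable_fun setT f -> measurable_fun setT g -> measurable_fun setT (fun z => jb a (f z * g z)).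
Proof. by move=> mf mg; apply: measurableT_comp => //; exact: measurable_funM. Qed.

Definition gauss (r x : R) : R := expR (- ((r * x) ^+ 2 / 2)).

Lemma gauss_ge0 r x : 0 <= gauss r x. Proof. exact: expR_ge0. Qed.

Lemma gauss_le1 r x : gauss r x <= 1.
Proof. by rewrite /gauss -[leRHS]expR0 ler_expR oppr_le0 divr_ge0// sqr_ge0. Qed.

Lemma measurable_gauss r : measurable_fun setT (gauss r).
Proof.
apply: (measurableT_comp (f := @expR R)) => //; apply: measurableT_comp => //.
by apply: measurable_funM => //; apply: measurable_funX; exact: measurable_funM.
Qed.

Lemma Rintegral_scale (k : R) (g : R -> R) : 0 < k -> measurable_fun setT g ->
  Rintegral m setT (fun x => g (k * x)) = powR k (- (2 * a)) * Rintegral m setT g.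
Proof.
move=> k0 mg; rewrite /Rintegral (hm_scale H k0 (g := EFin \o g)); last exact/measurable_EFinP.
exact: fine_mulEFin.
Qed.

Lemma integral_gauss_moment (n : nat) (r : R) : 0 < r ->
  (\int[m]_x ((r * x) ^+ (2 * n) * gauss r x)%:E =
   (powR r (- (2 * a)) * (2 ^+ n * risef a n))%:E)%E.
Proof.
move=> r0; rewrite EFinM -(hm_gauss H n).
rewrite (hm_scale H r0 (g := fun x => (x ^+ (2 * n) * expR (- (x ^+ 2 / 2)))%:E))//.
apply/measurable_EFinP; apply: measurable_funM; first exact: measurable_funX.
exact: measurable_gauss_half.
Qed.

Lemma integrable_gauss_moment (n : nat) r : 0 < r ->
  m.-integrable setT (EFin \o (fun x => (r * x) ^+ (2 * n) * gauss r x)).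
Proof.
move=> r0; apply: ge0_integrable.
- by apply: measurable_funM; [apply: measurable_funX; exact: measurable_funM|exact: measurable_gauss].
- by move=> x; rewrite mulr_ge0 ?gauss_ge0// exprM exprn_ge0// sqr_ge0.
- by rewrite integral_gauss_moment// ltry.
Qed.

Lemma integrable_gauss r : 0 < r -> m.-integrable setT (EFin \o gauss r).
Proof.
move=> r0; apply: eq_integrable (integrable_gauss_moment 0 r0) => // x _.
by rewrite /= mul1r.
Qed.

(** The standard Gaussian is its own Hankel transform: term by term, the Gaussian moments turn the
    Bessel series into the exponential series of [- w^2/2], dominated by that of [w^2/2]. *)
Lemma Rintegral_jb_gauss1 w :
  Rintegral m setT (fun x => jb a (w * x) * gauss 1 x) = expR (- (w ^+ 2 / 2)).
Proof.
pose f n x : R := bc a n * (w * x) ^+ (2 * n) * gauss 1 x.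
pose c n : R := bc a n * w ^+ (2 * n).
have fE n x : f n x = c n * ((1 * x) ^+ (2 * n) * gauss 1 x).
  by rewrite /f /c exprMn mul1r; ring.
have f0 p : p`!%:R != 0 :> R by rewrite pnatr_eq0 -lt0n fact_gt0.
have r0 p : risef a p != 0 by rewrite gt_eqF// risef_gt0.
have e0 p : 4 ^+ p != 0 :> R by rewrite expf_neq0.
have e2 p : 2 ^+ p != 0 :> R by rewrite expf_neq0.
have E4 p : 4 ^+ p = 2 ^+ p * 2 ^+ p :> R by rewrite -exprMn -natrM.
have cE n : c n * (2 ^+ n * risef a n) = exp_coeff (- (w ^+ 2 / 2)) n.
  rewrite /c /bc /exp_coeff/= [(- (_ / _)) ^+ n]exprNn expr_div_n exprM E4.
  by field; rewrite f0 r0 e2.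
have nE n : `|c n| * (2 ^+ n * risef a n) = exp_coeff (w ^+ 2 / 2) n.
  rewrite -[2 ^+ n * risef a n]ger0_norm; last by rewrite mulr_ge0 ?exprn_ge0// ltW// risef_gt0.
  rewrite -normrM cE /exp_coeff/= exprNn normrM normrM normrX normrN1 expr1n mul1r.
  by rewrite !ger0_norm// ?invr_ge0// exprn_ge0// divr_ge0// sqr_ge0.
have mf n : measurable_fun setT (f n).
  apply: measurable_funM; last exact: measurable_gauss.
  by apply: measurable_funM => //; apply: measurable_funX; exact: measurable_funM.
have fu n : (\int[m]_x `|f n x|%:E <= (exp_coeff (w ^+ 2 / 2) n)%:E)%E.
  rewrite -nE; under eq_integral => x _.
    rewrite fE normrM [X in _ * X]ger0_norm; last first.
      by rewrite mulr_ge0 ?gauss_ge0// exprM exprn_ge0// sqr_ge0.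
    over.
  rewrite ge0_integralZR//; last 2 first.
  - apply: measurable_funM; last exact: measurable_gauss.
    by apply: measurable_funX; exact: measurable_funM.
  - by move=> x; rewrite mulr_ge0 ?gauss_ge0// exprM exprn_ge0// sqr_ge0.
  by rewrite integral_gauss_moment// powR1 mul1r EFinM.
have fc x : series (f ^~ x) n @[n --> \oo] --> jb a (w * x) * gauss 1 x.
  have -> : series (f ^~ x) = (fun n => series (fun k => bc a k * (w * x) ^+ (2 * k)) n * gauss 1 x).
    by apply/funext => n; rewrite /series/= mulr_suml.
  by apply: cvgMl; exact: cvg_jb.
have [_ h] := @integral_series _ _ _ m f (fun x => jb a (w * x) * gauss 1 x) _ mf fu
  (@is_cvg_series_exp_coeff _ _) fc.
apply: (cvg_unique (@Rhausdorff R) h).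
rewrite (_ : (fun k => Rintegral m setT (f k)) = exp_coeff (- (w ^+ 2 / 2))).
  exact: is_cvg_series_exp_coeff.
apply/funext => n; rewrite -cE.
have -> : f n = (fun x => c n * ((1 * x) ^+ (2 * n) * gauss 1 x)).
  by apply/funext => x; exact: fE.
rewrite RintegralZT; last exact: integrable_gauss_moment.
by rewrite /Rintegral integral_gauss_moment// powR1 mul1r.
Qed.

(** The Hankel transform of [gauss r], written in closed form; the power of [r] gives it mass one
    with respect to [m]. *)
Definition heat (r w : R) : R := powR r (- (2 * a)) * gauss r^-1 w.

Lemma heat_ge0 r w : 0 <= heat r w.
Proof. by rewrite mulr_ge0 ?powR_ge0 ?gauss_ge0. Qed.

Lemma measurable_heat r : measurable_fun setT (heat r).
Proof. by apply: measurable_funM => //; exact: measurable_gauss. Qed.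

Lemma heat_le r w : `|heat r w| <= powR r (- (2 * a)).
Proof. by rewrite ger0_norm ?heat_ge0// ler_piMr ?powR_ge0 ?gauss_le1. Qed.

Lemma Rintegral_jb_gauss r w : 0 < r ->
  Rintegral m setT (fun x => jb a (w * x) * gauss r x) = heat r w.
Proof.
move=> r0; rewrite /heat {2}/gauss [r^-1 * w]mulrC -(Rintegral_jb_gauss1 (w / r)).
have mg : measurable_fun setT (fun x => jb a (w / r * x) * gauss 1 x).
  by apply: measurable_funM; [exact: mjbM|exact: measurable_gauss].
rewrite -(Rintegral_scale r0 mg); apply: eq_Rintegral => x _.
by rewrite /gauss mul1r mulrA divfK// gt_eqF.
Qed.

Lemma integral_heat (r : R) : 0 < r -> (\int[m]_x (heat r x)%:E = 1)%E.
Proof.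
move=> r0; have ri : 0 < r^-1 by rewrite invr_gt0.
rewrite ge0_integralZR ?powR_ge0//; [|exact: measurable_gauss|by move=> x; exact: gauss_ge0].
have -> : (\int[m]_x (gauss r^-1 x)%:E = \int[m]_x ((r^-1 * x) ^+ (2 * 0) * gauss r^-1 x)%:E)%E.
  by apply: eq_integral => x _; rewrite muln0 expr0 mul1r.
rewrite integral_gauss_moment//; rewrite -EFinM risef0 mulr1 mulr1 -powR_inv1 ?ltW// -powRrM -powRD.
  by rewrite mulN1r opprK addNr powRr0.
by rewrite (gt_eqF r0) implybT.
Qed.

Lemma integral_sqr_heat (r : R) : 0 < r -> (\int[m]_x (x ^+ 2 * heat r x)%:E = (2 * a * r ^+ 2)%:E)%E.
Proof.
move=> r0; have ri : 0 < r^-1 by rewrite invr_gt0.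
have rn : r != 0 by rewrite gt_eqF.
have -> : (\int[m]_x (x ^+ 2 * heat r x)%:E =
  \int[m]_x ((powR r (- (2 * a)) * r ^+ 2) * ((r^-1 * x) ^+ (2 * 1) * gauss r^-1 x))%:E)%E.
  apply: eq_integral => x _; congr EFin; rewrite /heat exprMn muln1.
  move: (gauss _ _) (powR _ _) => g p; by field.
have k0 : 0 <= powR r (- (2 * a)) * r ^+ 2 by apply: mulr_ge0; [exact: powR_ge0|exact: sqr_ge0].
rewrite ge0_integralZR//; last 2 first.
- apply: measurable_funM; last exact: measurable_gauss.
  by apply: measurable_funX; exact: measurable_funM.
- by move=> x; rewrite mulr_ge0 ?gauss_ge0// exprM exprn_ge0// sqr_ge0.
rewrite integral_gauss_moment// -EFinM; congr EFin.
rewrite expr1 risefS risef0 mul1r addr0.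
have -> : powR r^-1 (- (2 * a)) = (powR r (- (2 * a)))^-1 by rewrite -powR_inv1 ?ltW// -powRrM mulN1r -powRN.
by field; rewrite gt_eqF// powR_gt0.
Qed.

Definition heatk r (z : R * R) : R := htr P (heat r) z.1 z.2.

Lemma measurable_heatk r : measurable_fun setT (heatk r).
Proof. by apply: measurable_htr; exact: measurable_heat. Qed.

Let mheat_hw r x y : measurable_fun setT (fun t => heat r (hw x y t)).
Proof. by apply: (measurableT_comp (measurable_heat r)); exact: measurable_hw_last. Qed.

Lemma heatkE r x y : (heatk r (x, y))%:E = (\int[P]_t (heat r (hw x y t))%:E)%E.
Proof.
rewrite /heatk/= /htr EFin_Rintegral//.
apply: (@integrable_bounded _ _ _ P (fun t => heat r (hw x y t))) => // t.
exact: heat_le.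
Qed.

Lemma heatk_ge0 r z : 0 <= heatk r z.
Proof.
case: z => x y; rewrite -lee_fin heatkE; apply: integral_ge0 => t _.
by rewrite lee_fin heat_ge0.
Qed.

Lemma heatkC r x y : heatk r (x, y) = heatk r (y, x).
Proof. exact: htrC. Qed.

Lemma integral_heatk r x : 0 < r -> (\int[m]_y (heatk r (x, y))%:E = 1)%E.
Proof.
move=> r0; under eq_integral do rewrite heatkE.
rewrite -(@ge0_integral_fubini1 _ _ _ _ _ m P (fun q => heat r (hw x q.1 q.2)))//.
- rewrite (ge0_integral_hw H x (measurable_heat r)); first exact: integral_heat.
  by move=> ?; exact: heat_ge0.
- by apply: (measurableT_comp (measurable_heat r)); exact: measurable_hw_pair.
- by move=> q; exact: heat_ge0.
Qed.

Lemma sqr_norm_sub_le_hw (x y t : R) : (`|x| - `|y|) ^+ 2 <= hw x y t ^+ 2.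
Proof.
rewrite hw_sqr sqrrB !real_normK ?num_real//.
have : `|x * y * cos t| <= `|x| * `|y|.
  by rewrite !normrM ler_piMr ?mulr_ge0// ler_norml cos_geN1 cos_le1.
by move=> /ler_normlP[h _]; lra.
Qed.

(** Since [hw x y t] is at least the distance of [|x|] and [|y|], translation invariance bounds the
    spread of the kernel by the second moment of [heat r]. *)
Lemma integral_sqr_heatk_le (r x : R) : 0 < r ->
  (\int[m]_y ((`|x| - `|y|) ^+ 2 * heatk r (x, y))%:E <= (2 * a * r ^+ 2)%:E)%E.
Proof.
move=> r0.
have mw : measurable_fun setT (fun w : R => w ^+ 2 * heat r w).
  by apply: measurable_funM; [exact: measurable_funX|exact: measurable_heat].
have w0 w : 0 <= w ^+ 2 * heat r w by rewrite mulr_ge0 ?heat_ge0 ?sqr_ge0.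
rewrite -integral_sqr_heat// -(ge0_integral_hw H x mw w0).
rewrite ge0_integral_fubini1//; last first.
  by apply: (measurableT_comp mw); exact: measurable_hw_pair.
apply: ge0_le_integral => //.
- by move=> y _; rewrite lee_fin mulr_ge0 ?heatk_ge0 ?sqr_ge0.
- apply/measurable_EFinP; apply: measurable_funM.
    by apply: measurable_funX; apply: measurable_funB => //; exact: measurableT_comp.
  exact (measurableT_comp (measurable_heatk r) (pair1_measurable x)).
- apply: (@measurable_fun_fubini_tonelli_F _ _ _ _ _ P (fun q => (hw x q.1 q.2 ^+ 2 * heat r (hw x q.1 q.2))%:E)) => //.
    by apply/measurable_EFinP; apply: (measurableT_comp mw); exact: measurable_hw_pair.
  by move=> q; rewrite lee_fin.
- move=> y _; rewrite EFinM heatkE -ge0_integralZR ?sqr_ge0//.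
    apply: ge0_le_integralR.
    + exact: measurable_funM.
    + by apply: (measurableT_comp mw); exact: measurable_hw_last.
    + by move=> t; rewrite mulr_ge0 ?heat_ge0 ?sqr_ge0.
    + by move=> t; rewrite ler_wpM2r ?heat_ge0 ?sqr_norm_sub_le_hw.
  by move=> t; exact: heat_ge0.
Qed.

(** The product formula merges the two Bessel factors into one, averaged over the angle; Fubini and
    the Gaussian transform then give the translated heat kernel. *)
Lemma Rintegral_jb2_gauss r x y : 0 < r ->
  Rintegral m setT (fun xi => jb a (x * xi) * jb a (y * xi) * gauss r xi) = heatk r (x, y).
Proof.
move=> r0.
pose F (q : R * R) := jb a (hw x y q.2 * q.1) * gauss r q.1.
have mh : measurable_fun setT (fun q : R * R => hw x y q.2) by apply: measurable_hw.
have mg := measurable_gauss r.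
have iF : (m \x P)%E.-integrable setT (EFin \o F).
  have i1 : P.-integrable setT (EFin \o (fun=> 1)) by apply: (@integrable_bounded _ _ _ P (fun=> 1) 1) => //; rewrite normr1.
  apply: (integrable_tensor _ (integrable_gauss r0) i1).
    by apply: measurable_funM; [exact: mjbM|exact: measurableT_comp].
  move=> xi t; rewrite /F/= mulr1 normrM [X in _ * X]ger0_norm ?gauss_ge0//.
  by rewrite ler_piMl ?gauss_ge0.
transitivity (Rintegral (m \x P)%E setT F).
  rewrite -Rintegral_fubini1//; apply: eq_Rintegral => xi _.
  rewrite /F/= RintegralZr_measurable; last by apply: mjbM => //; exact: measurable_hw_last.
  by rewrite -(htr_jb H).
rewrite -Rintegral_fubini2//; apply: eq_Rintegral => t _.
by rewrite /F/= Rintegral_jb_gauss.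
Qed.

End GaussianKernel.

(** * Plancherel *)

Lemma integral_le_fatou d (T : measurableType d) (R : realType) (m : {measure set T -> \bar R})
    (f : nat -> T -> R) (g : T -> R) (B : \bar R) :
  (forall n, measurable_fun setT (f n)) -> (forall n x, 0 <= f n x) ->
  (forall n, \int[m]_x (f n x)%:E <= B)%E ->
  (forall x, f n x @[n --> \oo] --> g x) -> (\int[m]_x (g x)%:E <= B)%E.
Proof.
move=> mf f0 fB fg.
have -> : (\int[m]_x (g x)%:E = \int[m]_x limn_einf (fun n => (f n x)%:E))%E.
  apply: eq_integral => x _; have h : (f n x)%:E @[n --> \oo] --> (g x)%:E.
    by apply: cvg_EFin; [exact: nearW|exact: fg].
  by rewrite (cvg_limn_einf_sup h).1.
apply: (@le_trans _ _ (limn_einf (fun n => \int[m]_x (f n x)%:E))%E).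
  apply: (fatou m measurableT (f := fun n x => (f n x)%:E)).
    by move=> n; exact/measurable_EFinP.
  by move=> n x _; rewrite lee_fin.
rewrite limn_einf_lim; apply: lime_le; first exact: is_cvg_einfs.
apply: nearW => n; apply: le_trans (fB n).
by apply: ereal_inf_lbound; exists n => /=.
Qed.

(** Mean-square approximation by bounded functions of bounded support. Uniform continuity is for the
    distance of [|x|] and [|y|], the one that the heat kernel estimate controls. *)
Definition uc_dense (R : realType) (m : {measure set R -> \bar R}) : Prop :=
  forall (h : R -> R) (M e : R), measurable_fun setT h -> (forall x, `|h x| <= M) ->
  m.-integrable setT (EFin \o h) -> 0 < e ->
  exists (g : R -> R) (K N : R), [/\ measurable_fun setT g,
    (forall x, `|g x| <= K) /\ (forall x, N < `|x| -> g x = 0),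
    (m [set x : R | (`|x| <= N)%R] < +oo)%E,
    (\int[m]_x ((h x - g x) ^+ 2)%:E <= e%:E)%E &
    forall e', 0 < e' -> exists2 d, 0 < d & forall x y, `| `|x| - `|y| | < d -> `|g x - g y| <= e'].

Section Plancherel.
Context (R : realType) (a : R) (m P : {sigma_finite_measure set R -> \bar R}).
Hypothesis H : hankel_measures a m P.
Hypothesis D : uc_dense m.

Let a_gt : 1 / 2 < a. Proof. exact: hm_gt H. Qed.
Let a0 : 0 < a. Proof. have h := a_gt; lra. Qed.
Let mjb : measurable_fun setT (jb a). Proof. exact: measurable_jb. Qed.
Let jb1 z : `|jb a z| <= 1. Proof. exact: (jb_le1 a_gt (hm_P1 H) (hm_cos_even H)). Qed.
Let mjbM d (T : measurableType d) (f g : T -> R) :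
  measurable_fun setT f -> measurable_fun setT g -> measurable_fun setT (fun z => jb a (f z * g z)).
Proof. by move=> mf mg; apply: measurableT_comp => //; exact: measurable_funM. Qed.

Let mk r : measurable_fun setT (heatk a P r). Proof. exact: measurable_heatk. Qed.
Let k0 r z : 0 <= heatk a P r z. Proof. exact: (heatk_ge0 H). Qed.
Let ksym r x y : heatk a P r (x, y) = heatk a P r (y, x). Proof. exact: heatkC. Qed.
Let k1 r x : 0 < r -> (\int[m]_y (heatk a P r (x, y))%:E = 1)%E.
Proof. exact: (integral_heatk H). Qed.

Let mabs : measurable_fun setT (fun x : R => `|x|). Proof. exact: measurableT_comp. Qed.

(** Near the diagonal the modulus of continuity gives [e^2], elsewhere the bound [4 K^2] is absorbed
    by the squared distance. The integrand vanishes unless one of the points has modulus at most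
    [N]; by symmetry this costs twice the mass of that set. *)
Lemma dirichlet_heat_le (g : R -> R) (K N d e r : R) : measurable_fun setT g ->
  (forall x, `|g x| <= K) -> (forall x, N < `|x| -> g x = 0) ->
  (m [set x : R | (`|x| <= N)%R] < +oo)%E -> 0 < d -> 0 < r ->
  (forall x y, `| `|x| - `|y| | < d -> `|g x - g y| <= e) ->
  (dirichlet m (heatk a P r) g <=
   (2 * fine (m [set x : R | (`|x| <= N)%R]) * (e ^+ 2 + 4 * K ^+ 2 / d ^+ 2 * (2 * a * r ^+ 2)))%:E)%E.
Proof.
move=> mg gK gN mB d0 r0 gd.
set B := [set x : R | `|x| <= N]; set C := 4 * K ^+ 2 / d ^+ 2.
have mBs : measurable B.
  rewrite (_ : B = (fun x => `|x|) @^-1` `]-oo, N]); last first.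
    by apply/seteqP; split => x /=; rewrite in_itv/=.
  by rewrite -[X in measurable X]setTI; exact: mabs.
have C0 : 0 <= C by rewrite /C; apply: divr_ge0; [apply: mulr_ge0 => //; exact: sqr_ge0|exact: sqr_ge0].
pose q (z : R * R) := (e ^+ 2 + C * (`|z.1| - `|z.2|) ^+ 2) * heatk a P r z.
have mz1 : measurable_fun setT (fun z : R * R => `|z.1|) by apply: (measurableT_comp mabs).
have mz2 : measurable_fun setT (fun z : R * R => `|z.2|) by apply: (measurableT_comp mabs).
have mq : measurable_fun setT q.
  apply: measurable_funM => //; apply: measurable_funD => //; apply: measurable_funM => //.
  by apply: measurable_funX; exact: measurable_funB.
have p0 u : 0 <= e ^+ 2 + C * u ^+ 2.
  by apply: addr_ge0; [exact: sqr_ge0|apply: mulr_ge0 => //; exact: sqr_ge0].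
have q0 z : 0 <= q z by apply: mulr_ge0; [exact: p0|].
have qsym x y : q (x, y) = q (y, x).
  by rewrite /q/= ksym -[in RHS]opprB sqrrN.
have qint x : (\int[m]_y (q (x, y))%:E <= (e ^+ 2 + C * (2 * a * r ^+ 2))%:E)%E.
  have mk1 : measurable_fun setT (fun y => heatk a P r (x, y)).
    exact (measurableT_comp (@mk r) (pair1_measurable x)).
  have mk2 : measurable_fun setT (fun y : R => (`|x| - `|y|) ^+ 2 * heatk a P r (x, y)).
    apply: measurable_funM => //; apply: measurable_funX; exact: measurable_funB.
  have k20 y : 0 <= (`|x| - `|y|) ^+ 2 * heatk a P r (x, y) by rewrite mulr_ge0 ?sqr_ge0.
  have -> : (\int[m]_y (q (x, y))%:E =
    \int[m]_y (e ^+ 2 * heatk a P r (x, y) + C * ((`|x| - `|y|) ^+ 2 * heatk a P r (x, y)))%:E)%E.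
    by apply: eq_integral => y _; congr EFin; rewrite /q/= mulrDl -(mulrA C).
  have ma1 : measurable_fun setT (fun y => e ^+ 2 * heatk a P r (x, y)) by exact: measurable_funM.
  have ma2 : measurable_fun setT (fun y : R => C * ((`|x| - `|y|) ^+ 2 * heatk a P r (x, y))).
    exact: measurable_funM.
  have a10 y : 0 <= e ^+ 2 * heatk a P r (x, y) by apply: mulr_ge0 => //; exact: sqr_ge0.
  have a20 y : 0 <= C * ((`|x| - `|y|) ^+ 2 * heatk a P r (x, y)) by exact: mulr_ge0.
  rewrite (ge0_integralDR _ ma1 ma2 a10 a20) (ge0_integralZR _ mk1 (sqr_ge0 e) (fun y => @k0 r (x, y))) k1// mule1.
  rewrite (ge0_integralZR _ mk2 C0 k20) EFinD (EFinM C).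
  by rewrite leeD2l// lee_wpmul2l ?lee_fin//; exact: (integral_sqr_heatk_le H).
have m1B : measurable_fun setT (\1_B : R -> R) by exact: measurable_indic.
have B0 x : 0 <= \1_B x :> R by rewrite indicE.
have mb1 : measurable_fun setT (fun z => \1_B z.1 * q z).
  by apply: measurable_funM => //; exact: measurableT_comp.
have mb2 : measurable_fun setT (fun z => \1_B z.2 * q z).
  by apply: measurable_funM => //; exact: measurableT_comp.
have b10 z : 0 <= \1_B z.1 * q z by exact: mulr_ge0.
have b20 z : 0 <= \1_B z.2 * q z by exact: mulr_ge0.
have half : (\int[m \x m]_z (\1_B z.1 * q z)%:E <= (fine (m B) * (e ^+ 2 + C * (2 * a * r ^+ 2)))%:E)%E.
  rewrite (ge0_integral_fubini1 m m mb1 b10).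
  apply: (@le_trans _ _ (\int[m]_x ((\1_B x)%:E * (e ^+ 2 + C * (2 * a * r ^+ 2))%:E))%E).
    apply: ge0_le_integral => //.
    - by move=> x _; apply: integral_ge0 => y _; rewrite lee_fin mulr_ge0.
    - apply: (@measurable_fun_fubini_tonelli_F _ _ _ _ _ m (fun z => (\1_B z.1 * q z)%:E)).
        exact/measurable_EFinP.
      by move=> z; rewrite lee_fin; exact: b10.
    - by apply: emeasurable_funM => //; exact/measurable_EFinP.
    - move=> x _ /=; have mqx : measurable_fun setT (fun y => q (x, y)).
        exact (measurableT_comp mq (pair1_measurable x)).
      rewrite (ge0_integralZR _ mqx (B0 x) (fun y => q0 (x, y))).
      by apply: lee_wpmul2l => //; rewrite lee_fin.
  have c0 : 0 <= e ^+ 2 + C * (2 * a * r ^+ 2).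
    apply: addr_ge0; first exact: sqr_ge0.
    by apply: mulr_ge0 => //; apply: mulr_ge0; [rewrite mulr_ge0// ltW|exact: sqr_ge0].
  have mEB : measurable_fun setT (fun x => (\1_B x : R)%:E) by exact/measurable_EFinP.
  rewrite (ge0_integralZr m measurableT mEB) ?lee_fin//.
  by rewrite integral_indic// setIT EFinM fineK// ge0_fin_numE.
have half2 : (\int[m \x m]_z (\1_B z.2 * q z)%:E <= (fine (m B) * (e ^+ 2 + C * (2 * a * r ^+ 2)))%:E)%E.
  apply: le_trans half.
  rewrite (ge0_integral_fubini2 m m mb2 b20).
  rewrite (ge0_integral_fubini1 m m mb1 b10).
  rewrite le_eqVlt; apply/orP; left; apply/eqP.
  by apply: eq_integral => y _; apply: eq_integral => x _ /=; rewrite qsym.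
have K0 : 0 <= K by apply: le_trans (gK 0).
apply: (@le_trans _ _ (\int[m \x m]_z (\1_B z.1 * q z + \1_B z.2 * q z)%:E)%E).
  apply: ge0_le_integralR.
  - apply: measurable_funM => //; apply: measurable_funX.
    by apply: measurable_funB; apply: measurableT_comp.
  - by apply: measurable_funD; apply: measurable_funM => //; exact: measurableT_comp.
  - by move=> z; rewrite mulr_ge0 ?sqr_ge0.
  case=> x y; rewrite /q/= -mulrDl mulrA ler_wpM2r//.
  (* The constant [C] satisfies [C d^2 = 4 K^2], which is what the case of distance at least [d]
     requires. *)
  have main : (g x - g y) ^+ 2 <= e ^+ 2 + C * (`|x| - `|y|) ^+ 2.
    have [lt|ge] := ltP `| `|x| - `|y| | d.
      rewrite -[leLHS]real_normK ?num_real//.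
      rewrite (@le_trans _ _ (e ^+ 2))//.
        by rewrite lerXn2r ?nnegrE ?gd// (le_trans _ (gd _ _ lt)).
      by rewrite lerDl mulr_ge0 ?sqr_ge0.
    apply: (@le_trans _ _ (4 * K ^+ 2)).
      have := gK x; have := gK y; rewrite !ler_norml => /andP[p1 p2] /andP[p3 p4].
      have : `|g x - g y| <= 2 * K by rewrite ler_norml; apply/andP; split; lra.
      move=> p; rewrite -[(g x - g y) ^+ 2]real_normK ?num_real//.
      have -> : 4 * K ^+ 2 = (2 * K) ^+ 2 by rewrite exprMn -natrX.
      by rewrite lerXn2r ?nnegrE ?mulr_ge0.
    rewrite -[leLHS]add0r lerD ?sqr_ge0// /C mulrAC ler_pdivlMr ?exprn_gt0//.
    rewrite ler_wpM2l ?mulr_ge0 ?sqr_ge0//.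
    by rewrite -[leRHS]real_normK ?num_real// lerXn2r ?nnegrE// ltW.
  have q00 := p0 (`|x| - `|y|).
  have BE z : \1_B z = (`|z| <= N)%R%:R :> R.
    by rewrite indicE; suff -> : (z \in B) = (`|z| <= N)%R by []; apply/idP/idP; rewrite inE.
  rewrite !BE; have [hx|hx] := leP `|x| N; have [hy|hy] := leP `|y| N => /=.
  - by lra.
  - by rewrite addr0 mul1r.
  - by rewrite add0r mul1r.
  - by rewrite (gN _ hx) (gN _ hy) subr0 addr0 mul0r expr0n.
rewrite (ge0_integralDR _ mb1 mb2 b10 b20).
rewrite -mulrA mulr_natl mulr2n EFinD; exact: leeD.
Qed.

Lemma dirichlet_heat_small (h : R -> R) (M e : R) : measurable_fun setT h ->
  (forall x, `|h x| <= M) -> m.-integrable setT (EFin \o h) -> 0 < e ->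
  exists2 r, 0 < r & (dirichlet m (heatk a P r) h <= e%:E)%E.
Proof.
move=> mh hM ih e0.
(* The budget is [3 (e/12 + e/6 + e/12) = e]: [e/12] for each approximation error and [e/6] for the
   form of [g], shared equally by [e1] and [r]. *)
have [|g [K [N [mg [gK gN] mB hg uc]]]] := @D h M (e / 12) mh hM ih; first by rewrite divr_gt0.
set mb := fine (m [set x : R | (`|x| <= N)%R]).
have mb0 : 0 <= mb by apply: fine_ge0.
pose e1 := Num.sqrt (e / 24 / (mb + 1)).
have mb1 : 0 < mb + 1 by lra.
have e1gt : 0 < e1 by rewrite sqrtr_gt0 !divr_gt0.
have e1sq : e1 ^+ 2 = e / 24 / (mb + 1) by rewrite sqr_sqrtr// ltW// !divr_gt0.
have [d d0 gd] := uc e1 e1gt.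
(* The coefficient of [r^2] in the bound for the form of [g]; adding [1] to it and to [mb] keeps the
   denominators positive. *)
pose Y := 2 * mb * (4 * K ^+ 2 / d ^+ 2 * (2 * a)).
have C0 : 0 <= 4 * K ^+ 2 / d ^+ 2.
  by apply: divr_ge0; [apply: mulr_ge0 => //; exact: sqr_ge0|exact: sqr_ge0].
have Y0 : 0 <= Y.
  rewrite /Y; apply: mulr_ge0; first exact: mulr_ge0.
  by apply: mulr_ge0 => //; rewrite mulr_ge0// ltW.
pose r := Num.sqrt (e / 12 / (Y + 1)).
have Y1 : 0 < Y + 1 by lra.
have r0 : 0 < r by rewrite sqrtr_gt0 !divr_gt0.
have rsq : r ^+ 2 = e / 12 / (Y + 1) by rewrite sqr_sqrtr// ltW// !divr_gt0.
exists r => //.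
apply: (le_trans (dirichlet_le (@mk r) (@k0 r) (@ksym r) (fun x => @k1 r x r0) mh mg)).
have := dirichlet_heat_le mg gK gN mB d0 r0 gd; rewrite -/mb => Dg.
apply: (@le_trans _ _ (3%:E * ((e / 12)%:E + (e / 6)%:E + (e / 12)%:E))%E); last first.
  by rewrite -!EFinD -EFinM lee_fin; lra.
rewrite lee_wpmul2l ?lee_fin// leeD// leeD//.
apply: (le_trans Dg); rewrite lee_fin e1sq rsq.
have -> : 2 * mb * (e / 24 / (mb + 1) + 4 * K ^+ 2 / d ^+ 2 * (2 * a * (e / 12 / (Y + 1)))) =
  mb / (mb + 1) * (e / 12) + Y / (Y + 1) * (e / 12).
  by rewrite /Y; move: (K ^+ 2 / d ^+ 2) (Y + 1) Y1 => KK W W1; rewrite /Y; field; rewrite !gt_eqF.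
have h1 : mb / (mb + 1) * (e / 12) <= 1 * (e / 12).
  by rewrite ler_wpM2r ?divr_ge0 ?ltW// ltr_pdivrMr// mul1r; lra.
have h2 : Y / (Y + 1) * (e / 12) <= 1 * (e / 12).
  by rewrite ler_wpM2r ?divr_ge0 ?ltW// ltr_pdivrMr// mul1r; lra.
lra.
Qed.

Section transform.
Variables (h : R -> R) (M : R).
Hypotheses (hM : forall x, `|h x| <= M) (ih : m.-integrable setT (EFin \o h)).

Let mh : measurable_fun setT h. Proof. exact: integrable_measurable ih. Qed.
Let mH : measurable_fun setT (hht a m h). Proof. exact: (measurable_hht H). Qed.
Let mH2 : measurable_fun setT (fun xi => hht a m h xi ^+ 2). Proof. exact: measurable_funX. Qed.

Lemma integrable_sqr_bounded : m.-integrable setT (EFin \o (fun x => h x ^+ 2)).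
Proof.
apply: (@le_integrableR _ _ _ _ _ (fun x => M * `|h x|)).
- exact: measurable_funX.
- by apply: integrableZR; exact: integrable_normR.
- by move=> x; rewrite normrX expr2 ler_wpM2r.
Qed.

Lemma integrable_hht_gauss r : 0 < r ->
  m.-integrable setT (EFin \o (fun xi => hht a m h xi ^+ 2 * gauss r xi)).
Proof.
move=> r0; apply: (@le_integrableR _ _ _ _ _ (fun xi => (Rintegral m setT (fun x => `|h x|)) ^+ 2 * gauss r xi)).
- by apply: measurable_funM => //; exact: measurable_gauss.
- by apply: integrableZR; exact: (integrable_gauss H).
- move=> xi; rewrite normrM (ger0_norm (gauss_ge0 _ _)) ler_wpM2r ?gauss_ge0// normrX.
  have b := hht_bound H xi ih.
  by rewrite lerXn2r ?nnegrE// (le_trans _ b).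
Qed.

(** The two factors of the square are unfolded one after the other, the Gaussian making each double
    integral absolutely convergent; the remaining integral in [xi] is the heat kernel. *)
Lemma Rintegral_hht_gauss r : 0 < r ->
  Rintegral m setT (fun xi => hht a m h xi ^+ 2 * gauss r xi) =
  Rintegral (m \x m)%E setT (fun z => h z.1 * h z.2 * heatk a P r z).
Proof.
move=> r0; pose L := Rintegral m setT (fun x => `|h x|).
have mg : measurable_fun setT (gauss r) by exact: measurable_gauss.
have mz d1 d2 (T1 : measurableType d1) (T2 : measurableType d2) (u : T2 -> R) :
    measurable_fun setT u -> measurable_fun setT (fun z : T1 * T2 => u z.2).
  by move=> ?; apply: measurableT_comp.
have mz1 d1 d2 (T1 : measurableType d1) (T2 : measurableType d2) (u : T1 -> R) :
    measurable_fun setT u -> measurable_fun setT (fun z : T1 * T2 => u z.1).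
  by move=> ?; apply: measurableT_comp.
rewrite -Rintegral_fubini1; last first.
  exact: (integrable_markov_mul (@mk r) (@k0 r) (@ksym r) (fun x => @k1 r x r0) mh integrable_sqr_bounded).
pose F1 (z : R * R) := h z.2 * (jb a (z.2 * z.1) * (hht a m h z.1 * gauss r z.1)).
have iL : m.-integrable setT (EFin \o (fun xi => L * gauss r xi)).
  by apply: integrableZR; exact: (integrable_gauss H).
have iF1 : (m \x m)%E.-integrable setT (EFin \o F1).
  apply: (integrable_tensor _ iL (integrable_normR ih)).
    apply: measurable_funM; first exact: mz.
    by apply: measurable_funM; [exact: mjbM|apply: measurable_funM; exact: mz1].
  move=> xi x; rewrite /F1/= mulrC !normrM (ger0_norm (gauss_ge0 _ _)) ler_wpM2r//.
  rewrite -[leRHS]mul1r ler_pM ?mulr_ge0 ?gauss_ge0// ler_wpM2r ?gauss_ge0//.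
  exact: (hht_bound H).
transitivity (Rintegral (m \x m)%E setT F1).
  rewrite -(Rintegral_fubini1 iF1); apply: eq_Rintegral => xi _; rewrite /F1/=.
  rewrite expr2 -mulrA {1}/hht -RintegralZr_measurable.
    by apply: eq_Rintegral => x _; rewrite -mulrA.
  exact: integrable_measurable (integrable_mul_jb H xi ih).
rewrite -(Rintegral_fubini2 iF1); apply: eq_Rintegral => x _; rewrite /F1/=.
pose F2 (z : R * R) := h z.2 * (jb a (x * z.1) * jb a (z.2 * z.1) * gauss r z.1).
have iF2 : (m \x m)%E.-integrable setT (EFin \o F2).
  apply: (integrable_tensor _ (integrable_gauss H r0) (integrable_normR ih)).
    apply: measurable_funM; first exact: mz.
    by apply: measurable_funM; [apply: measurable_funM; exact: mjbM|exact: mz1].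
  move=> xi y; rewrite /F2/= mulrC !normrM (ger0_norm (gauss_ge0 _ _)) ler_wpM2r//.
  by rewrite ler_piMl ?gauss_ge0// mulr_ile1.
have m1 : measurable_fun setT (fun xi => jb a (x * xi) * (hht a m h xi * gauss r xi)).
  by apply: measurable_funM; [exact: mjbM|exact: measurable_funM].
transitivity (h x * Rintegral m setT (fun xi => jb a (x * xi) * (hht a m h xi * gauss r xi))).
  by rewrite [RHS]mulrC -RintegralZr_measurable//; apply: eq_Rintegral => xi _; rewrite mulrC.
transitivity (h x * Rintegral (m \x m)%E setT F2); last first.
  rewrite -(Rintegral_fubini2 iF2) [LHS]mulrC -RintegralZr_measurable; last first.
    apply: (@measurable_Rintegral1 _ _ R R R m (fun z => F2 (z.2, z.1))).
    have := integrable_measurable iF2 => mF2.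
    exact (measurableT_comp mF2 (@measurable_swap _ _ R R)).
  apply: eq_Rintegral => y _; rewrite /F2/= [LHS]mulrC -mulrA; congr (_ * _).
  rewrite -(Rintegral_jb2_gauss H x y r0) mulrC -RintegralZr_measurable; last first.
    apply: measurable_funM => //; by apply: measurable_funM; exact: mjbM.
  by apply: eq_Rintegral => xi _; rewrite mulrC.
congr (_ * _); rewrite -(Rintegral_fubini1 iF2); apply: eq_Rintegral => xi _; rewrite /F2/=.
rewrite mulrCA /hht -RintegralZr_measurable; last first.
  exact: integrable_measurable (integrable_mul_jb H xi ih).
by apply: eq_Rintegral => y _; ring.
Qed.

(** Nonnegativity of the Dirichlet form bounds the regularized energies by the norm of [h], and
    Fatou along [r = 1/(n+1)] gives one inequality. The other follows from a small value of the form
    and [gauss <= 1]. *)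
Lemma hankel_plancherel :
  (\int[m]_xi (hht a m h xi ^+ 2)%:E = \int[m]_x (h x ^+ 2)%:E)%E.
Proof.
have i2 := integrable_sqr_bounded.
rewrite -(EFin_Rintegral i2); set N := Rintegral m setT _.
have A r : 0 < r -> (dirichlet m (heatk a P r) h = (2 * (N - Rintegral m setT (fun xi => hht a m h xi ^+ 2 * gauss r xi)))%:E)%E.
  move=> r0; rewrite Rintegral_hht_gauss//.
  exact: (dirichletE (@mk r) (@k0 r) (@ksym r) (fun x => @k1 r x r0) mh i2).
have AI r : 0 < r -> ((Rintegral m setT (fun xi => hht a m h xi ^+ 2 * gauss r xi))%:E =
    \int[m]_xi (hht a m h xi ^+ 2 * gauss r xi)%:E)%E.
  by move=> r0; apply: EFin_Rintegral; exact: integrable_hht_gauss.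
apply/eqP; rewrite eq_le; apply/andP; split.
- have cf xi : hht a m h xi ^+ 2 * gauss n.+1%:R^-1 xi @[n --> \oo] --> hht a m h xi ^+ 2.
    rewrite -[X in _ --> X]mulr1; apply: cvgMr.
    rewrite -[X in _ --> X]expR0; apply: (@continuous_cvg _ _ _ _ _ _ expR); first exact: continuous_expR.
    rewrite -[X in _ --> X]oppr0; apply: cvgN.
    rewrite -[X in _ --> X](mul0r 2^-1); apply: cvgMl.
    rewrite -[X in _ --> X](expr0n R 2); apply: (@continuous_cvg _ _ _ _ _ _ (fun x : R => x ^+ 2)).
      exact: exprn_continuous.
    rewrite -[X in _ --> X](mul0r xi); apply: cvgMl; exact: cvg_harmonic.
  apply: (@integral_le_fatou _ _ _ m (fun n xi => hht a m h xi ^+ 2 * gauss n.+1%:R^-1 xi)) => //.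
  - by move=> n; apply: measurable_funM => //; exact: measurable_gauss.
  - by move=> n xi; rewrite mulr_ge0 ?gauss_ge0 ?sqr_ge0.
  - move=> n; have rn : (0 : R) < n.+1%:R^-1 by rewrite invr_gt0.
    rewrite -AI// lee_fin; have : (0 <= dirichlet m (heatk a P n.+1%:R^-1) h)%E.
      by apply: integral_ge0 => z _; rewrite lee_fin mulr_ge0 ?sqr_ge0.
    by rewrite A// lee_fin; lra.
- apply/lee_addgt0Pr => e e0.
  have [r r0] := dirichlet_heat_small mh hM ih (mulr_gt0 (ltr0Sn _ 1) e0 : 0 < 2 * e).
  rewrite (A r r0) lee_fin => hr.
  apply: (@le_trans _ _ ((Rintegral m setT (fun xi => hht a m h xi ^+ 2 * gauss r xi))%:E + e%:E)%E).
    by rewrite -EFinD lee_fin; lra.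
  rewrite leeD2r// AI//; apply: ge0_le_integralR => //.
  - by apply: measurable_funM => //; exact: measurable_gauss.
  - by move=> xi; rewrite mulr_ge0 ?gauss_ge0 ?sqr_ge0.
  - by move=> xi; rewrite ler_piMr ?gauss_le1 ?sqr_ge0.
Qed.

End transform.

End Plancherel.

(** * Uniform continuity, tails and truncation *)

Section UniformContinuity.
Context (R : realType).

(** Compactness of the segment in near-covering form. Only [x] is confined to it; [y] may lie
    slightly outside. *)
Lemma continuous_uniform_itv (G : R -> R) (L e : R) : continuous G -> 0 < e ->
  exists2 d, 0 < d & forall x y, 0 <= x <= L -> `|x - y| < d -> `|G x - G y| <= e.
Proof.
move=> cG e0.
have /compact_near_coveringP cov : compact (`[0, L] : set R) by exact: segment_compact.
have := cov R (0^'+) (fun d x => forall y, `|x - y| < d -> `|G x - G y| <= e) _.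
case.
  move=> x xL.
  have /cvgrPdist_le /(_ (e / 2)) := cG x.
  rewrite divr_gt0// => /(_ isT) /nbhs_ballP[d /= d0 dG].
  exists (ball x (d / 2), [set i : R | i < d / 2]) => /=.
    split; first by apply: nbhsx_ballx; rewrite divr_gt0.
    by apply: nbhs_right_lt; rewrite divr_gt0.
  move=> [x' i] [/= bx id] y xy.
  have h1 : `|G x - G x'| <= e / 2.
    by apply: dG; rewrite /ball/= in bx *; rewrite (lt_trans bx)// gtr_pMr// invf_lt1// ltr1n.
  have h2 : `|G x - G y| <= e / 2.
    apply: dG; rewrite /ball/= in bx *.
    rewrite (le_lt_trans (ler_distD x' _ _))// (splitr d) ltrD//.
    exact: lt_trans id.
  by rewrite (le_trans (ler_distD (G x) _ _))// (splitr e) lerD// distrC.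
move=> d /= d0 dP.
exists (d / 2); first by rewrite divr_gt0.
move=> x y xL xy.
have := dP (d / 2); rewrite /ball/= sub0r normrN gtr0_norm ?divr_gt0//.
rewrite gtr_pMr// invf_lt1// ltr1n => /(_ isT).
by move=> /(_ isT) dx; apply: (dx x) => //; rewrite /= in_itv.
Qed.

End UniformContinuity.

(** Otherwise every truncated integral would be at most the total minus [e], and Fatou would give
    the same bound for the total. *)
Lemma integral_tail_small d (T : measurableType d) (R : realType) (m : {measure set T -> \bar R})
    (f : T -> R) (u : T -> R) (e : R) : m.-integrable setT (EFin \o f) ->
  measurable_fun setT u -> (forall x, 0 <= f x) -> 0 < e ->
  exists n : nat, (\int[m]_x (f x * (n%:R < u x)%R%:R)%:E <= e%:E)%E.
Proof.
move=> fi mu f0 e0; apply: contrapT => /forallNP nn.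
have mf := integrable_measurable fi.
have mi (n : nat) : measurable_fun setT (fun x => (n%:R < u x)%R%:R : R).
  rewrite (_ : (fun x => _) = \1_(u @^-1` `]n%:R, +oo[)); last first.
    apply/funext => x; rewrite indicE; congr (nat_of_bool _)%:R.
    by apply/idP/idP; rewrite inE/= in_itv/= andbT.
  apply: measurable_indic; rewrite -[X in measurable X]setTI; exact: mu.
have mi' (n : nat) : measurable_fun setT (fun x => (u x <= n%:R)%R%:R : R).
  rewrite (_ : (fun x => _) = (fun x => 1 - (n%:R < u x)%R%:R)); last first.
    by apply/funext => x; case: ltP; rewrite ?subrr ?subr0.
  exact: measurable_funB.
have : (\int[m]_x (f x)%:E <= (Rintegral m setT f - e)%:E)%E.
  apply: (@integral_le_fatou _ _ _ m (fun n x => f x * (u x <= n%:R)%R%:R)).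
  - by move=> n; exact: measurable_funM.
  - by move=> n x; rewrite mulr_ge0.
  - move=> n; have /negP := nn n; rewrite -ltNge => lt.
    have E : (\int[m]_x (f x)%:E = \int[m]_x (f x * (u x <= n%:R)%R%:R)%:E +
         \int[m]_x (f x * (n%:R < u x)%R%:R)%:E)%E.
      rewrite -ge0_integralDR//; last 4 first.
      - exact: measurable_funM.
      - exact: measurable_funM.
      - by move=> x; rewrite mulr_ge0.
      - by move=> x; rewrite mulr_ge0.
      by apply: eq_integral => x _; rewrite -mulrDr; case: ltP; rewrite ?addr0 ?add0r mulr1.
    rewrite EFinB (EFin_Rintegral fi) leeBrDr// E leeD2l// ltW//.
  - move=> x; apply: cvg_near_cst.
    near=> n; rewrite (_ : u x <= n%:R) ?mulr1//.
    by near: n; exact: nbhs_infty_ger.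
by rewrite -EFin_Rintegral// lee_fin; lra.
Unshelve. all: by end_near.
Qed.

Lemma clip_dist_le (R : realType) (M u v : R) : - M <= u <= M ->
  `|u - Num.max (- M) (Num.min M v)| <= `|u - v|.
Proof.
move=> /andP[p q]; have h2 := ler_norm (u - v); have h3 := ler_norm (v - u).
rewrite distrC in h3; rewrite ler_norml.
case: (leP M v) => c1; [case: (leP (- M) M)|case: (leP (- M) v)] => c2; apply/andP; split; lra.
Qed.

(** * The concrete measures satisfy the abstract hypotheses *)

Section HankelMeasuresInstance.
Context (R : realType) (alpha : R).
Hypothesis ha : - (1 / 2) < alpha.

Lemma hankel_measures_hmu : hankel_measures (alpha + 1) (on_reals (hmu alpha)) (on_reals (hP alpha)).
Proof.
have mcos : measurable_fun setT (@cos R) by exact: measurable_cos.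
split.
- have h := ha; lra.
- exact: (hP_setT ha).
- move=> k; rewrite integral_on_reals ?integral_hP_cos_even//.
  by apply/measurable_EFinP; exact: measurable_funX.
- move=> k; rewrite integral_on_reals ?integral_hP_cos_odd//.
  by apply/measurable_EFinP; exact: measurable_funX.
- move=> y G mG G0.
  have mh : measurable_fun setT (fun q : R * R => hw y q.1 q.2) by apply: measurable_hw.
  have mG1 : measurable_fun setT (fun q : R * R => G (hw y q.1 q.2, q.1)).
    by apply: (measurableT_comp mG); exact: measurable_fun_pair.
  have mG2 : measurable_fun setT (fun q : R * R => G (q.1, hw y q.1 q.2)).
    by apply: (measurableT_comp mG); exact: measurable_fun_pair.
  have E (F : R * R -> \bar R) : measurable_fun setT F -> (forall q, 0 <= F q)%E ->
      (\int[on_reals (hmu alpha)]_x \int[on_reals (hP alpha)]_t F (x, t) =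
       \int[hmu alpha]_x \int[hP alpha]_t F (x, t))%E.
    move=> mF F0; rewrite integral_on_reals; last first.
      exact: (@measurable_fun_fubini_tonelli_F _ _ _ _ _ (on_reals (hP alpha)) F).
    apply: eq_integral => x _; apply: integral_on_reals.
    exact (measurableT_comp mF (pair1_measurable x)).
  rewrite (E _ mG1 (fun q => G0 _)) (E _ mG2 (fun q => G0 _)).
  exact: integral_hw_swap.
- move=> n; rewrite integral_on_reals ?integral_hmu_gauss//.
  apply/measurable_EFinP; apply: measurable_funM; first exact: measurable_funX.
  exact: measurable_gauss_half.
- move=> k g k0 mg.
  have mk : measurable_fun setT (fun x : R => g (k * x)).
    by apply: (measurableT_comp mg); exact: measurable_funM.
  rewrite !integral_on_reals// integral_hmu_scale//.
  by rewrite mulrDr mulr1.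
Qed.

Lemma mu_dens_le (L x : R) : 0 <= x <= L -> mu_dens alpha x <= mu_dens alpha L.
Proof.
move=> /andP[x0 xL]; have h := ha; rewrite /mu_dens ler_wpM2r//.
  rewrite invr_ge0 mulr_ge0 ?powR_ge0// ltW// gamma_gt0//; lra.
apply: ge0_ler_powR => //; rewrite ?nnegrE//; [lra|exact: le_trans xL].
Qed.

Lemma hmu_norm_le_lty (N : R) : (on_reals (hmu alpha) [set x : R | (`|x| <= N)%R] < +oo)%E.
Proof.
set B := [set x : R | _].
have mB : measurable B.
  rewrite (_ : B = (fun x => `|x|) @^-1` `]-oo, N]); last first.
    by apply/seteqP; split => x /=; rewrite in_itv/=.
  rewrite -[X in measurable X]setTI; apply: (measurableT_comp (f := @Num.norm R R)) => //.
rewrite -[X in (X < _)%E](_ : (\int[on_reals (hmu alpha)]_x (\1_B x)%:E = _)%E); last first.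
  by rewrite integral_indic// setIT.
have m1 : measurable_fun setT (fun x : R => (\1_B x : R)%:E).
  by apply/measurable_EFinP; exact: measurable_indic.
rewrite integral_on_reals// integral_hmu//.
apply: (@le_lt_trans _ _ (\int[lebesgue_measure]_(x in `[0%R, +oo[) ((mu_dens alpha N)%:E * (\1_(`[0, N]%classic : set R) x)%:E))%E).
  apply: ge0_le_integral => //.
  - by move=> x _; rewrite mule_ge0 ?lee_fin ?indicE// mu_dens_ge0.
  - apply: emeasurable_funM; first exact: measurable_funTS.
    by apply: measurable_funTS; apply/measurable_EFinP; exact: measurable_mu_dens.
  - apply: measurable_funTS; apply: emeasurable_funM => //.
    by apply/measurable_EFinP; exact: measurable_indic.
  move=> x; rewrite /= in_itv/= andbT => x0; rewrite -!EFinM lee_fin mulrC.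
  rewrite !indicE; have [xN|xN] := leP x N.
    rewrite mem_set ?mulr1 ?mem_set ?mulr1//=; first by apply: mu_dens_le; rewrite x0.
      by rewrite in_itv/= x0.
    by rewrite /B/= ger0_norm.
  have nB : ~ B x by rewrite /B/= ger0_norm// leNgt xN.
  by rewrite (memNset nB) mulr0; apply: mulr_ge0 => //; exact: mu_dens_ge0.
rewrite ge0_integralZl//; last 2 first.
- by apply: measurable_funTS; apply/measurable_EFinP; exact: measurable_indic.
- by rewrite lee_fin mu_dens_ge0.
rewrite integral_indic//; apply: lte_mul_pinfty => //; rewrite ?lee_fin ?mu_dens_ge0//.
apply: (@le_lt_trans _ _ (lebesgue_measure (`[0, N]%classic : set R))).
  by apply: le_measure; rewrite ?inE//; exact: measurableI.
by rewrite lebesgue_measure_itv/=; case: ifP; rewrite ?ltry// -EFinB ltry.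
Qed.

(** Cut [h] at [N], approximate in Lebesgue [L^1] on [[0, N + 1]] by a continuous function, clip it
    to [[- M, M]] and multiply by a continuous cutoff. Boundedness by [M] and the bounded density
    convert the [L^1] error into a mean-square error for the measure. *)
Lemma uc_dense_hmu : uc_dense (on_reals (hmu alpha)).
Proof.
move=> h M e mh hM ih e0.
have M0 : 0 <= M by apply: le_trans (hM 0).
have mh2 : measurable_fun setT (fun x => h x ^+ 2) by exact: measurable_funX.
have ih2 : (on_reals (hmu alpha)).-integrable setT (EFin \o (fun x => h x ^+ 2)).
  exact: (integrable_sqr_bounded hM ih).
have mid : measurable_fun setT (fun x : R => x) by exact: measurable_id.
have [n tail] := integral_tail_small ih2 mid (fun x => sqr_ge0 (h x)) (divr_gt0 e0 (ltr0Sn _ 3) : 0 < e / 4).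
pose N : R := n%:R.
pose E := (`[0, N + 1]%classic : set R).
have mE : measurable (E : set (measurableTypeR R)) by exact: measurable_itv.
pose h1 x : R := h x * (x <= N)%R%:R.
have [C C0 CE] : exists2 C, 0 <= C & forall x, 0 <= x <= N + 1 -> mu_dens alpha x <= C.
  by exists (mu_dens alpha (N + 1)); [exact: mu_dens_ge0|move=> x; exact: mu_dens_le].
have mi : measurable_fun setT (fun x : R => (x <= N)%R%:R : R).
  rewrite (_ : (fun x => _) = \1_(`]-oo, N]%classic : set R)); last first.
    apply/funext => x; rewrite indicE; congr (nat_of_bool _)%:R.
    by apply/idP/idP; rewrite inE/= in_itv/=.
  exact: measurable_indic.
have mh1 : measurable_fun setT h1 by exact: measurable_funM.
have h1M x : `|h1 x| <= M.
  by rewrite normrM; case: (x <= N)%R; rewrite ?normr1 ?normr0 ?mulr1 ?mulr0.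
have Eoo : (lebesgue_measure (E : set R) < +oo)%E.
  by rewrite lebesgue_measure_itv/=; case: ifP; rewrite ?ltry// -EFinB ltry.
have ih1 : (@lebesgue_measure R).-integrable E (EFin \o h1).
  apply/integrableP; split.
    by apply: measurable_funTS; exact/measurable_EFinP.
  apply: (@le_lt_trans _ _ (\int[lebesgue_measure]_(x in E) M%:E)%E).
    apply: ge0_le_integral => //.
    - by apply: measurable_funTS; apply: measurableT_comp => //; exact/measurable_EFinP.
    - by move=> x _ /=; rewrite lee_fin.
  by rewrite integral_cst// lte_mul_pinfty.
have [g_ [cg ig cvg0]] := approximation_continuous_integrable mE Eoo ih1.
(* The mean-square error is at most [2 M C] times the [L^1] error, hence at most [e/4]. *)
pose eps := e / 4 / (2 * M * C + 1).
have MC0 : 0 <= 2 * M * C by rewrite !mulr_ge0.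
have D1 : 0 < 2 * M * C + 1 by lra.
have eps0 : 0 < eps by rewrite !divr_gt0.
have [k gk] : exists k, (\int[lebesgue_measure]_(z in E) `|(h1 z - g_ k z)%:E| <= eps%:E)%E.
  have /fine_cvgP[[n1 _ fin] /cvgrPdist_le /(_ eps eps0)[n2 _ H]] := cvg0.
  exists (maxn n1 n2); have := H (maxn n1 n2) (leq_maxr _ _).
  rewrite sub0r normrN -[X in _ -> (X <= _)%E]fineK ?lee_fin; last first.
    exact: fin (leq_maxl _ _).
  by apply: le_trans; rewrite ler_norm.
pose clip x : R := Num.max (- M) (Num.min M (g_ k x)).
(* Equal to [1] up to [N], linear, then [0] from [N + 1] on. *)
pose chi x : R := Num.max 0 (Num.min 1 (N + 1 - x)).
pose G x := chi x * clip x.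
have cG : continuous G.
  have ccst (c : R) : continuous (fun _ : R => c) by move=> x; exact: cvg_cst.
  have cmax (u v : R -> R) : continuous u -> continuous v -> continuous (fun x => Num.max (u x) (v x)).
    by move=> cu cv x; exact: (@continuous_max _ _ u v x (cu x) (cv x)).
  have cmin (u v : R -> R) : continuous u -> continuous v -> continuous (fun x => Num.min (u x) (v x)).
    by move=> cu cv x; exact: (@continuous_min _ _ u v x (cu x) (cv x)).
  have cclip : continuous clip.
    by apply: cmax; [exact: ccst|apply: cmin; [exact: ccst|exact: cg]].
  have cchi : continuous chi.
    apply: cmax; first exact: ccst.
    apply: cmin; first exact: ccst.
    by move=> x; apply: cvgB; [exact: cvg_cst|exact: cvg_id].
  by move=> x; apply: cvgM; [exact: cchi|exact: cclip].
exists (fun x => G `|x|), M, (N + 1).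
have chi01 x : 0 <= chi x <= 1.
  by rewrite /chi le_max lexx/= ge_max ler01/= ge_min lexx.
have clipM x : `|clip x| <= M.
  rewrite ler_norml /clip le_max lexx/= ge_max ge_min lexx/= andbT; lra.
have Gclip x : `|G x| <= `|clip x|.
  have /andP[p q] := chi01 x.
  by rewrite /G normrM (ger0_norm p) ler_piMl.
have GM x : `|G x| <= M by exact: le_trans (clipM x).
have G0 x : N + 1 <= x -> G x = 0.
  move=> xN; rewrite /G /chi [Num.max _ _](_ : _ = 0) ?mul0r//.
  by apply/max_idPl; rewrite ge_min subr_le0 xN orbT.
have mG : measurable_fun setT G by exact: continuous_measurable_fun.
have mGa : measurable_fun setT (fun x : R => G `|x|).
  have mabs : measurable_fun setT (fun x : R => `|x|) by exact: measurableT_comp.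
  exact (measurableT_comp mG mabs).
have h1G x : `|h1 x - G x| <= `|h1 x - g_ k x|.
  rewrite /h1; have [xN|xN] := leP x N.
    rewrite mulr1 /G /chi (_ : Num.min 1 _ = 1); last by apply/min_idPl; lra.
    rewrite (_ : Num.max 0 1 = 1) ?mul1r; last by apply/max_idPr.
    by apply: clip_dist_le; have := hM x; rewrite ler_norml.
  rewrite mulr0 !sub0r !normrN (le_trans (Gclip x))//.
  have := @clip_dist_le _ M 0 (g_ k x); rewrite !sub0r !normrN; apply.
  by rewrite M0 oppr_le0 M0.
split => //.
- split; first by move=> x; exact: GM.
  by move=> x xN; apply: G0; exact: ltW.
- exact: hmu_norm_le_lty.
- have mD : measurable_fun setT (fun x : R => (h1 x - G `|x|) ^+ 2).
    by apply: measurable_funX; exact: measurable_funB.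
  have D0 x : 0 <= (h1 x - G `|x|) ^+ 2 by exact: sqr_ge0.
  have mT : measurable_fun setT (fun x : R => h x ^+ 2 * (n%:R < x)%R%:R).
    rewrite (_ : (fun x => _) = (fun x => h x ^+ 2 - h x * h1 x)).
      by apply: measurable_funB => //; exact: measurable_funM.
    by apply/funext => x; rewrite /h1 /N; case: ltP; rewrite ?mulr1 ?mulr0 ?subr0// -expr2 subrr.
  have T0 x : 0 <= h x ^+ 2 * (n%:R < x)%R%:R by rewrite mulr_ge0 ?sqr_ge0.
  have two : (0 : R) <= 2 by [].
  have second : (\int[on_reals (hmu alpha)]_x ((h1 x - G `|x|) ^+ 2)%:E <= (e / 4)%:E)%E.
    have mDE : measurable_fun setT (fun x : R => ((h1 x - G `|x|) ^+ 2)%:E) by exact/measurable_EFinP.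
    rewrite integral_on_reals// integral_hmu//.
    pose F (x : R) := (((h1 x - G `|x|) ^+ 2)%:E * (mu_dens alpha x)%:E)%E.
    have FE : (\int[lebesgue_measure]_(x in `[0%R, +oo[) F x = \int[lebesgue_measure]_(x in E) F x)%E.
      rewrite -[in RHS](_ : `[0, +oo[%classic `&` E = E); last first.
        by apply: setIidr => x; rewrite /E/= !in_itv/= andbT => /andP[].
      rewrite integral_mkcondr; apply: eq_integral => x; rewrite inE/= in_itv/= andbT => x0.
      rewrite patchE; case: ifPn => // /negP; rewrite inE /E/= in_itv/= x0/= => /negP.
      rewrite -ltNge => xN.
      have Gx : G `|x| = 0 by rewrite ger0_norm//; apply: G0; exact: ltW.
      have h1x : h1 x = 0 by rewrite /h1 lt_geF ?mulr0//; lra.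
      by rewrite /F Gx h1x subr0 expr0n mul0e.
    rewrite [leLHS]FE.
    have mgk : measurable_fun setT (g_ k) by exact: continuous_measurable_fun.
    have mab : measurable_fun setT (fun z => `|(h1 z - g_ k z)%:E|%E).
      apply: measurableT_comp => //; apply/measurable_EFinP; exact: measurable_funB.
    apply: (@le_trans _ _ (\int[lebesgue_measure]_(x in E) ((2 * M * C)%:E * `|(h1 x - g_ k x)%:E|))%E).
      apply: ge0_le_integral => //.
      - by move=> x _; rewrite /F mule_ge0 ?lee_fin ?mu_dens_ge0.
      - apply: measurable_funTS; apply: emeasurable_funM => //.
        by apply/measurable_EFinP; exact: measurable_mu_dens.
      - by apply: measurable_funTS; exact: emeasurable_funM.
      move=> x; rewrite /E/= in_itv/= => xE; rewrite /F -!EFinM lee_fin [leRHS]mulrAC.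
      have x0 : 0 <= x by case/andP: xE.
      apply: ler_pM => //; [exact: mu_dens_ge0| |exact: CE].
      rewrite (ger0_norm x0) -real_normK ?num_real// expr2.
      apply: ler_pM => //.
      have := h1M x; have := GM x; rewrite !ler_norml => /andP[p1 p2] /andP[p3 p4].
      by apply/andP; split; lra.
    rewrite ge0_integralZl//; last by apply: measurable_funTS.
    apply: (@le_trans _ _ ((2 * M * C)%:E * eps%:E)%E).
      by apply: lee_wpmul2l => //; rewrite lee_fin.
    rewrite -EFinM lee_fin /eps mulrA ler_pdivrMr// mulrC ler_wpM2l ?divr_ge0 ?ltW//; lra.
  (* The inequality [(u + v)^2 <= 2 u^2 + 2 v^2] for the tail of [h] and the error on the truncated
     part, each of which costs [e/4]. *)
  apply: (@le_trans _ _ (\int[on_reals (hmu alpha)]_x (2 * (h x ^+ 2 * (n%:R < x)%R%:R) + 2 * (h1 x - G `|x|) ^+ 2)%:E)%E).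
    apply: ge0_le_integralR.
    - by apply: measurable_funX; exact: measurable_funB.
    - by apply: measurable_funD; exact: measurable_funM.
    - by move=> x; exact: sqr_ge0.
    move=> x; have := sqr_ge0 (h x * (n%:R < x)%R%:R - (h1 x - G `|x|)).
    rewrite /h1 /N; case: ltP => _; rewrite ?mulr1 ?mulr0; move: (h x) (G _) => u v; nra.
  have mT2 : measurable_fun setT (fun x : R => 2 * (h x ^+ 2 * (n%:R < x)%R%:R)) by exact: measurable_funM.
  have mD2 : measurable_fun setT (fun x : R => 2 * (h1 x - G `|x|) ^+ 2) by exact: measurable_funM.
  rewrite (ge0_integralDR _ mT2 mD2 (fun x => mulr_ge0 two (T0 x)) (fun x => mulr_ge0 two (D0 x))).
  rewrite (ge0_integralZR _ mT two T0) (ge0_integralZR _ mD two D0).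
  apply: (@le_trans _ _ (2%:E * (e / 4)%:E + 2%:E * (e / 4)%:E)%E); last first.
    by rewrite -!EFinM -EFinD lee_fin; lra.
  by apply: leeD; rewrite lee_wpmul2l// lee_fin.
- move=> e' e'0.
  have [d d0 dG] := continuous_uniform_itv (N + 2) cG e'0.
  exists (Num.min d 1); first by rewrite lt_min d0 ltr01.
  move=> x y; rewrite lt_min => /andP[xyd xy1].
  (* Beyond [N + 2] a point at distance less than [1] is still beyond [N + 1], and both values of
     [G] vanish. *)
  have [xN|xN] := leP `|x| (N + 2); first by apply: dG => //; rewrite normr_ge0.
  rewrite !G0 ?subrr ?normr0 ?ltW//.
    by move: xy1; rewrite ltr_norml => /andP[_ ?]; lra.
  by lra.
Qed.

End HankelMeasuresInstance.

(** * Square-integrable functions *)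

Section SquareIntegrable.
Context (R : realType) (a : R) (m P : {sigma_finite_measure set R -> \bar R}).
Hypothesis H : hankel_measures a m P.

Definition L2fun (f : R -> R) : Prop :=
  measurable_fun setT f /\ m.-integrable setT (EFin \o (fun x => f x ^+ 2)).

Definition norm2 (f : R -> R) : R := Rintegral m setT (fun x => f x ^+ 2).

Lemma norm2_ge0 f : 0 <= norm2 f.
Proof. by apply: Rintegral_ge0 => x _; exact: sqr_ge0. Qed.

Lemma L2funP (f : R -> R) : measurable_fun setT f -> (\int[m]_x (f x ^+ 2)%:E < +oo)%E -> L2fun f.
Proof.
move=> mf foo; split => //; apply: ge0_integrable => //; first exact: measurable_funX.
by move=> x; exact: sqr_ge0.
Qed.

Lemma norm2E f : L2fun f -> ((norm2 f)%:E = \int[m]_x (f x ^+ 2)%:E)%E.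
Proof. by move=> [_ fi]; exact: EFin_Rintegral. Qed.

Lemma L2fun_le (f g : R -> R) : measurable_fun setT g -> (forall x, `|g x| <= `|f x|) -> L2fun f -> L2fun g.
Proof.
move=> mg gf [mf fi]; split => //; apply: (le_integrableR _ fi); first exact: measurable_funX.
move=> x; rewrite normrX -[leRHS]real_normK ?num_real//.
by rewrite lerXn2r ?nnegrE.
Qed.

Section product.
Variables (f phi : R -> R) (x : R).
Hypotheses (Lf : L2fun f) (Lp : L2fun phi).

Let F (q : R * R) := f q.1 * phi (hw x q.1 q.2).

Let mF : measurable_fun setT F.
Proof.
have [mf _] := Lf; have [mp _] := Lp.
apply: measurable_funM; first exact: measurableT_comp.
by apply: (measurableT_comp mp); exact: measurable_hw_pair.
Qed.

(** By [2 |u v| <= u^2 + v^2]; the two squares are integrable on the product because [P] has mass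
    one and [m] is translation invariant. *)
Lemma integrable_L2_hw : (m \x P)%E.-integrable setT (EFin \o F).
Proof.
have [mf fi] := Lf; have [mp phii] := Lp.
apply: (le_integrableR mF (integrableDR (integrable_fst H fi) (integrable_hw H x phii))).
move=> q; rewrite /F; move: (f _) (phi _) => u v.
have := sqr_ge0 (u - v); have := sqr_ge0 (u + v); have := sqr_ge0 u; have := sqr_ge0 v.
rewrite !sqrrD sqrrN mulrN ler_norml => *; apply/andP; split; lra.
Qed.

Lemma cv_prodE : cv m P f phi x = Rintegral (m \x P)%E setT F.
Proof.
have [mf fi] := Lf; have [mp phii] := Lp.
rewrite -(Rintegral_fubini1 integrable_L2_hw) /cv; apply: eq_Rintegral => y _.
rewrite /F/= mulrC /htr -RintegralZr_measurable.
  by apply: eq_Rintegral => t _; rewrite mulrC.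
by apply: (measurableT_comp mp); exact: measurable_hw_last.
Qed.

End product.

Lemma cvBl f g phi x : L2fun f -> L2fun g -> L2fun phi ->
  cv m P (fun y => f y - g y) phi x = cv m P f phi x - cv m P g phi x.
Proof.
move=> Lf Lg Lp; have [mf fi] := Lf; have [mg gi] := Lg.
have L : L2fun (fun y => f y - g y).
  split; first exact: measurable_funB.
  apply: (le_integrableR _ (integrableZR 2 (integrableDR fi gi))).
    by apply: measurable_funX; exact: measurable_funB.
  move=> y; rewrite ger0_norm ?sqr_ge0//; have := sqr_ge0 (f y + g y).
  rewrite sqrrD sqrrB; lra.
rewrite !cv_prodE// -RintegralBT; [|exact: integrable_L2_hw|exact: integrable_L2_hw].
by apply: eq_Rintegral => q _; rewrite mulrBl.
Qed.

(** Here [U + i V] pairs [f1 + i f2] with the conjugate of the translated [p1 + i p2]. For every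
    positive [C >= A], AM-GM with weight [C] gives [N <= C B]. The choice [C = A] concludes; if
    [A = 0], a small [C] excludes [N > 0]. *)
Lemma cv_cauchy_schwarz f1 f2 p1 p2 x : L2fun f1 -> L2fun f2 -> L2fun p1 -> L2fun p2 ->
  (cv m P f1 p1 x + cv m P f2 p2 x) ^+ 2 + (cv m P f2 p1 x - cv m P f1 p2 x) ^+ 2 <=
  (norm2 f1 + norm2 f2) * (norm2 p1 + norm2 p2).
Proof.
move=> L1 L2 M1 M2.
set U := cv m P f1 p1 x + _; set V := cv m P f2 p1 x - _.
set A := norm2 f1 + _; set B := norm2 p1 + _; set N := U ^+ 2 + V ^+ 2.
have A0 : 0 <= A by rewrite addr_ge0 ?norm2_ge0.
have B0 : 0 <= B by rewrite addr_ge0 ?norm2_ge0.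
have N0 : 0 <= N by rewrite addr_ge0 ?sqr_ge0.
have key C : 0 < C -> A <= C -> N <= C * B.
  move=> C0 AC.
  pose T1 (q : R * R) := U * (f1 q.1 * p1 (hw x q.1 q.2) + f2 q.1 * p2 (hw x q.1 q.2)).
  pose T2 (q : R * R) := V * (f2 q.1 * p1 (hw x q.1 q.2) - f1 q.1 * p2 (hw x q.1 q.2)).
  pose G (q : R * R) := (N / C / 2) * (f1 q.1 ^+ 2 + f2 q.1 ^+ 2) +
    (C / 2) * (p1 (hw x q.1 q.2) ^+ 2 + p2 (hw x q.1 q.2) ^+ 2).
  have i11 := integrable_L2_hw x L1 M1; have i22 := integrable_L2_hw x L2 M2.
  have i21 := integrable_L2_hw x L2 M1; have i12 := integrable_L2_hw x L1 M2.
  have j1 := integrable_fst H L1.2; have j2 := integrable_fst H L2.2.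
  have k1 := integrable_hw H x M1.2; have k2 := integrable_hw H x M2.2.
  have iT1 := integrableZR U (integrableDR i11 i22).
  have iT2 := integrableZR V (integrableBR i21 i12).
  have iG1 := integrableZR (N / C / 2) (integrableDR j1 j2).
  have iG2 := integrableZR (C / 2) (integrableDR k1 k2).
  have fE f : L2fun f -> Rintegral (m \x P)%E setT (fun q => f q.1 ^+ 2) = norm2 f.
    move=> [mf fi]; rewrite /norm2 /Rintegral (ge0_integral_fst H (phi := fun x => f x ^+ 2))//.
      exact: measurable_funX.
    by move=> z; exact: sqr_ge0.
  have pE p : L2fun p -> Rintegral (m \x P)%E setT (fun q => p (hw x q.1 q.2) ^+ 2) = norm2 p.
    move=> [mf fi]; rewrite /norm2 /Rintegral (ge0_integral_hw H x (phi := fun x => p x ^+ 2))//.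
      exact: measurable_funX.
    by move=> z; exact: sqr_ge0.
  have NE : N = Rintegral (m \x P)%E setT (fun q => T1 q + T2 q).
    rewrite (RintegralDT iT1 iT2) (RintegralZT U (integrableDR i11 i22)) (RintegralZT V (integrableBR i21 i12)).
    rewrite (RintegralDT i11 i22) (RintegralBT i21 i12) -!cv_prodE//.
  have GE : Rintegral (m \x P)%E setT G = N / C / 2 * A + C / 2 * B.
    rewrite (RintegralDT iG1 iG2) (RintegralZT _ (integrableDR j1 j2)) (RintegralZT _ (integrableDR k1 k2)).
    by rewrite (RintegralDT j1 j2) (RintegralDT k1 k2) !fE// !pE.
  have : N <= N / C / 2 * A + C / 2 * B.
    rewrite {1}NE -GE; apply: le_RintegralT.
    - exact: integrableDR iT1 iT2.
    - exact: integrableDR iG1 iG2.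
    move=> q; rewrite /T1 /T2 /G.
    move: (f1 _) (f2 _) (p1 _) (p2 _) => u1 u2 v1 v2.
    (* AM-GM by completing the square: the difference is the squared modulus of a complex number
       over [2 C]. *)
    have E : N / C / 2 * (u1 ^+ 2 + u2 ^+ 2) + C / 2 * (v1 ^+ 2 + v2 ^+ 2) -
      (U * (u1 * v1 + u2 * v2) + V * (u2 * v1 - u1 * v2)) =
      ((U * u1 + V * u2 - C * v1) ^+ 2 + (U * u2 - V * u1 - C * v2) ^+ 2) / (2 * C).
      by rewrite /N; field; rewrite gt_eqF.
    rewrite -subr_ge0 E divr_ge0 ?addr_ge0 ?sqr_ge0//; lra.
  have : N / C * A <= N / C * C by rewrite ler_wpM2l// divr_ge0// ltW.
  rewrite divfK ?gt_eqF// => h1 h2.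
  have -> : C * B = 2 * (C / 2 * B) by field.
  lra.
have [A1|] := ltP 0 A; first exact: key.
move=> A1; have -> : A = 0 by apply/eqP; rewrite eq_le A1 A0.
rewrite mul0r leNgt; apply/negP => N1.
have B1 : 0 < B + 1 by lra.
(* With this [C] the bound [N <= C B] would read [N <= N B / (2 (B + 1))], impossible for
   [N > 0]. *)
have C0 : 0 < N / (2 * (B + 1)) by rewrite divr_gt0// mulr_gt0.
have := key _ C0 (le_trans A1 (ltW C0)).
rewrite mulrAC ler_pdivlMr ?mulr_gt0// => h; nra.
Qed.

End SquareIntegrable.

(** * Dilations *)

Section Dilation.
Context (R : realType) (a : R) (m P : {sigma_finite_measure set R -> \bar R}).
Hypothesis H : hankel_measures a m P.

Let a_gt : 1 / 2 < a. Proof. exact: hm_gt H. Qed.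

Definition dl (s : R) (phi : R -> R) (x : R) : R := powR s a * phi (s * x).

Lemma measurable_dl s phi : measurable_fun setT phi -> measurable_fun setT (dl s phi).
Proof.
by move=> mp; apply: measurable_funM => //; apply: (measurableT_comp mp); exact: measurable_funM.
Qed.

Lemma powR_sqr_inv s : 0 < s -> powR s a ^+ 2 * powR s (- (2 * a)) = 1.
Proof.
move=> s0; rewrite -powR_mulrn ?powR_ge0// -powRrM -powRD; last by rewrite (gt_eqF s0) implybT.
by rewrite (_ : a * 2%:R + - (2 * a) = 0) ?powRr0//; lra.
Qed.

Lemma L2fun_dl s phi : 0 < s -> L2fun m phi -> L2fun m (dl s phi) /\ norm2 m (dl s phi) = norm2 m phi.
Proof.
move=> s0 Lp; have [mp phii] := Lp.
have mp2 : measurable_fun setT (fun x => phi x ^+ 2) by exact: measurable_funX.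
have mps : measurable_fun setT (fun x => phi (s * x) ^+ 2).
  by apply: (measurableT_comp mp2); exact: measurable_funM.
have E : (\int[m]_x (dl s phi x ^+ 2)%:E = (norm2 m phi)%:E)%E.
  have -> : (\int[m]_x (dl s phi x ^+ 2)%:E = \int[m]_x (powR s a ^+ 2 * phi (s * x) ^+ 2)%:E)%E.
    by apply: eq_integral => x _; rewrite /dl exprMn.
  rewrite (ge0_integralZR _ mps (sqr_ge0 _) (fun x => sqr_ge0 _)).
  rewrite (hm_scale H s0 (g := fun x => (phi x ^+ 2)%:E)); last exact/measurable_EFinP.
  by rewrite -(norm2E Lp) -!EFinM mulrA powR_sqr_inv// mul1r.
have L : L2fun m (dl s phi) by apply: L2funP; [exact: measurable_dl|rewrite E ltry].
by split => //; apply: EFin_inj; rewrite -E (norm2E L).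
Qed.

Lemma integrable_dl s phi : 0 < s -> m.-integrable setT (EFin \o phi) ->
  m.-integrable setT (EFin \o dl s phi).
Proof.
move=> s0 phii; have mp := integrable_measurable phii.
apply: integrableZR; apply/integrableP; split.
  by apply/measurable_EFinP; apply: (measurableT_comp mp); exact: measurable_funM.
rewrite (hm_scale H s0 (g := fun x => `|phi x|%:E)); last first.
  by apply/measurable_EFinP; exact: measurableT_comp.
have /integrableP[_ h] := phii.
by apply: lte_mul_pinfty => //; rewrite lee_fin powR_ge0.
Qed.

Lemma hht_dl s phi xi : 0 < s -> measurable_fun setT phi ->
  hht a m (dl s phi) xi = powR s (- a) * hht a m phi (xi / s).
Proof.
move=> s0 mp.
have mg : measurable_fun setT (fun x => phi x * jb a (x * (xi / s))).
  apply: measurable_funM => //; apply: (measurableT_comp (measurable_jb _)) => //; exact: measurable_funM.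
have -> : powR s (- a) = powR s a * powR s (- (2 * a)).
  rewrite -powRD; last by rewrite (gt_eqF s0) implybT.
  by congr powR; lra.
rewrite -mulrA /hht -(Rintegral_scale H s0 mg) mulrC -RintegralZr_measurable; last first.
  by apply: (measurableT_comp mg); exact: measurable_funM.
apply: eq_Rintegral => x _; rewrite /dl (_ : s * x * (xi / s) = x * xi); first by ring.
by field; rewrite gt_eqF.
Qed.

End Dilation.

(** * The wavelet isometry *)

(** Separate from [hankel_measures] because these facts serve only Plancherel, truncation and the
    restriction to positive scales and frequencies. *)
Record half_line_measure (R : realType) (m : {measure set R -> \bar R}) : Prop := HalfLineMeasure {
  hl_pos : forall g : R -> \bar R, measurable_fun setT g -> (forall x, 0 <= g x)%E ->
    (\int[m]_x (g x * ((0 < x)%R%:R)%:E) = \int[m]_x g x)%E ;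
  hl_fin : forall N : R, (m [set x : R | (`|x| <= N)%R] < +oo)%E ;
  hl_dense : uc_dense m
}.

Section WaveletIsometry.
Context (R : realType) (a : R) (m P : {sigma_finite_measure set R -> \bar R}).
Hypothesis H : hankel_measures a m P.
Hypothesis HL : half_line_measure m.
Variables p1 p2 : R -> R.
Hypotheses (ip1 : m.-integrable setT (EFin \o p1)) (ip2 : m.-integrable setT (EFin \o p2)).
Hypotheses (Lp1 : L2fun m p1) (Lp2 : L2fun m p2).

Let a_gt : 1 / 2 < a. Proof. exact: hm_gt H. Qed.
Let mp1 : measurable_fun setT p1. Proof. exact: integrable_measurable ip1. Qed.
Let mp2 : measurable_fun setT p2. Proof. exact: integrable_measurable ip2. Qed.
Let mhht f : measurable_fun setT f -> measurable_fun setT (hht a m f).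
Proof. exact: (measurable_hht H). Qed.

(** With [wim], the real and imaginary parts of the transform of [f1 + i f2] for the wavelet
    [p1 + i p2], without the factor [c_psi^(-1/2)]; the signs come from the conjugate on the
    wavelet. *)
Definition wre (f1 f2 : R -> R) (s x : R) : R := cv m P f1 (dl a s p1) x + cv m P f2 (dl a s p2) x.
Definition wim (f1 f2 : R -> R) (s x : R) : R := cv m P f2 (dl a s p1) x - cv m P f1 (dl a s p2) x.
Definition wpow (f1 f2 : R -> R) (z : R * R) : R := wre f1 f2 z.1 z.2 ^+ 2 + wim f1 f2 z.1 z.2 ^+ 2.

Lemma wpow_ge0 f1 f2 z : 0 <= wpow f1 f2 z.
Proof. by rewrite addr_ge0 ?sqr_ge0. Qed.

Lemma measurable_cv_dl (f p : R -> R) : measurable_fun setT f -> measurable_fun setT p ->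
  measurable_fun setT (fun z : R * R => cv m P f (dl a z.1 p) z.2).
Proof.
move=> mf mp.
apply: (@measurable_Rintegral1 _ _ (R * R)%type R R m (fun w => f w.2 * htr P (dl a w.1.1 p) w.1.2 w.2)).
apply: measurable_funM; first exact: measurableT_comp.
apply: (@measurable_Rintegral1 _ _ (R * R * R)%type R R P
  (fun w => powR w.1.1.1 a * p (w.1.1.1 * hw w.1.1.2 w.1.2 w.2))).
have m1 : measurable_fun setT (fun w : R * R * R * R => w.1.1.1).
  by apply: (measurableT_comp measurable_fst); apply: (measurableT_comp measurable_fst).
have m2 : measurable_fun setT (fun w : R * R * R * R => w.1.1.2).
  by apply: (measurableT_comp measurable_snd); apply: (measurableT_comp measurable_fst).
have m3 : measurable_fun setT (fun w : R * R * R * R => w.1.2).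
  by apply: (measurableT_comp measurable_snd).
have mpw : measurable_fun setT (fun x : R => powR x a) by exact: measurable_powR.
apply: measurable_funM; first exact (measurableT_comp mpw m1).
apply: (measurableT_comp mp); apply: measurable_funM => //.
by apply: measurable_hw => //; exact: measurable_snd.
Qed.

Lemma measurable_wpow f1 f2 : measurable_fun setT f1 -> measurable_fun setT f2 ->
  measurable_fun setT (wpow f1 f2).
Proof.
move=> mf1 mf2; apply: measurable_funD; apply: measurable_funX.
  by apply: measurable_funD; exact: measurable_cv_dl.
by apply: measurable_funB; exact: measurable_cv_dl.
Qed.

Lemma wpow_le f1 f2 s x : 0 < s -> L2fun m f1 -> L2fun m f2 ->
  wpow f1 f2 (s, x) <= (norm2 m f1 + norm2 m f2) * (norm2 m p1 + norm2 m p2).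
Proof.
move=> s0 L1 L2.
have [M1 E1] := L2fun_dl H s0 Lp1; have [M2 E2] := L2fun_dl H s0 Lp2.
by rewrite -E1 -E2; exact: (cv_cauchy_schwarz H).
Qed.

Lemma wreB f1 f2 g1 g2 s x : 0 < s -> L2fun m f1 -> L2fun m f2 -> L2fun m g1 -> L2fun m g2 ->
  wre (fun y => f1 y - g1 y) (fun y => f2 y - g2 y) s x = wre f1 f2 s x - wre g1 g2 s x.
Proof.
move=> s0 L1 L2 G1 G2.
have [M1 _] := L2fun_dl H s0 Lp1; have [M2 _] := L2fun_dl H s0 Lp2.
by rewrite /wre (cvBl H x L1 G1 M1) (cvBl H x L2 G2 M2) opprD addrACA.
Qed.

Lemma wimB f1 f2 g1 g2 s x : 0 < s -> L2fun m f1 -> L2fun m f2 -> L2fun m g1 -> L2fun m g2 ->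
  wim (fun y => f1 y - g1 y) (fun y => f2 y - g2 y) s x = wim f1 f2 s x - wim g1 g2 s x.
Proof.
move=> s0 L1 L2 G1 G2.
have [M1 _] := L2fun_dl H s0 Lp1; have [M2 _] := L2fun_dl H s0 Lp2.
have aux (A B C D : R) : (A - B) - (C - D) = (A - C) - (B - D) by ring.
by rewrite /wim (cvBl H x L1 G1 M2) (cvBl H x L2 G2 M1); exact: aux.
Qed.

(** The scale is integrated against [m] as well: [a^(2 alpha + 1) da] is [hK alpha] times this
    measure, and the scaling rule of [m] then applies to scales too. *)
Definition wenergy f1 f2 : \bar R := (\int[m \x m]_z (wpow f1 f2 z * (0 < z.1)%R%:R)%:E)%E.

Definition wpsi (xi : R) : R := hht a m p1 xi ^+ 2 + hht a m p2 xi ^+ 2.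

(** The admissibility integral with respect to [m]: the power of [xi] turns the density of [m] into
    that of [d xi / xi], up to [hK alpha]. *)
Definition wcst : \bar R := (\int[m]_xi (wpsi xi * powR xi (- (2 * a)) * (0 < xi)%R%:R)%:E)%E.

Lemma measurable_pos : measurable_fun setT (fun x : R => (0 < x)%R%:R : R).
Proof.
rewrite (_ : (fun x => _) = \1_(`]0, +oo[%classic : set R)); first exact: measurable_indic.
by apply/funext => x; rewrite indic_gt.
Qed.

Lemma wpsi_ge0 xi : 0 <= wpsi xi. Proof. by rewrite addr_ge0 ?sqr_ge0. Qed.

Lemma measurable_wpsi : measurable_fun setT wpsi.
Proof. by apply: measurable_funD; apply: measurable_funX; exact: mhht. Qed.

Lemma wcst_ge0 : (0 <= wcst)%E.
Proof. by apply: integral_ge0 => x _; rewrite lee_fin !mulr_ge0 ?wpsi_ge0 ?powR_ge0. Qed.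

Lemma measurable_wenergy f1 f2 : measurable_fun setT f1 -> measurable_fun setT f2 ->
  measurable_fun setT (fun z : R * R => wpow f1 f2 z * (0 < z.1)%R%:R).
Proof.
move=> mf1 mf2; apply: measurable_funM; first exact: measurable_wpow.
exact (measurableT_comp measurable_pos measurable_fst).
Qed.

Lemma wenergy_ge0 f1 f2 z : 0 <= wpow f1 f2 z * (0 < z.1)%R%:R.
Proof. by rewrite mulr_ge0 ?wpow_ge0. Qed.

Lemma wenergyE f1 f2 : measurable_fun setT f1 -> measurable_fun setT f2 ->
  (wenergy f1 f2 = \int[m]_s ((\int[m]_x (wpow f1 f2 (s, x))%:E) * ((0 < s)%R%:R)%:E))%E.
Proof.
move=> mf1 mf2; rewrite /wenergy (ge0_integral_fubini1 m m (measurable_wenergy mf1 mf2) (@wenergy_ge0 _ _)).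
apply: eq_integral => s _ /=.
have mw : measurable_fun setT (fun x => wpow f1 f2 (s, x)).
  exact (measurableT_comp (measurable_wpow mf1 mf2) (pair1_measurable s)).
under eq_integral do rewrite mulrC.
by rewrite (ge0_integralZR m mw (ler0n _ _) (fun=> wpow_ge0 _ _ _)) muleC.
Qed.

Lemma hhtD f g xi : m.-integrable setT (EFin \o f) -> m.-integrable setT (EFin \o g) ->
  hht a m (fun x => f x + g x) xi = hht a m f xi + hht a m g xi.
Proof.
move=> fi gi; rewrite /hht -RintegralDT; [|exact: (integrable_mul_jb H)|exact: (integrable_mul_jb H)].
by apply: eq_Rintegral => x _; rewrite mulrDl.
Qed.

Lemma hhtB f g xi : m.-integrable setT (EFin \o f) -> m.-integrable setT (EFin \o g) ->
  hht a m (fun x => f x - g x) xi = hht a m f xi - hht a m g xi.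
Proof.
move=> fi gi; rewrite /hht -RintegralBT; [|exact: (integrable_mul_jb H)|exact: (integrable_mul_jb H)].
by apply: eq_Rintegral => x _; rewrite mulrBl.
Qed.

Section bounded.
Variables (f1 f2 : R -> R) (M : R).
Hypotheses (if1 : m.-integrable setT (EFin \o f1)) (if2 : m.-integrable setT (EFin \o f2)).
Hypotheses (b1 : forall x, `|f1 x| <= M) (b2 : forall x, `|f2 x| <= M).

Let mf1 : measurable_fun setT f1. Proof. exact: integrable_measurable if1. Qed.
Let mf2 : measurable_fun setT f2. Proof. exact: integrable_measurable if2. Qed.

Let F xi := hht a m f1 xi ^+ 2 + hht a m f2 xi ^+ 2.

Let mF : measurable_fun setT F.
Proof. by apply: measurable_funD; apply: measurable_funX; exact: mhht. Qed.

Let F0 xi : 0 <= F xi. Proof. by rewrite addr_ge0 ?sqr_ge0. Qed.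

Let intF : (\int[m]_xi (F xi)%:E = (norm2 m f1 + norm2 m f2)%:E)%E.
Proof.
have mH1 : measurable_fun setT (fun xi => hht a m f1 xi ^+ 2) by apply: measurable_funX; exact: mhht.
have mH2 : measurable_fun setT (fun xi => hht a m f2 xi ^+ 2) by apply: measurable_funX; exact: mhht.
rewrite (ge0_integralDR _ mH1 mH2 (fun=> sqr_ge0 _) (fun=> sqr_ge0 _)) EFinD.
rewrite (hankel_plancherel H (hl_dense HL) b1 if1) (hankel_plancherel H (hl_dense HL) b2 if2).
by rewrite !norm2E//; split => //; exact: (integrable_sqr_bounded _ if2) || exact: (integrable_sqr_bounded _ if1).
Qed.

(** Plancherel for the real and the imaginary part, both bounded and integrable. The convolution
    theorem makes their transforms products, and a scaling of [xi] moves the dilation from the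
    wavelet to [f]. *)
Lemma integral_wpow_bounded s : 0 < s ->
  (\int[m]_x (wpow f1 f2 (s, x))%:E = \int[m]_xi (F (s * xi) * wpsi xi)%:E)%E.
Proof.
move=> s0.
have iq1 := integrable_dl H s0 ip1; have iq2 := integrable_dl H s0 ip2.
have c11 := integrable_cv H if1 iq1; have c12 := integrable_cv H if1 iq2.
have c21 := integrable_cv H if2 iq1; have c22 := integrable_cv H if2 iq2.
have ir := integrableDR c11 c22; have ii := integrableBR c21 c12.
have br x : `|wre f1 f2 s x| <= M * Rintegral m setT (fun x => `|dl a s p1 x|) +
    M * Rintegral m setT (fun x => `|dl a s p2 x|).
  rewrite (le_trans (ler_normD _ _))// lerD//.
    exact: (cv_bounded H if1 iq1 x b1).
  exact: (cv_bounded H if2 iq2 x b2).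
have bi x : `|wim f1 f2 s x| <= M * Rintegral m setT (fun x => `|dl a s p1 x|) +
    M * Rintegral m setT (fun x => `|dl a s p2 x|).
  rewrite (le_trans (ler_normB _ _))// lerD//.
    exact: (cv_bounded H if2 iq1 x b2).
  exact: (cv_bounded H if1 iq2 x b1).
have mr : measurable_fun setT (wre f1 f2 s) by exact: integrable_measurable ir.
have mi : measurable_fun setT (wim f1 f2 s) by exact: integrable_measurable ii.
have mr2 : measurable_fun setT (fun x => wre f1 f2 s x ^+ 2) by exact: measurable_funX.
have mi2 : measurable_fun setT (fun x => wim f1 f2 s x ^+ 2) by exact: measurable_funX.
rewrite (ge0_integralDR m mr2 mi2 (fun=> sqr_ge0 _) (fun=> sqr_ge0 _)).
rewrite -(hankel_plancherel H (hl_dense HL) br ir) -(hankel_plancherel H (hl_dense HL) bi ii).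
have mhr : measurable_fun setT (fun xi => hht a m (wre f1 f2 s) xi ^+ 2) by apply: measurable_funX; exact: mhht.
have mhi : measurable_fun setT (fun xi => hht a m (wim f1 f2 s) xi ^+ 2) by apply: measurable_funX; exact: mhht.
rewrite -(ge0_integralDR m mhr mhi (fun=> sqr_ge0 _) (fun=> sqr_ge0 _)).
pose g xi := F xi * wpsi (xi / s).
have mdiv : measurable_fun setT (fun xi : R => xi / s) by exact: measurable_funM.
have mg : measurable_fun setT g.
  apply: measurable_funM; first exact: mF.
  exact (measurableT_comp measurable_wpsi mdiv).
have g0 xi : 0 <= g xi by rewrite mulr_ge0 ?wpsi_ge0.
transitivity (\int[m]_xi (powR s (- (2 * a)) * g xi)%:E)%E.
  apply: eq_integral => xi _; congr EFin.
  have -> : hht a m (wre f1 f2 s) xi = hht a m f1 xi * hht a m (dl a s p1) xi + hht a m f2 xi * hht a m (dl a s p2) xi.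
    by rewrite (hhtD _ c11 c22) !(hht_cv H).
  have -> : hht a m (wim f1 f2 s) xi = hht a m f2 xi * hht a m (dl a s p1) xi - hht a m f1 xi * hht a m (dl a s p2) xi.
    by rewrite (hhtB _ c21 c12) !(hht_cv H).
  rewrite !(hht_dl H)// /g /F /wpsi.
  have -> : powR s (- (2 * a)) = powR s (- a) ^+ 2.
    by rewrite -powR_mulrn ?powR_ge0// -powRrM; congr powR; lra.
  (* Multiplicativity of the squared modulus of complex numbers, in real form. *)
  have aux (k A B u v : R) : (A * (k * u) + B * (k * v)) ^+ 2 + (B * (k * u) - A * (k * v)) ^+ 2 =
      k ^+ 2 * ((A ^+ 2 + B ^+ 2) * (u ^+ 2 + v ^+ 2)) by ring.
  exact: aux.
rewrite (ge0_integralZR m mg (powR_ge0 _ _) g0).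
have mEg : measurable_fun setT (EFin \o g) by exact/measurable_EFinP.
have <- : (\int[m]_xi (g (s * xi))%:E = (powR s (- (2 * a)))%:E * \int[m]_x (g x)%:E)%E.
  exact: (hm_scale H s0 mEg).
apply: eq_integral => xi _ /=; congr EFin; rewrite /g (mulrC s) mulfK//.
by rewrite gt_eqF.
Qed.

(** Tonelli puts the scale integral inside. There [F (s xi)] integrates to [xi^(-2a)] times the
    integral of [F], known from Plancherel, and the remaining integral in [xi] is [wcst]. *)
Lemma wenergy_bounded : (wenergy f1 f2 = wcst * (norm2 m f1 + norm2 m f2)%:E)%E.
Proof.
rewrite wenergyE//.
pose K (z : R * R) := F (z.1 * z.2) * wpsi z.2.
have mz : measurable_fun setT (fun z : R * R => z.1 * z.2) by exact: measurable_funM.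
have mK : measurable_fun setT K.
  apply: measurable_funM; first exact (measurableT_comp mF mz).
  exact (measurableT_comp measurable_wpsi measurable_snd).
have K0 z : 0 <= K z by rewrite mulr_ge0 ?wpsi_ge0.
have mKE : measurable_fun setT (EFin \o K) by exact/measurable_EFinP.
have KE0 z : (0 <= (EFin \o K) z)%E by rewrite lee_fin.
transitivity (\int[m]_s ((\int[m]_xi (K (s, xi))%:E) * ((0 < s)%R%:R)%:E))%E.
  apply: eq_integral => s _; have [s0|s0] := ltP 0 s; last by rewrite !mule0.
  by rewrite integral_wpow_bounded.
rewrite (hl_pos HL); last 2 first.
- exact: (@measurable_fun_fubini_tonelli_F _ _ _ _ _ m (EFin \o K)).
- by move=> s; apply: integral_ge0 => x _; rewrite lee_fin.
rewrite -(ge0_integral_fubini1 m m mK K0) (ge0_integral_fubini2 m m mK K0).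
rewrite -(hl_pos HL); last 2 first.
- exact: (@measurable_fun_fubini_tonelli_G _ _ _ _ _ m (EFin \o K)).
- by move=> s; apply: integral_ge0 => x _; rewrite lee_fin.
have mc : measurable_fun setT (fun xi => wpsi xi * powR xi (- (2 * a)) * (0 < xi)%R%:R).
  apply: measurable_funM; last exact: measurable_pos.
  by apply: measurable_funM; [exact: measurable_wpsi|exact: measurable_powR].
transitivity (\int[m]_xi ((wpsi xi * powR xi (- (2 * a)) * (0 < xi)%R%:R)%:E * (norm2 m f1 + norm2 m f2)%:E))%E.
  apply: eq_integral => xi _; have [x0|x0] := ltP 0 xi; last by rewrite !mulr0 mule0 mul0e.
  rewrite mule1 mulr1.
  have mFx : measurable_fun setT (fun s => F (xi * s)).
    by apply: (measurableT_comp mF); exact: measurable_funM.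
  transitivity (\int[m]_s (wpsi xi * F (xi * s))%:E)%E.
    by apply: eq_integral => s _; rewrite /K/= mulrC (mulrC s).
  rewrite (ge0_integralZR m mFx (wpsi_ge0 _) (fun=> F0 _)).
  have mEF : measurable_fun setT (EFin \o F) by apply/measurable_EFinP; exact: mF.
  have E : (\int[m]_s (F (xi * s))%:E = (powR xi (- (2 * a)))%:E * \int[m]_x (F x)%:E)%E.
    exact: (hm_scale H x0 mEF).
  by rewrite E intF !EFinM muleA.
rewrite ge0_integralZr//.
- exact/measurable_EFinP.
- by move=> xi _; rewrite lee_fin !mulr_ge0 ?wpsi_ge0 ?powR_ge0.
- by rewrite lee_fin addr_ge0 ?norm2_ge0.
Qed.

End bounded.

Hypothesis Cfin : (wcst < +oo)%E.

Let C := fine wcst.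
Let CE : wcst = C%:E. Proof. by rewrite /C fineK// ge0_fin_numE ?wcst_ge0. Qed.
Let C0 : 0 <= C. Proof. by rewrite -lee_fin -CE wcst_ge0. Qed.

Let Bp := norm2 m p1 + norm2 m p2.
Let Bp0 : 0 <= Bp. Proof. by rewrite addr_ge0 ?norm2_ge0. Qed.

(** Both functions are cut to the set where [|f1|], [|f2|] and [|x|] are at most [n]: the pieces
    kept are bounded with bounded support, hence integrable, and disjointness of supports makes
    squared norms add. *)
Lemma L2fun_trunc f1 f2 (e : R) : L2fun m f1 -> L2fun m f2 -> 0 < e ->
  exists g1 g2 M, [/\ m.-integrable setT (EFin \o g1) /\ m.-integrable setT (EFin \o g2),
    (forall x, `|g1 x| <= M) /\ (forall x, `|g2 x| <= M),
    [/\ L2fun m g1, L2fun m g2, L2fun m (fun x => f1 x - g1 x) & L2fun m (fun x => f2 x - g2 x)],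
    norm2 m (fun x => f1 x - g1 x) + norm2 m (fun x => f2 x - g2 x) <= e &
    norm2 m f1 + norm2 m f2 = norm2 m g1 + norm2 m g2 +
      (norm2 m (fun x => f1 x - g1 x) + norm2 m (fun x => f2 x - g2 x))].
Proof.
move=> [mf1 i1] [mf2 i2] e0.
have mabs : measurable_fun setT (fun x : R => `|x|) by exact: measurableT_comp.
pose u x := Num.max `|f1 x| (Num.max `|f2 x| `|x|).
have mu_ : measurable_fun setT u.
  apply: measurable_maxr; first exact (measurableT_comp mabs mf1).
  by apply: measurable_maxr => //; exact (measurableT_comp mabs mf2).
have F0 x : 0 <= f1 x ^+ 2 + f2 x ^+ 2 by rewrite addr_ge0 ?sqr_ge0.
have [n tail] := integral_tail_small (integrableDR i1 i2) mu_ F0 e0.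
pose g (f : R -> R) x := f x * (u x <= n%:R)%R%:R.
have mi : measurable_fun setT (fun x => (u x <= n%:R)%R%:R : R).
  rewrite (_ : (fun x => _) = \1_(u @^-1` `]-oo, n%:R])).
    by apply: measurable_indic; rewrite -[X in measurable X]setTI; exact: mu_.
  apply/funext => x; rewrite indicE; congr (nat_of_bool _)%:R.
  by apply/idP/idP; rewrite inE/= in_itv/=.
have uu x : u x <= n%:R -> [/\ `|f1 x| <= n%:R, `|f2 x| <= n%:R & `|x| <= n%:R].
  by rewrite /u !ge_max => /and3P[].
have gb (f : R -> R) x : (u x <= n%:R -> `|f x| <= n%:R) -> `|g f x| <= n%:R.
  by rewrite /g normrM; case: (u x <= n%:R)%R => h; rewrite ?normr1 ?normr0 ?mulr1 ?mulr0// h.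
have b1 x : `|g f1 x| <= n%:R by apply: gb => /uu[].
have b2 x : `|g f2 x| <= n%:R by apply: gb => /uu[].
pose B : set R := [set x : R | `|x| <= n%:R].
have mB : measurable B.
  rewrite (_ : B = (fun x => `|x|) @^-1` `]-oo, n%:R]); last first.
    by apply/seteqP; split => x /=; rewrite in_itv/=.
  by rewrite -[X in measurable X]setTI; exact: mabs.
have iB : m.-integrable setT (EFin \o (fun x => n%:R * (\1_B x : R))).
  apply: integrableZR; apply: ge0_integrable; first exact: measurable_indic.
    by move=> x; rewrite indicE.
  by rewrite integral_indic// setIT; exact: (hl_fin HL).
have ig (f : R -> R) : measurable_fun setT f -> (forall x, u x <= n%:R -> `|f x| <= n%:R) ->
    m.-integrable setT (EFin \o g f).
  move=> mf fb; apply: (le_integrableR _ iB); first exact: measurable_funM.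
  move=> x; rewrite /g normrM; have [ux|ux] := leP (u x) n%:R; last by rewrite normr0 mulr0 mulr_ge0// indicE.
  rewrite normr1 indicE mem_set ?mulr1 ?fb//=; by have [] := uu x ux.
have b01 (b : bool) : `|b%:R : R| <= 1 by case: b; rewrite ?normr1 ?normr0.
have Lg f : L2fun m f -> L2fun m (g f).
  move=> Lf; have [mf _] := Lf; apply: (L2fun_le _ _ Lf); first exact: measurable_funM.
  by move=> x; rewrite /g normrM ler_piMr.
have hE f x : f x - g f x = f x * (n%:R < u x)%R%:R.
  by rewrite /g; case: leP; rewrite ?mulr1 ?mulr0 ?subrr ?subr0.
have Lh f : L2fun m f -> L2fun m (fun x => f x - g f x).
  move=> Lf; have [mf _] := Lf; have [mgf _] := Lg f Lf.
  apply: (L2fun_le _ _ Lf); first exact: measurable_funB.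
  by move=> x; rewrite hE normrM ler_piMr.
have nE f : L2fun m f -> norm2 m f = norm2 m (g f) + norm2 m (fun x => f x - g f x).
  move=> Lf; have [_ k1] := Lg f Lf; have [_ k2] := Lh f Lf.
  rewrite /norm2 -RintegralDT//; apply: eq_Rintegral => x _; rewrite hE /g.
  by case: leP; rewrite ?mulr1 ?mulr0 expr0n/= ?addr0 ?add0r.
have Lf1 : L2fun m f1 by []; have Lf2 : L2fun m f2 by [].
exists (g f1), (g f2), n%:R; split.
- by split; apply: ig => // x /uu[].
- by split.
- by split; [exact: Lg|exact: Lg|exact: Lh|exact: Lh].
- have [_ k1] := Lh f1 Lf1; have [_ k2] := Lh f2 Lf2.
  rewrite -lee_fin /norm2 -RintegralDT// (EFin_Rintegral (integrableDR k1 k2)).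
  apply: le_trans tail; rewrite le_eqVlt; apply/orP; left; apply/eqP.
  apply: eq_integral => x _; congr EFin; rewrite !hE !exprMn mulrDl.
  by case: (_ < _)%R; rewrite ?expr1n ?expr0n.
- by rewrite (nE f1)// (nE f2)//; ring.
Qed.

(** Fatou along truncations with error at most [1/(k+1)]. The pointwise convergence it needs comes
    from the uniform bound [wpow_le] applied to the remainders, by linearity of [wre] and [wim]. *)
Lemma wenergy_le f1 f2 : L2fun m f1 -> L2fun m f2 ->
  (wenergy f1 f2 <= (C * (norm2 m f1 + norm2 m f2))%:E)%E.
Proof.
move=> L1 L2; have [mf1 _] := L1; have [mf2 _] := L2.
have ex (k : nat) : exists g : (R -> R) * (R -> R), exists M, [/\ m.-integrable setT (EFin \o g.1) /\ m.-integrable setT (EFin \o g.2),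
    (forall x, `|g.1 x| <= M) /\ (forall x, `|g.2 x| <= M),
    [/\ L2fun m g.1, L2fun m g.2, L2fun m (fun x => f1 x - g.1 x) & L2fun m (fun x => f2 x - g.2 x)],
    norm2 m (fun x => f1 x - g.1 x) + norm2 m (fun x => f2 x - g.2 x) <= k.+1%:R^-1 &
    norm2 m f1 + norm2 m f2 = norm2 m g.1 + norm2 m g.2 +
      (norm2 m (fun x => f1 x - g.1 x) + norm2 m (fun x => f2 x - g.2 x))].
  have k0 : (0 : R) < k.+1%:R^-1 by rewrite invr_gt0.
  by have [g1 [g2 [M h]]] := L2fun_trunc L1 L2 k0; exists (g1, g2), M.
have [g gP] := choice ex.
apply: (@integral_le_fatou _ _ _ (m \x m)%E (fun k z => wpow (g k).1 (g k).2 z * (0 < z.1)%R%:R)).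
- move=> k; have [M [_ _ [[mg1 _] [mg2 _] _ _] _ _]] := gP k; exact: measurable_wenergy.
- by move=> k z; exact: wenergy_ge0.
- move=> k; have [M [[i1 i2] [b1 b2] _ _ nE]] := gP k.
  rewrite -/(wenergy _ _) (wenergy_bounded i1 i2 b1 b2) CE -EFinM lee_fin ler_wpM2l// nE.
  by rewrite lerDl addr_ge0 ?norm2_ge0.
- case=> s x; have [s0|s0] := ltP 0 s; last first.
    under eq_fun do rewrite mulr0; rewrite mulr0; exact: cvg_cst.
  under eq_fun do rewrite mulr1; rewrite mulr1.
  have sq0 : (k.+1%:R^-1 * Bp : R) @[k --> \oo] --> 0.
    by rewrite -[X in _ --> X](mul0r Bp); apply: cvgMl; exact: cvg_harmonic.
  have conv (v : nat -> R) (l : R) : (forall k, (l - v k) ^+ 2 <= k.+1%:R^-1 * Bp) -> v k @[k --> \oo] --> l.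
    move=> hv; apply/cvgrPdist_le => e e0.
    have /cvgrPdist_le /(_ (e ^+ 2) (exprn_gt0 2 e0)) := sq0.
    apply: filterS => k; rewrite sub0r normrN => hk.
    have e1 := ltW e0.
    rewrite -(@ler_pXn2r _ 2)// ?nnegrE// real_normK ?num_real//.
    by rewrite (le_trans (hv k))// (le_trans _ hk)// ler_norm.
  have bound k : (wre f1 f2 s x - wre (g k).1 (g k).2 s x) ^+ 2 + (wim f1 f2 s x - wim (g k).1 (g k).2 s x) ^+ 2 <= k.+1%:R^-1 * Bp.
    have [M [_ _ [G1 G2 D1 D2] hd _]] := gP k.
    rewrite -(wreB x s0 L1 L2 G1 G2) -(wimB x s0 L1 L2 G1 G2).
    apply: (le_trans (wpow_le x s0 D1 D2)); exact: ler_wpM2r.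
  have c1 : wre (g k).1 (g k).2 s x @[k --> \oo] --> wre f1 f2 s x.
    by apply: conv => k; apply: le_trans (bound k); rewrite lerDl sqr_ge0.
  have c2 : wim (g k).1 (g k).2 s x @[k --> \oo] --> wim f1 f2 s x.
    by apply: conv => k; apply: le_trans (bound k); rewrite lerDr sqr_ge0.
  by apply: cvgD; rewrite /= !expr2; apply: cvgM.
Qed.

(** For the reverse inequality the exact identity is used on a truncation and [wenergy_le] on the
    remainder. The two are compared through [|v|^2 <= (1 + t) |u|^2 + (1 + 1/t) |u - v|^2]. *)
Theorem wavelet_isometry f1 f2 : L2fun m f1 -> L2fun m f2 ->
  (wenergy f1 f2 = (C * (norm2 m f1 + norm2 m f2))%:E)%E.
Proof.
move=> L1 L2; have [mf1 _] := L1; have [mf2 _] := L2.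
apply/eqP; rewrite eq_le wenergy_le//=.
set A := norm2 m f1 + norm2 m f2.
have A0 : 0 <= A by rewrite addr_ge0 ?norm2_ge0.
have W0 : (0 <= wenergy f1 f2)%E by apply: integral_ge0 => z _; rewrite lee_fin wenergy_ge0.
have Wfin : wenergy f1 f2 \is a fin_num.
  by rewrite ge0_fin_numE//; apply: le_lt_trans (wenergy_le L1 L2) _; rewrite ltry.
set E := fine (wenergy f1 f2).
have WE : wenergy f1 f2 = E%:E by rewrite /E fineK.
have EA : E <= C * A by rewrite -lee_fin -WE wenergy_le.
rewrite WE lee_fin.
have key t : 0 < t -> t <= 1 -> C * A <= E + t * (C * A + 3 * C).
  move=> t0 t1.
  (* A truncation error of [t^2] compensates the factor [1 + 1/t]: their product is [t^2 + t]. *)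
  have [g1 [g2 [M [[i1 i2] [b1 b2] [G1 G2 D1 D2] hd nE]]]] := L2fun_trunc L1 L2 (exprn_gt0 2 t0).
  set d := norm2 m (fun x => f1 x - g1 x) + _ in hd nE.
  have [mg1 _] := G1; have [mg2 _] := G2; have [md1 _] := D1; have [md2 _] := D2.
  have h := wenergy_le D1 D2; rewrite -/d in h.
  have q0 : 0 <= 1 + t^-1 by rewrite addr_ge0// invr_ge0 ltW.
  have r0 : 0 <= 1 + t by rewrite addr_ge0// ltW.
  have le1 : (wenergy g1 g2 <= (1 + t)%:E * wenergy f1 f2 +
      (1 + t^-1)%:E * wenergy (fun x => f1 x - g1 x)%R (fun x => f2 x - g2 x)%R)%E.
    have mw1 := measurable_wenergy mf1 mf2; have mw2 := measurable_wenergy md1 md2.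
    rewrite /wenergy -(ge0_integralZR _ mw1 r0 (@wenergy_ge0 _ _)) -(ge0_integralZR _ mw2 q0 (@wenergy_ge0 _ _)).
    have mk1 : measurable_fun setT (fun z => (1 + t) * (wpow f1 f2 z * (0 < z.1)%R%:R)) by exact: measurable_funM.
    have mk2 : measurable_fun setT (fun z => (1 + t^-1) * (wpow (fun x => f1 x - g1 x) (fun x => f2 x - g2 x) z * (0 < z.1)%R%:R)) by exact: measurable_funM.
    rewrite -(ge0_integralDR _ mk1 mk2 (fun z => mulr_ge0 r0 (@wenergy_ge0 _ _ z)) (fun z => mulr_ge0 q0 (@wenergy_ge0 _ _ z))).
    apply: ge0_le_integralR.
    - exact: measurable_wenergy.
    - exact: measurable_funD.
    - by move=> z; exact: wenergy_ge0.
    case=> s x; rewrite /=; have [s0|s0] := ltP 0 s; last by rewrite !mulr0 addr0.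
    rewrite !mulr1 /wpow/= (wreB x s0 L1 L2 G1 G2) (wimB x s0 L1 L2 G1 G2).
    move: (wre f1 f2 s x) (wre g1 g2 s x) (wim f1 f2 s x) (wim g1 g2 s x) => u v u' v'.
    (* The right side exceeds [q^2] by exactly a square divided by [t]. *)
    have aux (p q : R) : q ^+ 2 <= (1 + t) * p ^+ 2 + (1 + t^-1) * (p - q) ^+ 2.
      have -> : (1 + t) * p ^+ 2 + (1 + t^-1) * (p - q) ^+ 2 = q ^+ 2 + (t * p + (p - q)) ^+ 2 / t.
        by field; rewrite gt_eqF.
      by rewrite lerDl divr_ge0 ?sqr_ge0// ltW.
    have := aux u v; have := aux u' v'; lra.
  rewrite (wenergy_bounded i1 i2 b1 b2) CE WE in le1.
  have le2 : C * (norm2 m g1 + norm2 m g2) <= (1 + t) * E + (1 + t^-1) * (C * d).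
    rewrite -lee_fin EFinD !EFinM; apply: (le_trans le1); rewrite leeD2l//.
    by apply: lee_wpmul2l; [rewrite lee_fin|rewrite -EFinM].
  have d0 : 0 <= d by rewrite addr_ge0 ?norm2_ge0.
  have le3 : (1 + t^-1) * (C * d) <= C * t ^+ 2 + C * t.
    have -> : C * t ^+ 2 + C * t = (1 + t^-1) * (C * t ^+ 2) by field; rewrite gt_eqF.
    by rewrite ler_wpM2l// ler_wpM2l.
  have le4 : C * d <= C * t ^+ 2 by rewrite ler_wpM2l.
  have le5 : C * t ^+ 2 <= C * t by rewrite ler_wpM2l// expr2 ler_piMl// ltW.
  have le6 : t * E <= t * (C * A) by rewrite ler_wpM2l// ltW.
  have -> : C * A = C * (norm2 m g1 + norm2 m g2) + C * d by rewrite -mulrDr -nE.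
  have CA : C * A = C * (norm2 m g1 + norm2 m g2) + C * d by rewrite -mulrDr -nE.
  rewrite CA in le6; lra.
apply/ler_addgt0Pr => e e0.
(* The added [1] makes [K] positive, so that [t = e / K], capped at [1], is available even when
   [C = 0]. *)
pose K := C * A + 3 * C + 1.
have K0 : 0 < K by rewrite ltr_wpDl// addr_ge0// mulr_ge0.
pose t := Num.min 1 (e / K).
have t0 : 0 < t by rewrite lt_min ltr01 divr_gt0.
have t1 : t <= 1 by rewrite ge_min lexx.
apply: (le_trans (key t t0 t1)); rewrite lerD2l.
have tK : t <= e / K by rewrite ge_min lexx orbT.
rewrite -(divfK (lt0r_neq0 K0) e); apply: ler_pM => //.
- exact: ltW.
- by rewrite addr_ge0// mulr_ge0.
- by rewrite /K lerDl.
Qed.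

End WaveletIsometry.

(** * Back to the concrete definitions *)

Lemma Rintegral_domZ d (T : measurableType d) (R : realType) (m : {measure set T -> \bar R})
    (D : set T) (f : T -> R) (k : R) : measurable D -> measurable_fun setT f ->
  Rintegral m D (fun x => k * f x) = k * Rintegral m D f.
Proof.
move=> mD mf; have E (g : T -> R) : Rintegral m D g = Rintegral m setT (fun x => g x * \1_D x).
  rewrite /Rintegral integral_mkcond; congr fine; apply: eq_integral => x _.
  rewrite patchE indicE; case: ifPn => _; first by rewrite mulr1.
  by rewrite mulr0.
rewrite !E mulrC -RintegralZr_measurable; last exact: measurable_funM.
by apply: eq_Rintegral => x _; ring.
Qed.

Section HankelDefsLink.
Context (R : realType) (alpha : R).
Hypothesis ha : - (1 / 2) < alpha.
Local Notation m := (on_reals (hmu alpha)).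
Local Notation P := (on_reals (hP alpha)).
Local Notation a := (alpha + 1).
Local Notation mu := (@lebesgue_measure R).

Let H : hankel_measures a m P. Proof. exact: hankel_measures_hmu. Qed.

Lemma half_line_measure_hmu : half_line_measure m.
Proof.
split; [|exact: (hmu_norm_le_lty ha)|exact: (uc_dense_hmu ha)].
move=> g mg g0.
have mi : measurable_fun setT (fun x : R => ((0 < x)%R%:R : R)%:E).
  apply/measurable_EFinP.
  rewrite (_ : (fun x => _) = \1_(`]0, +oo[%classic : set R)); first exact: measurable_indic.
  by apply/funext => x; rewrite indic_gt.
have mgi : measurable_fun setT (fun x => (g x * ((0 < x)%R%:R)%:E)%E) by exact: emeasurable_funM.
rewrite !integral_on_reals// !ge0_integral_hmu//.
  congr (_ * _)%E; apply: eq_integral => x; rewrite inE/= in_itv/= andbT => x0.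
  by rewrite x0 mule1.
by move=> x; rewrite mule_ge0.
Qed.

Lemma j_besselE z : j_bessel alpha z = jb a z.
Proof.
have a0 : 0 < a by have h := ha; lra.
have g0 : Gamma a != 0 by rewrite gt_eqF// gamma_gt0.
rewrite /j_bessel; have -> : series (fun n : nat =>
     (-1) ^+ n / ((n`!)%:R * Gamma (n%:R + alpha + 1)) * (z / 2) ^+ (2 * n)) =
     (fun n => series (fun n => bc a n * z ^+ (2 * n)) n * (Gamma a)^-1).
  apply/funext => n; rewrite /series/= mulr_suml; apply: eq_bigr => k _.
  rewrite -addrA addrC gamma_risef// /bc expr_div_n.
  have -> : 2 ^+ (2 * k) = 4 ^+ k :> R by rewrite exprM -natrX.
  have f0 : k`!%:R != 0 :> R by rewrite pnatr_eq0 -lt0n fact_gt0.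
  have r0 : risef a k != 0 by rewrite gt_eqF// risef_gt0.
  have e0 : 4 ^+ k != 0 :> R by rewrite expf_neq0.
  by move: (Gamma a) g0 (risef a k) r0 => G G0 r r0; field; rewrite f0 r0 e0 G0.
have cj : series (fun n => bc a n * z ^+ (2 * n)) n * (Gamma a)^-1 @[n --> \oo] --> jb a z * (Gamma a)^-1.
  by apply: cvgMl; apply: cvg_jb; exact: hm_gt H.
by rewrite (cvg_lim _ cj)// mulrC divfK.
Qed.

(** The even extension through [|x|] yields a function measurable on the whole line from one that is
    only assumed measurable on [[0, +oo[]; the measure [m] sees no difference. *)
Definition rpart (g : R -> R[i]) (x : R) : R := complex.Re (g `|x|).
Definition ipart (g : R -> R[i]) (x : R) : R := complex.Im (g `|x|).

Lemma measurable_comp_norm (h : R -> R) : measurable_fun (`[0%R, +oo[%classic : set R) h ->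
  measurable_fun setT (fun x : R => h `|x|).
Proof.
move=> mh; apply: (@measurable_comp _ _ _ _ _ _ (`[0%R, +oo[%classic : set R)) => //.
- move=> _ [x _ <-]; rewrite /= in_itv/= andbT; exact: normr_ge0.
Qed.

Lemma measurable_rpart g : cmeasurable g -> measurable_fun setT (rpart g).
Proof. by move=> [h _]; exact: (measurable_comp_norm h). Qed.

Lemma measurable_ipart g : cmeasurable g -> measurable_fun setT (ipart g).
Proof. by move=> [_ h]; exact: (measurable_comp_norm h). Qed.

(** Bridge from weighted integrals on the half-line to [m]. No integrability enters, since [fine] is
    applied to the same extended real on both sides. *)
Lemma Rintegral_m (h u : R -> R) : measurable_fun setT h ->
  (forall x, 0 <= x -> h x * mu_dens alpha x = u x) ->
  Rintegral mu `[0%R, +oo[ u = Rintegral m setT h.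
Proof.
move=> mh hu; rewrite /Rintegral; congr fine.
have mE : measurable_fun setT (EFin \o h) by exact/measurable_EFinP.
rewrite [RHS](_ : _ = \int[m]_x (EFin \o h) x)%E// integral_on_reals// integral_hmu//.
by apply: eq_integral => x; rewrite inE/= in_itv/= andbT => x0; rewrite -hu// EFinM.
Qed.

Lemma Re_scale (k : R) (z : R[i]) : complex.Re (k%:C%C * z) = k * complex.Re z.
Proof. by case: z => u v /=; rewrite mul0r subr0. Qed.

Lemma Im_scale (k : R) (z : R[i]) : complex.Im (k%:C%C * z) = k * complex.Im z.
Proof. by case: z => u v /=; rewrite mul0r addr0. Qed.

Lemma Re_scaler (k : R) (z : R[i]) : complex.Re (z * k%:C%C) = complex.Re z * k.
Proof. by rewrite mulrC Re_scale mulrC. Qed.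

Lemma Im_scaler (k : R) (z : R[i]) : complex.Im (z * k%:C%C) = complex.Im z * k.
Proof. by rewrite mulrC Im_scale mulrC. Qed.

Lemma cmod_sqr (z : R[i]) : cmod z ^+ 2 = complex.Re z ^+ 2 + complex.Im z ^+ 2.
Proof. by rewrite /cmod sqr_sqrtr// addr_ge0 ?sqr_ge0. Qed.

Lemma hankel_Re g xi : cmeasurable g -> complex.Re (hankel alpha g xi) = hht a m (rpart g) xi.
Proof.
move=> mg; rewrite /hankel /mu_int /cintegral/=; apply: Rintegral_m.
  apply: measurable_funM; first exact: measurable_rpart.
  by apply: (measurableT_comp (measurable_jb (hm_gt H))); exact: measurable_funM.
by move=> x x0; rewrite !Re_scaler j_besselE /rpart ger0_norm.
Qed.

Lemma hankel_Im g xi : cmeasurable g -> complex.Im (hankel alpha g xi) = hht a m (ipart g) xi.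
Proof.
move=> mg; rewrite /hankel /mu_int /cintegral/=; apply: Rintegral_m.
  apply: measurable_funM; first exact: measurable_ipart.
  by apply: (measurableT_comp (measurable_jb (hm_gt H))); exact: measurable_funM.
by move=> x x0; rewrite !Im_scaler j_besselE /ipart ger0_norm.
Qed.

Lemma Rintegral_P (h u : R -> R) : measurable_fun setT h ->
  (forall t, h t * powR (sin t) (2 * alpha) = u t) ->
  cS alpha * Rintegral mu `[0%R, pi] u = Rintegral P setT h.
Proof.
move=> mh hu; have mE : measurable_fun setT (EFin \o h) by exact/measurable_EFinP.
have mu_ : measurable_fun setT u.
  rewrite (_ : u = fun t => h t * powR (sin t) (2 * alpha)); last by apply/funext => t; rewrite hu.
  have mpw : measurable_fun setT (fun x : R => powR x (2 * alpha)) by exact: measurable_powR.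
  have ms : measurable_fun setT (@sin R) by exact: measurable_sin.
  by apply: measurable_funM => //; exact (measurableT_comp mpw ms).
rewrite -Rintegral_domZ//.
rewrite /Rintegral; congr fine.
rewrite [RHS](_ : _ = \int[P]_x (EFin \o h) x)%E// integral_on_reals// integral_hP//.
by apply: eq_integral => t _; rewrite -hu -EFinM; congr EFin; ring.
Qed.

Lemma htrans_Re x (g : R -> R[i]) (h : R -> R) y : measurable_fun setT h ->
  (forall t, 0 <= t -> complex.Re (g t) = h t) ->
  complex.Re (htrans alpha x g y) = htr P h x y.
Proof.
move=> mh gh; rewrite /htrans Re_scale /cintegral/=; apply: Rintegral_P.
  by apply: (measurableT_comp mh); exact: measurable_hw_last.
by move=> t; rewrite Re_scaler -/(hw x y t) gh ?hw_ge0.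
Qed.

Lemma htrans_Im x (g : R -> R[i]) (h : R -> R) y : measurable_fun setT h ->
  (forall t, 0 <= t -> complex.Im (g t) = h t) ->
  complex.Im (htrans alpha x g y) = htr P h x y.
Proof.
move=> mh gh; rewrite /htrans Im_scale /cintegral/=; apply: Rintegral_P.
  by apply: (measurableT_comp mh); exact: measurable_hw_last.
by move=> t; rewrite Im_scaler -/(hw x y t) gh ?hw_ge0.
Qed.

Lemma dil_Re s psi x : 0 < s -> 0 <= x -> complex.Re (dil alpha s psi x) = dl a s (rpart psi) x.
Proof.
move=> s0 x0; rewrite /dil Re_scale /dl /rpart ger0_norm// mulr_ge0// ltW//.
Qed.

Lemma dil_Im s psi x : 0 < s -> 0 <= x -> complex.Im (dil alpha s psi x) = dl a s (ipart psi) x.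
Proof.
move=> s0 x0; rewrite /dil Im_scale /dl /ipart ger0_norm// mulr_ge0// ltW//.
Qed.

(** Obtained for every [x], so that the real and imaginary parts of the transform can be split
    pointwise. The slice is dominated by the angular integral of an integrable function on the
    product. *)
Lemma integrable_cv_slice (f phi : R -> R) x : L2fun m f -> L2fun m phi ->
  m.-integrable setT (EFin \o (fun y => f y * htr P phi x y)).
Proof.
move=> Lf Lp; have iF := integrable_L2_hw H x Lf Lp.
have [mf _] := Lf; have [mp _] := Lp.
have mk : measurable_fun setT (fun y => f y * htr P phi x y).
  by apply: measurable_funM => //; exact: measurable_htrr.
apply/integrableP; split; first exact/measurable_EFinP.
have h := (integrable12ltyP m P (measurable_int _ iF)).1 iF.
apply: le_lt_trans h; apply: ge0_le_integral => //.
- by apply: measurableT_comp => //; exact/measurable_EFinP.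
- apply: (@measurable_fun_fubini_tonelli_F _ _ _ _ _ P (fun q => `|(f q.1 * phi (hw x q.1 q.2))%:E|%E)) => //.
  by apply: measurableT_comp => //; exact: measurable_int iF.
move=> y _ /=; rewrite /htr mulrC -RintegralZr_measurable; last first.
  by apply: (measurableT_comp mp); exact: measurable_hw_last.
apply: (le_trans (le_norm_Rintegral P _)).
  by apply: measurable_funM => //; apply: (measurableT_comp mp); exact: measurable_hw_last.
rewrite le_eqVlt; apply/orP; left; apply/eqP.
by apply: eq_integral => t _; rewrite /= mulrC.
Qed.

Section wavelet.
Variables (psi f : R -> R[i]).
Let p1 := rpart psi.
Let p2 := ipart psi.
Let f1 := rpart f.
Let f2 := ipart f.
Hypotheses (Lp1 : L2fun m p1) (Lp2 : L2fun m p2) (Lf1 : L2fun m f1) (Lf2 : L2fun m f2).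

Lemma hwt_cmod_sqr s x : 0 < s ->
  cmod (hwt alpha psi f (s, x)) ^+ 2 =
  powR (fine (c_psi alpha psi)) (- (1 / 2)) ^+ 2 * wpow a m P p1 p2 f1 f2 (s, x).
Proof.
move=> s0; rewrite cmod_sqr /hwt Re_scale Im_scale !exprMn -mulrDr; congr (_ * _).
have [M1 _] := L2fun_dl H s0 Lp1; have [M2 _] := L2fun_dl H s0 Lp2.
have [mM1 _] := M1; have [mM2 _] := M2.
have [mf1 _] := Lf1; have [mf2 _] := Lf2.
have TR y : complex.Re (htrans alpha x (dil alpha s psi) y) = htr P (dl a s p1) x y.
  by apply: htrans_Re => // t t0; exact: dil_Re.
have TI y : complex.Im (htrans alpha x (dil alpha s psi) y) = htr P (dl a s p2) x y.
  by apply: htrans_Im => // t t0; exact: dil_Im.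
have i11 := integrable_cv_slice x Lf1 M1; have i22 := integrable_cv_slice x Lf2 M2.
have i21 := integrable_cv_slice x Lf2 M1; have i12 := integrable_cv_slice x Lf1 M2.
have conjR (u v : R[i]) : complex.Re (u * v^*%C) = complex.Re u * complex.Re v + complex.Im u * complex.Im v.
  by case: u v => [u1 u2] [v1 v2] /=; rewrite mulrN opprK.
have conjI (u v : R[i]) : complex.Im (u * v^*%C) = complex.Im u * complex.Re v - complex.Re u * complex.Im v.
  by case: u v => [u1 u2] [v1 v2] /=; rewrite mulrN addrC.
rewrite /wpow/=; congr (_ ^+ 2 + _ ^+ 2).
- rewrite /wre /cv -RintegralDT//; apply: Rintegral_m.
    exact: integrable_measurable (integrableDR i11 i22).
  by move=> t t0; rewrite Re_scaler conjR TR TI /f1 /f2 /rpart /ipart ger0_norm.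
- rewrite /wim /cv -RintegralBT//; apply: Rintegral_m.
    exact: integrable_measurable (integrableBR i21 i12).
  by move=> t t0; rewrite Im_scaler conjI TR TI /f1 /f2 /rpart /ipart ger0_norm.
Qed.

End wavelet.

Lemma Lp_int2E g : cmeasurable g -> (Lp_int alpha 2 g = \int[m]_x (rpart g x ^+ 2 + ipart g x ^+ 2)%:E)%E.
Proof.
move=> mg; have mr := measurable_rpart mg; have mi := measurable_ipart mg.
have mE : measurable_fun setT (fun x => (rpart g x ^+ 2 + ipart g x ^+ 2)%:E).
  by apply/measurable_EFinP; apply: measurable_funD; exact: measurable_funX.
rewrite integral_on_reals// integral_hmu// /Lp_int.
apply: eq_integral => x; rewrite inE/= in_itv/= andbT => x0.
rewrite -EFinM powR_mulrn ?sqrtr_ge0// cmod_sqr /rpart /ipart ger0_norm//.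
Qed.

Lemma in_L2P g : cmeasurable g -> (Lp_int alpha 2 g < +oo)%E ->
  [/\ L2fun m (rpart g), L2fun m (ipart g) &
    L2norm2 alpha g = norm2 m (rpart g) + norm2 m (ipart g)].
Proof.
move=> mg; rewrite /L2norm2 Lp_int2E// => goo.
have mr := measurable_rpart mg; have mi := measurable_ipart mg.
have mr2 : measurable_fun setT (fun x => rpart g x ^+ 2) by exact: measurable_funX.
have mi2 : measurable_fun setT (fun x => ipart g x ^+ 2) by exact: measurable_funX.
have Lr : L2fun m (rpart g).
  apply: L2funP => //; apply: le_lt_trans goo; apply: ge0_le_integralR => //.
  - exact: measurable_funD.
  - by move=> x; exact: sqr_ge0.
  - by move=> x; rewrite lerDl sqr_ge0.
have Li : L2fun m (ipart g).
  apply: L2funP => //; apply: le_lt_trans goo; apply: ge0_le_integralR => //.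
  - exact: measurable_funD.
  - by move=> x; exact: sqr_ge0.
  - by move=> x; rewrite lerDr sqr_ge0.
split => //; rewrite (ge0_integralDR _ mr2 mi2 (fun=> sqr_ge0 _) (fun=> sqr_ge0 _)).
by rewrite -!norm2E.
Qed.

(** The exponents [- 2a] and [2 alpha + 1] add up to [-1], the weight of [da / a], which leaves only
    the normalization of the density. *)
Lemma c_psiE psi : cmeasurable psi ->
  (c_psi alpha psi = (hK alpha)%:E * wcst a m (rpart psi) (ipart psi))%E.
Proof.
move=> mpsi; have mr := measurable_rpart mpsi; have mi := measurable_ipart mpsi.
have mw : measurable_fun setT (wpsi a m (rpart psi) (ipart psi)).
  by apply: measurable_funD; apply: measurable_funX; exact: (measurable_hht H).
have mW : measurable_fun setT (fun xi => (wpsi a m (rpart psi) (ipart psi) xi * powR xi (- (2 * a)) * (0 < xi)%R%:R)%:E).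
  apply/measurable_EFinP; apply: measurable_funM; last exact: measurable_pos.
  by apply: measurable_funM => //; exact: measurable_powR.
have W0 xi : (0 <= (wpsi a m (rpart psi) (ipart psi) xi * powR xi (- (2 * a)) * (0 < xi)%R%:R)%:E)%E.
  by rewrite lee_fin !mulr_ge0 ?wpsi_ge0 ?powR_ge0.
rewrite /wcst integral_on_reals// ge0_integral_hmu// muleA -EFinM divff ?mul1e; last first.
  by rewrite gt_eqF// hK_gt0.
rewrite /c_psi; apply: eq_integral => x; rewrite inE/= in_itv/= andbT => x0.
rewrite -EFinM; congr EFin; rewrite cmod_sqr hankel_Re// hankel_Im// x0 mulr1 -mulrA.
congr (_ * _); rewrite -powRD; last by rewrite (gt_eqF x0) implybT.
rewrite (_ : - (2 * a) + (2 * alpha + 1) = -1); last by lra.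
by rewrite powR_inv1// ltW.
Qed.

End HankelDefsLink.

(** * Integration over scales and positions *)

Section RegionIntegral.
Context (R : realType) (alpha : R).
Hypothesis ha : - (1 / 2) < alpha.
Local Notation m := (on_reals (hmu alpha)).
Local Notation mu := (@lebesgue_measure R).
Local Open Scope ereal_scope.

Lemma measurable_nu_dens : measurable_fun setT (nu_dens alpha : R * R -> R).
Proof.
have m1 : measurable_fun setT (fun x : R => powR x (2 * alpha + 1)) by exact: measurable_powR.
apply: measurable_funM; first exact (measurableT_comp m1 measurable_fst).
exact (measurableT_comp (measurable_mu_dens alpha) measurable_snd).
Qed.

Lemma measurable_regionR : measurable (@regionR R : set (R * R)).
Proof. by apply: measurableX; exact: measurable_itv. Qed.

(** The position variable of [nu_alpha] already carries [mu_alpha]; the scale variable carries the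
    same density without its denominator, whence the factor [hK alpha]. *)
Lemma integral_region (g : R * R -> R) : measurable_fun setT g -> (forall z, (0 <= g z)%R) ->
  \int[mu \x mu]_(p in @regionR R) (g p * nu_dens alpha p)%:E =
  (hK alpha)%:E * \int[m \x m]_z (g z * (0 < z.1)%R%:R)%:E.
Proof.
move=> mg g0.
have mpos := @measurable_pos R.
have mpos1 : measurable_fun setT (fun z : R * R => (0 < z.1)%R%:R : R).
  exact (measurableT_comp mpos measurable_fst).
have mgp : measurable_fun setT (fun z => g z * (0 < z.1)%R%:R)%R by exact: measurable_funM.
have gp0 z : (0 <= g z * (0 < z.1)%R%:R)%R by rewrite mulr_ge0.
rewrite (ge0_integral_fubini1 m m mgp gp0).
pose K s := \int[m]_x (g (s, x) * (0 < s)%R%:R)%:E.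
have mK : measurable_fun setT K.
  apply: (@measurable_fun_fubini_tonelli_F _ _ _ _ _ m (fun z => (g z * (0 < z.1)%R%:R)%:E)).
    exact/measurable_EFinP.
  by move=> z; rewrite lee_fin.
have K0 s : 0 <= K s by apply: integral_ge0 => x _; rewrite lee_fin (gp0 (s, x)).
rewrite [X in _ * X](_ : _ = \int[m]_s K s)// integral_on_reals// ge0_integral_hmu//.
rewrite muleA -EFinM divff ?mul1e; last by rewrite gt_eqF// hK_gt0.
have mr := measurable_regionR.
rewrite integral_mkcond.
pose G (z : R * R) : \bar R := (g z * nu_dens alpha z * \1_(@regionR R) z)%:E.
have -> : \int[mu \x mu]_x ((fun p => (g p * nu_dens alpha p)%:E) \_ (@regionR R)) x =
   \int[mu \x mu]_z G z.
  apply: eq_integral => z _; rewrite patchE /G indicE; case: ifPn => _; first by rewrite mulr1.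
  by rewrite mulr0.
have mG : measurable_fun setT G.
  apply/measurable_EFinP; apply: measurable_funM; last exact: measurable_indic.
  by apply: measurable_funM => //; exact: measurable_nu_dens.
have G0 z : 0 <= G z.
  rewrite lee_fin; apply: mulr_ge0; last by rewrite indicE.
  by apply: mulr_ge0 => //; apply: mulr_ge0; [exact: powR_ge0|exact: mu_dens_ge0].
rewrite (@fubini_tonelli1 _ _ _ _ _ mu mu G mG G0) [RHS]integral_mkcond.
apply: eq_integral => s _; rewrite patchE; case: ifPn => [|/negP].
  rewrite inE/= in_itv/= andbT => s0; rewrite /fubini_F /K.
  have mgs : measurable_fun setT (fun x => (g (s, x) * (0 < s)%R%:R)%:E).
    apply/measurable_EFinP; exact (measurableT_comp mgp (pair1_measurable s)).
  rewrite integral_on_reals// integral_hmu//.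
  have mH : measurable_fun (`[0%R, +oo[%classic : set R) (fun x : R => (g (s, x) * (0 < s)%R%:R)%:E * (mu_dens alpha x)%:E).
    apply: measurable_funTS; apply: emeasurable_funM => //.
    by apply/measurable_EFinP; exact: measurable_mu_dens.
  rewrite -ge0_integralZr ?lee_fin ?powR_ge0//; last first.
    by move=> x _; rewrite mule_ge0 ?lee_fin ?mu_dens_ge0// (gp0 (s, x)).
  rewrite [RHS]integral_mkcond; apply: eq_integral => x _.
  rewrite patchE /G /nu_dens indicE /=.
  have -> : ((s, x) \in @regionR R) = (x \in (`[0%R, +oo[%classic : set R)).
    apply/idP/idP; rewrite !inE /regionR/= !in_itv/= !andbT; first by case.
    by split.
  case: ifPn => _; last by rewrite mulr0.
  by rewrite -!EFinM; congr EFin; rewrite s0; ring.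
rewrite inE/= in_itv/= andbT => s0; rewrite /fubini_F.
apply: integral0_eq => x _; rewrite /G indicE memNset ?mulr0//.
by rewrite /regionR/= => -[]; rewrite /= in_itv/= andbT.
Qed.

End RegionIntegral.

(** Both integrals may be infinite; comparing positive and negative parts separately allows an
    entropy equal to [+oo]. *)
Lemma le_integral_gen d (T : measurableType d) (R : realType) (m : {measure set T -> \bar R})
    (D : set T) (f g : T -> R) : measurable D -> measurable_fun D f -> measurable_fun D g ->
  (forall x, D x -> f x <= g x) ->
  (\int[m]_(x in D) (f x)%:E <= \int[m]_(x in D) (g x)%:E)%E.
Proof.
move=> mD mf mg fg; rewrite integralE [leRHS]integralE.
have mF : measurable_fun D (EFin \o f) by exact/measurable_EFinP.
have mG : measurable_fun D (EFin \o g) by exact/measurable_EFinP.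
apply: leeB; apply: ge0_le_integral => //.
- exact: measurable_funepos.
- exact: measurable_funepos.
- by move=> x Dx; rewrite !funeposE ge_max !le_max lexx orbT lee_fin fg.
- exact: measurable_funeneg.
- exact: measurable_funeneg.
- by move=> x Dx; rewrite !funenegE ge_max !le_max lexx orbT leeN2 lee_fin fg.
Qed.

(** * Integrability of the components of a wavelet *)

Section AdmissibleWavelet.
Context (R : realType) (alpha : R).
Hypothesis ha : - (1 / 2) < alpha.
Local Notation m := (on_reals (hmu alpha)).
Local Notation mu := (@lebesgue_measure R).

Let mcmod (g : R -> R[i]) : cmeasurable g -> measurable_fun setT (fun x : R => cmod (g `|x|)).
Proof.
move=> mg; have mr := measurable_rpart mg; have mi := measurable_ipart mg.
apply: (measurableT_comp (@measurable_sqrt R)).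
by apply: measurable_funD; exact: measurable_funX.
Qed.

Lemma Lp_intE (p : R) g : cmeasurable g -> (Lp_int alpha p g = \int[m]_x (powR (cmod (g `|x|)) p)%:E)%E.
Proof.
move=> mg; have mc := mcmod mg.
have mpw : measurable_fun setT (fun x : R => powR x p) by exact: measurable_powR.
have mE : measurable_fun setT (fun x : R => (powR (cmod (g `|x|)) p)%:E).
  by apply/measurable_EFinP; exact (measurableT_comp mpw mc).
rewrite (integral_on_reals _ mE) (integral_hmu alpha mE) /Lp_int.
by apply: eq_integral => x; rewrite inE/= in_itv/= andbT => x0; rewrite -EFinM ger0_norm.
Qed.

Lemma in_L1_parts g : in_Lp alpha 1 g ->
  m.-integrable setT (EFin \o rpart g) /\ m.-integrable setT (EFin \o ipart g).
Proof.
move=> [mg]; rewrite Lp_intE// => goo.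
have mr := measurable_rpart mg; have mi := measurable_ipart mg; have mc := mcmod mg.
have c0 z : 0 <= cmod z :> R by exact: sqrtr_ge0.
have ic : m.-integrable setT (EFin \o (fun x => cmod (g `|x|))).
  apply: ge0_integrable => //; apply: le_lt_trans goo.
  by rewrite le_eqVlt; apply/orP; left; apply/eqP; apply: eq_integral => x _; rewrite powRr1.
split; apply: (le_integrableR _ ic) => // x.
- by rewrite -sqrtr_sqr /cmod ler_wsqrtr// lerDl sqr_ge0.
- by rewrite -sqrtr_sqr /cmod ler_wsqrtr// lerDr sqr_ge0.
Qed.

(** The estimate [|g|^2 <= M |g|] holds almost everywhere; the absolute value of [M] keeps the
    constant nonnegative. *)
Lemma in_L1_Linf_L2 g : in_Lp alpha 1 g -> in_Linf g -> (Lp_int alpha 2 g < +oo)%E.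
Proof.
move=> [mg goo] [_ [M gM]].
have c0 z : 0 <= cmod z :> R by exact: sqrtr_ge0.
have mc := mcmod mg.
have mD (p : R) : measurable_fun (`[0%R, +oo[%classic : set R) (fun x => (powR (cmod (g x)) p * mu_dens alpha x)%:E).
  apply: (eq_measurable_fun (fun x : R => (powR (cmod (g `|x|)) p * mu_dens alpha x)%:E)).
    by move=> x; rewrite inE/= in_itv/= andbT => x0; rewrite ger0_norm.
  apply: measurable_funTS; apply/measurable_EFinP; apply: measurable_funM; last exact: measurable_mu_dens.
  have mpw : measurable_fun setT (fun x : R => powR x p) by exact: measurable_powR.
  exact (measurableT_comp mpw mc).
have D0 p x : (0 <= (powR (cmod (g x)) p * mu_dens alpha x)%:E)%E.
  by rewrite lee_fin; apply: mulr_ge0; [exact: powR_ge0|exact: mu_dens_ge0].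
apply: (@le_lt_trans _ _ (\int[mu]_(x in `[0%R, +oo[) (`|M|%:E * (powR (cmod (g x)) 1 * mu_dens alpha x)%:E))%E).
  apply: ae_ge0_le_integral => //.
  - exact: mD.
  - by move=> x _; rewrite mule_ge0.
  - by apply: emeasurable_funM => //; exact: mD.
  - case: gM => N [mN N0 sub]; exists N; split => // x hx; apply: sub => /= gx; apply: hx.
    rewrite /= in_itv/= andbT => x0.
    rewrite -EFinM lee_fin [leRHS]mulrA; apply: ler_wpM2r; first exact: mu_dens_ge0.
    rewrite powR_mulrn// powRr1// expr2; apply: ler_wpM2r => //.
    by rewrite (le_trans (gx x0))// ler_norm.
rewrite ge0_integralZl//; last exact: mD.
by apply: lte_mul_pinfty.
Qed.

End AdmissibleWavelet.

(** * The entropy inequality *)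

Lemma powR_half_sqr (R : realType) (c : R) : 0 < c -> powR c (- (1 / 2)) ^+ 2 = c^-1.
Proof.
move=> c0; rewrite -powR_mulrn ?powR_ge0// -powRrM -(powR_inv1 (ltW c0)).
by congr powR; lra.
Qed.

(* Also correct when [A * B = 0], since then both logarithms are [ln 0 = 0]. *)
Lemma ln_div_swap (R : realType) (A B c : R) : 0 <= A -> 0 <= B -> 0 < c ->
  ln (c / (B * A)) = - ln (A * B / c).
Proof.
move=> A0 B0 c0; have [M0|M0] := ltP 0 (A * B / c).
  by rewrite -lnV ?posrE// invf_div (mulrC B).
have AB0 : A * B = 0.
  by apply/eqP; rewrite eq_le mulr_ge0// andbT; move: M0; rewrite ler_pdivrMr// mul0r.
by rewrite (mulrC B) AB0 invr0 mulr0 mul0r ln0// oppr0.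
Qed.

Theorem mainTheorem10 (R : realType) (alpha : R) (psi f : R -> R[i]) :
  -(1 / 2) < alpha ->
  admissible alpha psi ->
  ((L2norm2 alpha psi)%:E <= c_psi alpha psi)%E ->
  in_Lp alpha 2 f -> ~ ae_zero f ->
  measurable_fun (@regionR R)
    (fun p => entropy_integrand alpha psi f p * nu_dens alpha p) /\
  (wavelet_entropy_negpart alpha psi f < +oo)%E /\
  (wavelet_entropy alpha psi f >=
     (L2norm2 alpha f *
        ln (fine (c_psi alpha psi) / (L2norm2 alpha psi * L2norm2 alpha f)))%:E)%E.
Proof.
move=> ha [L1psi [Linf [_ [c0 coo]]]] _ [mf foo] _.
have [mpsi _] := L1psi.
have [Lf1 Lf2 Af] := in_L2P mf foo.
have [Lp1 Lp2 Bp] := in_L2P mpsi (in_L1_Linf_L2 L1psi Linf).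
have [ip1 ip2] := in_L1_parts L1psi.
have H := hankel_measures_hmu ha; have HL := half_line_measure_hmu ha.
have [mf1 _] := Lf1; have [mf2 _] := Lf2.
pose w := wpow (alpha + 1) (on_reals (hmu alpha)) (on_reals (hP alpha)) (rpart psi) (ipart psi) (rpart f) (ipart f).
have mw : measurable_fun setT w by apply: measurable_wpow => //; exact: integrable_measurable.
have w0 z : 0 <= w z by exact: wpow_ge0.
set c := fine (c_psi alpha psi).
move: (L2norm2 alpha f) (L2norm2 alpha psi) Af Bp => A B Af Bp.
have cE : c_psi alpha psi = c%:E by rewrite /c fineK// gt0_fin_numE.
have cgt0 : 0 < c by rewrite -lte_fin -cE.
have K0 : 0 < hK alpha by exact: hK_gt0.
have wcE := c_psiE ha mpsi.
set wc := wcst _ _ _ _ in wcE.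
have wcoo : (wc < +oo)%E.
  rewrite ltey; apply/negP => /eqP wcy; move: coo.
  by rewrite wcE wcy gt0_muley ?lte_fin// ltxx.
have wcfin : wc \is a fin_num by rewrite ge0_fin_numE// wcst_ge0.
have iso := wavelet_isometry H HL ip1 ip2 Lp1 Lp2 wcoo Lf1 Lf2.
rewrite -Af in iso.
have cK : c = hK alpha * fine wc by rewrite /c wcE fine_mulEFin.
have cdef : fine (c_psi alpha psi) = c by [].
clearbody c.
have A0 : 0 <= A by rewrite Af addr_ge0 ?norm2_ge0.
have B0 : 0 <= B by rewrite Bp addr_ge0 ?norm2_ge0.
(* A nonnegative function, measurable everywhere, that coincides with the squared modulus of the
   transform on the region. *)
pose v z := c^-1 * w z.
have v0 z : 0 <= v z by rewrite mulr_ge0// invr_ge0 ltW.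
have mv : measurable_fun setT v by exact: measurable_funM.
have hv p : regionR p -> cmod (hwt alpha psi f p) ^+ 2 = v p.
  case: p => s x [/=]; rewrite in_itv/= andbT => s0 _.
  rewrite (hwt_cmod_sqr ha Lp1 Lp2 Lf1 Lf2 x s0) cdef /v.
  by rewrite powR_half_sqr.
pose Mx := A * B / c.
have vM p : regionR p -> v p <= Mx.
  case: p => s x [/=]; rewrite in_itv/= andbT => s0 _.
  rewrite /v /Mx [leRHS]mulrC; apply: ler_wpM2l; first by rewrite invr_ge0 ltW.
  rewrite Af Bp.
  exact: (wpow_le H Lp1 Lp2 x s0 Lf1 Lf2).
have nd0 p : 0 <= nu_dens alpha p :> R.
  by apply: mulr_ge0; [exact: powR_ge0|exact: mu_dens_ge0].
have mnd := @measurable_nu_dens R alpha.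
have mr := @measurable_regionR R.
have total : (\int[lebesgue_measure \x lebesgue_measure]_(p in @regionR R) (v p * nu_dens alpha p)%:E = A%:E)%E.
  rewrite (integral_region ha mv v0).
  have mwp := measurable_wenergy (alpha + 1) (on_reals (hP alpha)) ip1 ip2 mf1 mf2.
  transitivity ((hK alpha)%:E * (c^-1%:E * wenergy (alpha + 1) (on_reals (hmu alpha)) (on_reals (hP alpha)) (rpart psi) (ipart psi) (rpart f) (ipart f)))%E.
    apply: (congr1 (fun z => _ * z)%E); rewrite /wenergy -ge0_integralZR//.
    - by apply: eq_integral => z _; rewrite /v mulrA.
    - by rewrite invr_ge0 ltW.
    - by move=> z; exact: wenergy_ge0.
  (* The factor [hK] of [nu_alpha] and the isometry constant multiply to [c], which cancels the
     normalization of the transform. *)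
  rewrite iso -!EFinM; congr EFin; rewrite cK; field.
  rewrite (gt_eqF K0) andbT; move: cgt0; rewrite cK.
  by have [->|] := eqVneq (fine wc) 0; rewrite ?mulr0 ?ltxx.
pose L := ln (c / (B * A)).
have LE : L = - ln Mx.
  exact: ln_div_swap.
(* Monotonicity of [ln] applies where [v] is positive; where [v] vanishes both sides are [0]. *)
have ent p : regionR p -> v p * L <= entropy_integrand alpha psi f p.
  move=> rp; rewrite /entropy_integrand (hv p rp) LE mulrN lerN2.
  have := v0 p; rewrite le_eqVlt => /predU1P[<-|vp]; first by rewrite !mul0r.
  by rewrite ler_pM2l// ler_ln ?posrE ?vM//; exact: lt_le_trans (vM p rp).
have ment : measurable_fun (@regionR R) (fun p => entropy_integrand alpha psi f p * nu_dens alpha p).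
  apply: (eq_measurable_fun (fun p => - (v p * ln (v p)) * nu_dens alpha p)).
    by move=> p; rewrite inE => rp; rewrite /entropy_integrand hv.
  apply: measurable_funTS; apply: measurable_funM => //.
  apply: measurableT_comp => //; apply: measurable_funM => //.
  exact (measurableT_comp (@measurable_ln R) mv).
have mvn : measurable_fun setT (fun p => v p * nu_dens alpha p) by exact: measurable_funM.
have vn0 p : 0 <= v p * nu_dens alpha p by apply: mulr_ge0; [exact: v0|exact: nd0].
split => //; split.
(* The negative part of the entropy integrand is at most [|L| v], of finite integral [|L| A]. *)
- apply: (@le_lt_trans _ _ (\int[lebesgue_measure \x lebesgue_measure]_(p in @regionR R) (`|L|%:E * (v p * nu_dens alpha p)%:E))%E).
    apply: ge0_le_integral => //.
    + by move=> p _; rewrite lee_fin le_max lexx orbT.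
    + apply/measurable_EFinP; apply: measurable_maxr => //; exact: measurableT_comp.
    + by apply: emeasurable_funM => //; apply: measurable_funTS; exact/measurable_EFinP.
    move=> p rp; rewrite -EFinM lee_fin ge_max; apply/andP; split.
      rewrite -mulNr [leRHS]mulrA; apply: ler_wpM2r; first exact: nd0.
      apply: (@le_trans _ _ (- (v p * L))); first by rewrite lerN2; exact: ent.
      by rewrite -mulrN mulrC; apply: ler_wpM2r => //; rewrite -normrN ler_norm.
    by apply: mulr_ge0 => //; exact: vn0.
  rewrite ge0_integralZl//.
  + by rewrite total -EFinM ltry.
  + by apply: measurable_funTS; exact/measurable_EFinP.
  + by move=> p _; rewrite lee_fin; exact: vn0.
- rewrite /wavelet_entropy.
  (* The minorant [L v] has a sign that depends on [L], so the comparison is the signed one; its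
     integral is [L A]. *)
  apply: (@le_trans _ _ (\int[lebesgue_measure \x lebesgue_measure]_(p in @regionR R) (L * (v p * nu_dens alpha p))%:E)%E); last first.
    apply: le_integral_gen => //.
    + by apply: measurable_funTS; exact: measurable_funM.
    + by move=> p rp; rewrite [leLHS]mulrA (mulrC L); apply: ler_wpM2r; [exact: nd0|exact: ent].
  have iv : (lebesgue_measure \x lebesgue_measure)%E.-integrable (@regionR R) (EFin \o (fun p => v p * nu_dens alpha p)).
    apply/integrableP; split; first by apply: measurable_funTS; exact/measurable_EFinP.
    rewrite (_ : integral _ _ _ = A%:E) ?ltry// -total.
    by apply: eq_integral => p _; rewrite /= (ger0_norm (vn0 p)).
  under eq_integral do rewrite EFinM.
  by rewrite integralZl// total -EFinM mulrC.
Qed.
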